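(* Let $A$ be a rational function of degree $n$ such that $\chi(\mathcal{O}_2^A)<0$. Then for any rational function $B$ of degree $m$ such that the curve $\mathcal{E}_{A,B}$ is irreducible, the inequality $$g(\mathcal{E}_{A,B})>\frac{m-84n+168}{168}$$ holds.
   Context: For rational functions $A,B\in\mathbb{C}(z)$, the curve $\mathcal{E}_{A,B}$ is the plane curve obtained by equating to zero the numerator of $A(x)-B(y)$; when irreducible, $g(\mathcal{E}_{A,B})$ denotes the genus of its desingularization. For a nonconstant rational function $A$, $\mathcal{O}_2^A=(\mathbb{C}\mathbb{P}^1,\nu_2^A)$, where $\nu_2^A(z)$ is the least common multiple of the local degrees of $A$ at the points of $A^{-1}\{z\}$, and its Euler characteristic is $\chi(\mathcal{O}_2^A)=2+\sum_{z\in\mathbb{C}\mathbb{P}^1}\left(\frac{1}{\nu_2^A(z)}-1\right)$. *)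

(* Defs.v *)
From HB Require Import structures.
From mathcomp Require Import all_boot all_order all_algebra finmap generic_quotient.
From mathcomp Require Import mathcomp_extra boolp classical_sets functions.
From mathcomp Require Import cardinality fsbigop reals complex.

Set Implicit Arguments.
Unset Strict Implicit.
Unset Printing Implicit Defensive.

Import Order.TTheory GRing.Theory Num.Theory.
Local Open Scope quotient_scope.
Local Open Scope classical_set_scope.
Local Open Scope ring_scope.

Section RationalFunctions.

Variable C : closedFieldType.

Definition ratfun : Type := {fraction {poly C}}.

(* [repr f] is some fraction p / q representing f, not necessarily in lowest
   terms. *)
Definition ratnum (f : ratfun) : {poly C} :=
  let p := \n_(repr f) in let q := \d_(repr f) in p %/ gcdp p q.

Definition ratden (f : ratfun) : {poly C} :=
  let p := \n_(repr f) in let q := \d_(repr f) in q %/ gcdp p q.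

Definition ratdeg (f : ratfun) : nat :=
  maxn (size (ratnum f)).-1 (size (ratden f)).-1.

(* The projective line: [Some a] is the finite point a and [None] is the point
   at infinity. *)
Definition P1 : Type := option C.

Definition rateval (f : ratfun) (x : P1) : P1 :=
  match x with
  | Some a => if (ratden f).[a] == 0 then None
              else Some ((ratnum f).[a] / (ratden f).[a])
  | None => if (size (ratden f) < size (ratnum f))%N then None
            else Some ((ratnum f)`_(size (ratden f)).-1 / lead_coef (ratden f))
  end.

(* Order of vanishing of f at x; meaningful for f != 0. *)
Definition ratord (f : ratfun) (x : P1) : int :=
  match x with
  | Some a => (mup a (ratnum f))%:Z - (mup a (ratden f))%:Z
  | None => (size (ratden f))%:Z - (size (ratnum f))%:Z
  end.

(* Order at x of f - f(x), or of 1 / f if x is a pole; it is positive when f is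
   not constant, so that taking the absolute value is harmless. *)
Definition locdeg (f : ratfun) (x : P1) : nat :=
  match rateval f x with
  | Some c => absz (ratord (f - tofrac c%:P) x)
  | None => absz (ratord f^-1 x)
  end.

(* In [nu2] and [chi2] the big operators range over arbitrary sets and are
   proper when only finitely many terms differ from the neutral element: this
   holds for every nonconstant f, which has finitely many critical points. *)
Definition nu2 (f : ratfun) (z : P1) : nat :=
  \big[lcmn/1%N]_(x \in [set x : P1 | rateval f x = z]) locdeg f x.

Definition chi2 (f : ratfun) : rat :=
  2 + \sum_(z \in [set: P1]) ((nu2 f z)%:R^-1 - 1 : rat).

(* In {poly {poly C}} the inner variable is x and the outer one is y. For A and
   B in lowest terms, this polynomial is coprime to the common denominator
   (ratden A)(x) * (ratden B)(y) of A(x) - B(y). *)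
Definition curveE (A B : ratfun) : {poly {poly C}} :=
  (ratnum A)%:P * (ratden B)^:P - (ratden A)%:P * (ratnum B)^:P.

End RationalFunctions.

(* The library's [irreducible_poly] is meant for coefficients in a field: it
   ignores factors that are constant in the outer variable. *)
Definition irreducible_elt (D : idomainType) (F : D) : Prop :=
  [/\ F != 0, F \isn't a GRing.unit &
      forall G H : D, F = G * H ->
        G \is a GRing.unit \/ H \is a GRing.unit].

(* phi identifies K with the fraction field of C[x, y] / (F), that is, with the
   field of rational functions on the curve F = 0. *)
Definition function_field (C : closedFieldType) (F : {poly {poly C}})
    (K : fieldType) (phi : {rmorphism {poly {poly C}} -> K}) : Prop :=
  (forall G, phi G = 0 <-> exists H, G = H * F) /\
  (forall z : K, exists G H, phi H != 0 /\ z = phi G / phi H).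

(* The genus of a function field K in one variable over an algebraically closed
   field C, embedded in K by iota. The places of K / C are the points of the
   nonsingular projective model of K, that is, of the desingularization of any
   curve with function field K. *)
Section Genus.

Variables (C : closedFieldType) (K : fieldType) (iota : C -> K).

(* A place is given by its normalized discrete valuation. The value at 0, which
   should be +oo, is set to 0, so that distinct places are distinct functions. *)
Record place : Type := Place {
  pval :> K -> int ;
  pval0 : pval 0 = 0 ;
  pvalM : forall u v, u != 0 -> v != 0 -> pval (u * v) = pval u + pval v ;
  pvalD : forall u v, u != 0 -> v != 0 -> u + v != 0 ->
            Num.min (pval u) (pval v) <= pval (u + v) ;
  pval_const : forall c, c != 0 -> pval (iota c) = 0 ;
  pval_unif : exists2 t, t != 0 & pval t = 1 }.

HB.instance Definition _ := gen_eqMixin place.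
HB.instance Definition _ := gen_choiceMixin place.

Definition divisor : Type := {fsfun place -> int with 0}.

(* All places have degree 1, because C is algebraically closed. *)
Definition divdeg (D : divisor) : int := \sum_(P <- finsupp D) D P.

Definition RRspace (D : divisor) : set K :=
  [set z | z = 0 \/ forall P : place, 0 <= P z + D P].

Definition is_dim (V : set K) (d : nat) : Prop :=
  exists w : 'I_d -> K,
    (forall c : 'rV[C]_d, \sum_(i < d) iota (c 0 i) * w i = 0 -> c = 0) /\
    (forall z, V z <-> exists c : 'rV[C]_d, z = \sum_(i < d) iota (c 0 i) * w i).

Definition RRdim (D : divisor) : nat :=
  xget 0%N [set d | is_dim (RRspace D) d].

(* g = max { deg D - l(D) + 1 | D a divisor }; the maximum exists by Riemann's
   theorem, and it is nonnegative because D = 0 contributes 0. *)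
Definition is_genus (g : nat) : Prop :=
  (forall D : divisor, divdeg D - (RRdim D)%:Z + 1 <= g%:Z) /\
  (exists D : divisor, divdeg D - (RRdim D)%:Z + 1 = g%:Z).

Definition genus : nat := xget 0%N [set g | is_genus g].

End Genus.

Definition curve_genus (C : closedFieldType) (K : fieldType)
    (phi : {rmorphism {poly {poly C}} -> K}) : nat :=
  genus (fun c : C => phi (c%:P)%:P).

(* Main.v *)
(** Let K be the function field of the curve, with [K : C(y)] = n. A place of K
    over (a, b), where A(a) = B(b), satisfies e_a v(x - a) = f_b v(y - b) for the
    local degrees e_a of A and f_b of B. Hence K / C(y) is ramified over b as soon
    as nu(B(b)) does not divide f_b; call such a point bad.

    There are at most 2 (g + n - 1) ramified points. Indeed, the ring of functions
    that are integral over C[y] has a basis f_i, reduced at infinity, with pole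
    orders a_i of sum g + n - 1, and the discriminant det Tr(f_i f_j) is a
    polynomial of degree at most 2 (g + n - 1) that vanishes at every ramified
    point.

    On the other hand the Riemann-Hurwitz formula for B shows that there are more
    than - chi m + 2 bad points, and - chi >= 1 / 42 because chi < 0. So
    2 (g + n - 1) > m / 42 + 2, which implies the claim if m - 84 n + 168 >= 0;
    otherwise there is nothing to prove. *)

Require Import Defs.
From HB Require Import structures.
From mathcomp Require Import all_boot all_order all_algebra reals complex.
From mathcomp Require Import finmap perm generic_quotient.
From mathcomp Require Import boolp classical_sets fsbigop.
From mathcomp Require Import zify ring lra.

Set Implicit Arguments.
Unset Strict Implicit.
Unset Printing Implicit Defensive.

Import Order.TTheory GRing.Theory Num.Theory.
Local Open Scope ring_scope.

(** * Places *)

(** Since the genus is defined as a maximum over divisors, the link with ramification goes through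
    exact dimensions: a reduced basis gives dim L(N D) for large N, and every divisor is compared
    with such an N D up to a principal divisor. This yields sum a_i = g + n - 1, and the
    discriminant of the same basis plays the role of the different.

    Two existence results feed the argument. Chevalley's extension theorem, by Zorn's lemma, puts a
    place over each point (a, b) of the curve, singular or not. Weak approximation bounds the number
    of zeros of a function by its degree and supplies a function of value 1 at a ramified place.

    Points at infinity are removed by coordinate changes: reversing polynomials keeps the shape of
    the equation, and 1 / (y - c) makes any finite set of points of the y-line finite.

    The constant 1 / 42 is Hurwitz's, attained by the triple (2, 3, 7). The strict inequality comes
    from the terms 1 / nu of the bad points themselves. A constant B is treated apart: a negative
    Euler characteristic forces n > 2, which makes the bound negative. *)

Lemma mup_spec (F : fieldType) (b : F) (p : {poly F}) : p != 0 ->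
  exists2 q, q.[b] != 0 & p = q * ('X - b%:P) ^+ mup b p.
Proof.
move=> p0; have [k [q]] := multiplicity_XsubC p b; rewrite p0 /= => qb e.
by exists q => //; rewrite {2}e mupMr // mup_XsubCX eqxx.
Qed.

Section Valuation.

Variables (C : closedFieldType) (K : fieldType) (iota : {rmorphism C -> K}).
Implicit Types (P Q : place iota) (z : K) (p q : {poly C}).

Lemma pval1 P : P 1 = 0.
Proof. by have := pval_const P (oner_neq0 C); rewrite rmorph1. Qed.

Lemma pvalN P z : P (- z) = P z.
Proof.
have [->|z0] := eqVneq z 0; first by rewrite oppr0.
have h1 : (-1 : C) != 0 by rewrite oppr_eq0 oner_neq0.
have := pval_const P h1; rewrite rmorphN1 => h.
by rewrite -mulN1r pvalM ?oppr_eq0 ?oner_neq0 // h add0r.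
Qed.

Lemma pvalV P z : P z^-1 = - P z.
Proof.
have [->|z0] := eqVneq z 0; first by rewrite invr0 pval0 oppr0.
have := pvalM P (invr_neq0 z0) z0; rewrite mulVf // pval1 => h.
by apply/eqP; rewrite eq_sym eqr_oppLR -subr_eq0 opprK addrC -h.
Qed.

Lemma pvalX P z k : P (z ^+ k) = k%:Z * P z.
Proof.
have [->|z0] := eqVneq z 0.
  by rewrite expr0n; case: k => [|k] /=; rewrite ?pval1 pval0 ?mulr0.
elim: k => [|k IH]; first by rewrite expr0 pval1 mul0r.
by rewrite exprS pvalM ?expf_neq0 // IH; lia.
Qed.

Lemma pvalXz P z (k : int) : P (z ^ k) = k * P z.
Proof.
case: k => k; first exact: pvalX.
by rewrite NegzE -exprnN pvalV pvalX; lia.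
Qed.

Lemma pval_div P u v : u != 0 -> v != 0 -> P (u / v) = P u - P v.
Proof. by move=> u0 v0; rewrite pvalM ?invr_neq0 // pvalV. Qed.

Lemma pval_prod P (I : Type) (s : seq I) (F : I -> K) :
  (forall i, F i != 0) -> P (\prod_(i <- s) F i) = \sum_(i <- s) P (F i).
Proof.
move=> F0; elim: s => [|i s IH]; first by rewrite !big_nil pval1.
rewrite !big_cons pvalM ?IH //.
by apply: (big_ind (fun z => z != 0)) => // [|u v]; [exact: oner_neq0|exact: mulf_neq0].
Qed.

(* The inequality v_P(z) >= k, with the convention v_P(0) = +oo that [place]
   does not follow. *)
Definition vge P z (k : int) : Prop := z = 0 \/ k <= P z.

Lemma vge0 P k : vge P 0 k. Proof. by left. Qed.

Lemma vgeP P z k : z != 0 -> vge P z k -> k <= P z.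
Proof. by move=> z0 [] // e; rewrite e eqxx in z0. Qed.

Lemma vgeW P z k l : l <= k -> vge P z k -> vge P z l.
Proof. by move=> lk [->|h]; [left|right; exact: le_trans h]. Qed.

Lemma vgeD P u v k : vge P u k -> vge P v k -> vge P (u + v) k.
Proof.
have [->|u0] := eqVneq u 0; first by rewrite add0r.
have [->|v0] := eqVneq v 0; first by rewrite addr0.
have [->|uv0] := eqVneq (u + v) 0; first by left.
move=> /(vgeP u0) hu /(vgeP v0) hv; right.
by apply: le_trans (pvalD P u0 v0 uv0); rewrite le_min hu hv.
Qed.

Lemma vgeN P u k : vge P u k -> vge P (- u) k.
Proof. by case=> [->|h]; [left; rewrite oppr0|right; rewrite pvalN]. Qed.

Lemma vgeB P u v k : vge P u k -> vge P v k -> vge P (u - v) k.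
Proof. by move=> hu hv; apply: vgeD => //; apply: vgeN. Qed.

Lemma vgeM P u v k l : vge P u k -> vge P v l -> vge P (u * v) (k + l).
Proof.
have [->|u0] := eqVneq u 0; first by rewrite mul0r; left.
have [->|v0] := eqVneq v 0; first by rewrite mulr0; left.
by move=> /(vgeP u0) hu /(vgeP v0) hv; right; rewrite pvalM //; apply: lerD.
Qed.

Lemma vge_const P c : vge P (iota c) 0.
Proof.
have [->|c0] := eqVneq c 0; first by left; rewrite rmorph0.
by right; rewrite pval_const.
Qed.

Lemma vgeX P u k : vge P u 0 -> vge P (u ^+ k) 0.
Proof.
move=> hu; elim: k => [|k IH]; first by right; rewrite expr0 pval1.
by rewrite exprS -[X in vge _ _ X]addr0; apply: vgeM.
Qed.

Lemma vge_sum P (I : Type) (s : seq I) (Pr : pred I) (F : I -> K) k :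
  (forall i, Pr i -> vge P (F i) k) -> vge P (\sum_(i <- s | Pr i) F i) k.
Proof.
move=> h; apply: (big_ind (fun z => vge P z k)) => //; first exact: vge0.
by move=> u v; apply: vgeD.
Qed.

Lemma pval_add_neq0 P u v : u != 0 -> vge P v (P u + 1) -> u + v != 0.
Proof.
move=> u0 hv; apply/eqP => uv0.
have e : v = - u by apply/eqP; rewrite -addr_eq0 addrC uv0.
move: hv; rewrite e => /(vgeP _); rewrite oppr_eq0 pvalN => /(_ u0); lia.
Qed.

(** Otherwise [u = (u + v) - v] would be a difference of elements of value at least [P u + 1]. *)
Lemma pval_add_eq P u v : u != 0 -> vge P v (P u + 1) -> P (u + v) = P u.
Proof.
move=> u0 hv; have uv0 := pval_add_neq0 u0 hv.
have h1 : P u <= P (u + v).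
  apply: (vgeP uv0); apply: vgeD; first by right.
  by apply: vgeW hv; lia.
have h2 : ~ (P u + 1 <= P (u + v)).
  move=> h; have : vge P u (P u + 1).
    rewrite -{1}(addrK v u); apply: vgeB => //; by right.
  by move=> /(vgeP u0); lia.
lia.
Qed.

(** The value p(u), written as a composition of morphisms so that the ring morphism structure is
    inherited. *)
Definition peval (u : K) : {poly C} -> K := horner_eval u \o map_poly iota.

HB.instance Definition _ u := GRing.RMorphism.on (peval u).

Lemma peE u p : peval u p = (map_poly iota p).[u]. Proof. by []. Qed.

Lemma peC u c : peval u c%:P = iota c.
Proof. by rewrite peE map_polyC hornerC. Qed.

Lemma peX u : peval u 'X = u.
Proof. by rewrite peE map_polyX hornerX. Qed.

Lemma peZ u c p : peval u (c *: p) = iota c * peval u p.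
Proof. by rewrite -mul_polyC rmorphM /= peC. Qed.

Lemma peXsubC u c : peval u ('X - c%:P) = u - iota c.
Proof. by rewrite rmorphB /= peX peC. Qed.

Lemma pe_sum u p : peval u p = \sum_(i < size p) iota p`_i * u ^+ i.
Proof.
rewrite peE horner_coef size_map_poly.
by apply: eq_bigr => i _; rewrite coef_map.
Qed.

Lemma pe_shift u b p : peval (u - iota b) p = peval u (p \Po ('X - b%:P)).
Proof.
by rewrite !peE map_comp_poly horner_comp rmorphB /= map_polyX map_polyC !hornerE.
Qed.

Lemma vge_pe P u p : vge P u 0 -> vge P (peval u p) 0.
Proof.
move=> hu; rewrite pe_sum; apply: vge_sum => i _; rewrite -[X in vge _ _ X]addr0.
by apply: vgeM; [exact: vge_const|exact: vgeX].
Qed.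

Lemma pe_root u p b : root p b -> exists q, p = q * ('X - b%:P) /\
  peval u p = peval u q * (u - iota b).
Proof.
by move=> /factor_theorem [q ->]; exists q; rewrite rmorphM /= peXsubC.
Qed.

Lemma vge_pe_sub P u b p : vge P (u - iota b) 1 ->
  vge P (peval u p - iota p.[b]) 1.
Proof.
move=> hu; have hu0 : vge P u 0.
  rewrite -(subrK (iota b) u); apply: vgeD; last exact: vge_const.
  exact: vgeW hu.
have r : root (p - p.[b]%:P) b by rewrite /root !hornerE subrr.
have [q [_]] := pe_root u r; rewrite rmorphB /= peC => ->.
rewrite -[X in vge _ _ X]add0r; apply: vgeM => //; exact: vge_pe.
Qed.

(** p(u) is congruent to the nonzero constant p(b) modulo the maximal ideal of P. *)
Lemma pval_pe_nroot P u b p : vge P (u - iota b) 1 -> p.[b] != 0 ->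
  peval u p != 0 /\ P (peval u p) = 0.
Proof.
move=> hu pb; have i0 : iota p.[b] != 0 by rewrite fmorph_eq0.
have h := vge_pe_sub p hu.
have e : peval u p = iota p.[b] + (peval u p - iota p.[b]) by ring.
have h' : vge P (peval u p - iota p.[b]) (P (iota p.[b]) + 1).
  by rewrite pval_const.
split; first by rewrite e (pval_add_neq0 i0 h').
by rewrite e (pval_add_eq i0 h') pval_const.
Qed.

Lemma pval_pe_mup P u b p : u - iota b != 0 -> vge P (u - iota b) 1 -> p != 0 ->
  peval u p != 0 /\ P (peval u p) = (mup b p)%:Z * P (u - iota b).
Proof.
move=> ub hu p0; have [q qb e] := mup_spec b p0.
have [q0 Pq] := pval_pe_nroot hu qb.
rewrite [in X in X != 0]e [in X in P X]e rmorphM rmorphXn /= peXsubC.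
split; first by rewrite mulf_neq0 // expf_neq0.
by rewrite pvalM ?expf_neq0 // Pq add0r pvalX.
Qed.

Lemma vge_pe_pole P u p (d : nat) : P u < 0 -> (size p <= d.+1)%N ->
  vge P (peval u p) (d%:Z * P u).
Proof.
move=> hu sp; rewrite pe_sum; apply: vge_sum => i _.
rewrite -[X in vge _ _ X]add0r; apply: vgeM; first exact: vge_const.
right; rewrite pvalX; have := ltn_ord i => hi.
have : (i <= d)%N by lia.
nia.
Qed.

(** At a pole of u the leading term has strictly the smallest value. *)
Lemma pval_pe_pole P u p : P u < 0 -> p != 0 ->
  peval u p != 0 /\ P (peval u p) = (size p).-1%:Z * P u.
Proof.
move=> hu p0; have u0 : u != 0 by apply: contraTneq hu => ->; rewrite pval0.
have sp : size p = (size p).-1.+1 by rewrite prednK // size_poly_gt0.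
set d := (size p).-1 in sp *.
have l0 : iota (lead_coef p) * u ^+ d != 0.
  by rewrite mulf_neq0 ?fmorph_eq0 ?lead_coef_eq0 ?expf_neq0.
have Pl : P (iota (lead_coef p) * u ^+ d) = d%:Z * P u.
  by rewrite pvalM ?fmorph_eq0 ?lead_coef_eq0 ?expf_neq0 // pval_const
    ?lead_coef_eq0 // pvalX add0r.
have e : peval u p = iota (lead_coef p) * u ^+ d +
    peval u (\poly_(i < d) p`_i).
  rewrite {1}(_ : p = lead_coef p *: 'X^d + \poly_(i < d) p`_i); last first.
    apply/polyP => i; rewrite coefD coefZ coefXn coef_poly /lead_coef -/d.
    case: (ltngtP i d) => [lt|gt|->]; rewrite ?mulr0 ?mulr1 ?add0r ?addr0 //.
    by rewrite nth_default // sp.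
  by rewrite rmorphD /= peZ rmorphXn /= peX.
have h : vge P (peval u (\poly_(i < d) p`_i)) (P (iota (lead_coef p) * u ^+ d) + 1).
  case: (posnP d) => [d0|dpos].
    left; rewrite (_ : \poly_(i < d) p`_i = 0) ?rmorph0 //.
    by apply/polyP => i; rewrite coef_poly d0 coef0.
  rewrite Pl; apply: vgeW (vge_pe_pole (d := d.-1) hu _); first nia.
  by rewrite prednK //; apply: size_poly.
by rewrite e (pval_add_neq0 l0 h) (pval_add_eq l0 h) Pl.
Qed.

Lemma place_eq P Q : (forall z, P z = Q z) -> P = Q.
Proof.
case: P Q => [p p1 p2 p3 p4 p5] [q q1 q2 q3 q4 q5] /= /funext e.
move: p1 p2 p3 p4 p5; rewrite e => p1 p2 p3 p4 p5.
by congr Place; apply: Prop_irrelevance.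
Qed.

End Valuation.

(** * Degree over a rational subfield *)

Section Independence.

Variables (D : idomainType) (K : fieldType).

(** Used with [D = {poly C}] and [psi = peval iota u], where clearing denominators makes it
    independence over C(u), and with [D = C]. *)
Definition indep (psi : D -> K) (I : finType) (f : I -> K) : Prop :=
  forall p : I -> D, \sum_i psi (p i) * f i = 0 -> forall i, p i = 0.

Variable psi : {rmorphism D -> K}.

Lemma not_indep (I : finType) (f : I -> K) : ~ indep psi f ->
  exists p : I -> D, \sum_i psi (p i) * f i = 0 /\ exists i, p i != 0.
Proof.
move=> h; apply: contrapT => h'; apply: h => p hp i.
apply/eqP; apply: contrapT => /negP pi; apply: h'.
by exists p; split => //; exists i.
Qed.

Lemma indep_comp (I J : finType) (h : J -> I) (f : I -> K) :
  injective h -> indep psi f -> indep psi (f \o h).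
Proof.
move=> hi hf p hp j0.
pose p' i := \sum_(j | h j == i) p j.
have := hf p' _ (h j0); rewrite /p' (big_pred1 j0); last first.
  by move=> j /=; rewrite (inj_eq hi).
apply; rewrite -[RHS]hp (partition_big h xpredT) //=.
apply: eq_bigr => i _; rewrite rmorph_sum big_distrl /=.
by apply: eq_bigr => j /eqP <-.
Qed.

Lemma dep_bound (a b : nat) (g : 'I_b -> K) (f : 'I_a -> K) : (b < a)%N ->
  (forall i, exists (q : D) (c : 'I_b -> D), q != 0 /\
     psi q * f i = \sum_j psi (c j) * g j) -> ~ indep psi f.
Proof.
move=> ab /choice [q /choice [c hqc]] hf.
pose M : 'M[D]_a := \matrix_(i, j) oapp (c i) 0 (insub (val j)).
have : \det M == 0.
  rewrite (expand_det_col M (Ordinal ab)) big1 // => i _.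
  by rewrite mxE /= insubN ?ltnn //= mul0r.
move=> /det0P [v v0 vM].
case/negP: v0; apply/eqP/rowP => i; rewrite mxE.
have := hf (fun i => v 0 i * q i) _ i.
case/(_ _)/Wrap => [|/eqP]; last first.
  rewrite mulf_eq0; case/orP => [/eqP //|qi].
  by have [] := hqc i; rewrite qi.
transitivity (\sum_i \sum_j psi (v 0 i * c i j) * g j).
  apply: eq_bigr => k _; rewrite rmorphM -mulrA; have [_ ->] := hqc k.
  by rewrite big_distrr /=; apply: eq_bigr => j _; rewrite rmorphM mulrA.
rewrite exchange_big /= big1 // => j _.
rewrite -big_distrl -rmorph_sum /=.
have ja : (j < a)%N by apply: ltn_trans ab.
have := congr1 (fun M : 'rV_a => M 0 (Ordinal ja)) vM; rewrite !mxE.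
rewrite (_ : \sum_(i < a) v 0 i * c i j =
  \sum_k v 0 k * M k (Ordinal ja)); first by move=> ->; rewrite rmorph0 mul0r.
apply: eq_bigr => k _; rewrite mxE /=; case: insubP => [u _ eu|]; last first.
  by rewrite ltn_ord.
by congr (_ * c _ _); apply: val_inj.
Qed.

End Independence.

Section Reversal.

Variable R : nzRingType.
Implicit Types p : {poly R}.

(* X^N p(1/X). *)
Definition revp (N : nat) p : {poly R} := \poly_(i < N.+1) p`_(N - i).

Lemma horner_revp (K : fieldType) (psi : {rmorphism R -> K}) N (u : K) p : u != 0 ->
  (size p <= N.+1)%N ->
  (map_poly psi (revp N p)).[u] = u ^+ N * (map_poly psi p).[u^-1].
Proof.
move=> u0 sp.
have -> : (map_poly psi p).[u^-1] = \sum_(i < N.+1) psi p`_i * u^-1 ^+ i.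
  rewrite (horner_coef_wide _ (n := N.+1)).
    by apply: eq_bigr => i _; rewrite coef_map.
  exact: leq_trans (size_poly _ _) sp.
rewrite (horner_coef_wide _ (n := N.+1)); last first.
  exact: leq_trans (size_poly _ _) (size_poly _ _).
rewrite (reindex_inj rev_ord_inj) /= big_distrr /=.
apply: eq_bigr => i _; have hi := ltn_ord i.
rewrite coef_map coef_poly subSS ltnS leq_subr subKn // mulrCA; congr (_ * _).
by rewrite exprVn -expfB_cond // (negbTE u0).
Qed.

Lemma revpK N p : (size p <= N.+1)%N -> revp N (revp N p) = p.
Proof.
move=> sp; apply/polyP => i; rewrite !coef_poly.
case: (leqP i N) => iN; last first.
  by rewrite ltnNge iN /= [RHS]nth_default //; apply: leq_trans sp iN.
by rewrite ltnS iN ltnS leq_subr subKn.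
Qed.

Lemma revp_eq0 N p : (size p <= N.+1)%N -> revp N p = 0 -> p = 0.
Proof.
move=> sp h; rewrite -(revpK sp) h; apply/polyP => i.
by rewrite coef_poly !coef0; case: ifP.
Qed.

End Reversal.

Section DegreeOver.

Variables (C : closedFieldType) (K : fieldType) (iota : {rmorphism C -> K}).
Implicit Types (P Q : place iota) (z u w y : K) (p q : {poly C}).

(* [K : C(u)] = n, phrased without the subfield C(u). *)
Definition deg_over u n : Prop :=
  (exists f : 'I_n -> K, indep (peval iota u) f) /\
  forall f : 'I_n.+1 -> K, ~ indep (peval iota u) f.

Lemma deg_over_max u n (I : finType) (f : I -> K) :
  deg_over u n -> indep (peval iota u) f -> (#|I| <= n)%N.
Proof.
move=> [_ h] hf; rewrite leqNgt; apply/negP => lt.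
apply: (h (fun k : 'I_n.+1 => f (enum_val (widen_ord lt k)))).
apply: (@indep_comp _ _ (peval iota u) _ _ (fun k => enum_val (widen_ord lt k))) => //.
by move=> k l /enum_val_inj /(congr1 val) /= e; apply: val_inj.
Qed.

Lemma deg_over_span u n (f : 'I_n -> K) z :
  deg_over u n -> indep (peval iota u) f -> exists q (p : 'I_n -> {poly C}),
  q != 0 /\ peval iota u q * z = \sum_i peval iota u (p i) * f i.
Proof.
move=> [_ h] hf; have := h (fun i => oapp f z (unlift ord0 i)).
move/not_indep => [p []]; rewrite big_ord_recl unlift_none /=.
under eq_bigr do rewrite liftK /=.
move=> hp [i pi]; exists (p ord0), (fun i => - p (lift ord0 i)); split.
  apply/eqP => p0; move: hp; rewrite p0 rmorph0 mul0r add0r => /hf hp.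
  case: (unliftP ord0 i) => [j e|e]; last by rewrite e p0 eqxx in pi.
  by rewrite e hp eqxx in pi.
under [RHS]eq_bigr do rewrite rmorphN mulNr.
by rewrite sumrN; apply/eqP; rewrite -addr_eq0 hp.
Qed.

Lemma deg_over_rel u n z : deg_over u n -> exists p : 'I_n.+1 -> {poly C},
  \sum_i peval iota u (p i) * z ^+ i = 0 /\ exists i, p i != 0.
Proof. by move=> [_ h]; have /not_indep := h (fun i => z ^+ i). Qed.

Lemma deg_over_transc u n p : (0 < n)%N -> deg_over u n -> peval iota u p = 0 -> p = 0.
Proof.
move=> n0 [[f hf] _] pu; pose i0 := Ordinal n0.
have := hf (fun i => if i == i0 then p else 0) _ i0; rewrite eqxx; apply.
by rewrite big1 // => i _; case: ifP => _; rewrite ?rmorph0 ?pu mul0r.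
Qed.

Lemma deg_over_neq0 u n p : (0 < n)%N -> deg_over u n -> p != 0 -> peval iota u p != 0.
Proof. by move=> n0 hu; apply: contra_neq => /(deg_over_transc n0 hu). Qed.

Lemma deg_over_sub_neq0 u n b : (0 < n)%N -> deg_over u n -> u - iota b != 0.
Proof.
move=> n0 hu; rewrite -peXsubC; apply: (deg_over_neq0 n0 hu).
by rewrite polyXsubC_eq0.
Qed.

Lemma deg_over_gen_neq0 u n : (0 < n)%N -> deg_over u n -> u != 0.
Proof. by move=> n0 hu; have := deg_over_sub_neq0 0 n0 hu; rewrite rmorph0 subr0. Qed.

Lemma indep_shift u b (I : finType) (f : I -> K) :
  indep (peval iota u) f -> indep (peval iota (u - iota b)) f.
Proof.
move=> hf p hp i.
have := hf (fun i => p i \Po ('X - b%:P)) _ i.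
case/(_ _)/Wrap => [|h].
  by rewrite -[RHS]hp; apply: eq_bigr => j _; rewrite pe_shift.
apply/eqP; rewrite -(comp_poly_eq0 (p i) (q := 'X - b%:P)) ?h //.
by rewrite size_XsubC.
Qed.

(** Multiplying a relation over C[u^-1] by a common power of u turns its coefficients into their
    reversals, which are polynomials in u. *)
Lemma indep_inv u (I : finType) (f : I -> K) : u != 0 ->
  indep (peval iota u) f -> indep (peval iota u^-1) f.
Proof.
move=> u0 hf p hp i.
pose N := \max_i size (p i).
have sp j : (size (p j) <= N.+1)%N by apply: leqW; apply: (leq_bigmax j).
apply: (revp_eq0 (sp i)); apply: (hf (fun i => revp N (p i)) _ i).
rewrite (_ : \sum_i _ = u ^+ N * \sum_i peval iota u^-1 (p i) * f i).
  by rewrite hp mulr0.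
by rewrite big_distrr /=; apply: eq_bigr => j _; rewrite !peE horner_revp // mulrA.
Qed.

Lemma deg_over_shift u n b : deg_over u n -> deg_over (u - iota b) n.
Proof.
move=> [[f hf] h]; split; first by exists f; apply: indep_shift.
move=> g /(indep_shift (b := - b)); rewrite rmorphN opprK subrK; exact: h.
Qed.

Lemma deg_over_inv u n : (0 < n)%N -> deg_over u n -> deg_over u^-1 n.
Proof.
move=> n0 hu; have u0 := deg_over_gen_neq0 n0 hu; case: hu => [[f hf] h].
split; first by exists f; apply: indep_inv.
by move=> g /(indep_inv (invr_neq0 u0)); rewrite invrK; apply: h.
Qed.

(** As long as all the coefficients vanish at 0, the relation can be divided by u. The result stays
    nontrivial after reduction modulo u. *)
Lemma dep_reduced u (I : finType) (f : I -> K) : u != 0 ->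
  ~ indep (peval iota u) f ->
  exists p : I -> {poly C},
    \sum_i peval iota u (p i) * f i = 0 /\ exists i, (p i).[0] != 0.
Proof.
move=> u0 /not_indep [p [hp [i pi]]].
move: {2}(size (p i)) (leqnn (size (p i))) => k.
elim: k p hp pi => [|k IH] p hp pi sk.
  by rewrite -size_poly_eq0 -leqn0 sk in pi.
case: (pselect (exists j, (p j).[0] != 0)) => [h|h]; first by exists p.
have r j : exists q, p j = q * 'X.
  have : root (p j) 0.
    by apply/rootP/eqP; apply: contrapT => /negP hj; apply: h; exists j.
  by move=> /factor_theorem [q ->]; exists q; rewrite subr0.
case/choice: r => q hq; apply: (IH q).
- apply/eqP; rewrite -(mulrI_eq0 _ (mulfI u0)) -[X in _ == X]hp; apply/eqP.
  rewrite big_distrr /=; apply: eq_bigr => j _; rewrite [in RHS]hq rmorphM /= peX.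
  by rewrite [peval _ _ _ * u]mulrC -mulrA.
- by apply: contra_neq pi => e; rewrite hq e mul0r.
- move: sk; rewrite hq size_mulX //; apply: contra_neq pi => e.
  by rewrite hq e mul0r.
Qed.

Lemma sum_neq0 P (I : finType) (F : I -> K) i0 : F i0 != 0 ->
  (forall i, i != i0 -> vge P (F i) (P (F i0) + 1)) -> \sum_i F i != 0.
Proof.
by move=> F0 h; rewrite (bigD1 i0) //=; apply: (pval_add_neq0 (P := P) F0); apply: vge_sum.
Qed.

(** The maximal ideal of P is prime, so it contains one of the factors. *)
Lemma prod_vge1 P z (s : seq C) : vge P z 0 ->
  vge P (\prod_(r <- s) (z - iota r)) 1 -> exists c, vge P (z - iota c) 1.
Proof.
move=> hz; elim: s => [|r s IH].
  by rewrite big_nil => /(vgeP (oner_neq0 K)); rewrite pval1.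
rewrite big_cons; case: (pselect (vge P (z - iota r) 1)) => [h|h]; first by exists r.
have zr0 : z - iota r != 0 by apply/eqP => e; apply: h; left.
move=> h1; apply: IH; move: h1.
have [->|p0] := eqVneq (\prod_(j <- s) (z - iota j)) 0; first by left.
move=> /(vgeP (mulf_neq0 zr0 p0)); rewrite pvalM // => h1.
right; have : ~ (1 <= P (z - iota r)) by move=> e; apply: h; right.
have := vgeP zr0 (vgeB hz (vge_const P r)); lia.
Qed.

Lemma pe_splits p : exists s : seq C,
  forall u, peval iota u p = iota (lead_coef p) * \prod_(r <- s) (u - iota r).
Proof.
have [s e] := closed_field_poly_normal p; exists s => u.
rewrite {1}e peZ rmorph_prod /=; congr (_ * _).
by apply: eq_bigr => r _; rewrite peXsubC.
Qed.

(** * Center and residue field of a place *)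

Section Center.

Variables (y : K) (n : nat).
Hypotheses (n0 : (0 < n)%N) (hy : deg_over y n).

(** If no coordinate of the y-line had positive value, P would vanish on all nonzero p(y). The terms
    of a relation of a uniformizer t over C[y] would then have distinct values, so their sum could
    not be 0. *)
Lemma place_center P : exists w, [/\ deg_over w n, 0 < P w &
  (w = y^-1 \/ exists b, w = y - iota b)].
Proof.
have y0 := deg_over_gen_neq0 n0 hy.
case: (ltP (P y) 0) => Py.
  exists y^-1; split; [exact: deg_over_inv|by rewrite pvalV; lia|by left].
apply: contrapT => h.
have h0 b : P (y - iota b) = 0.
  have yb := deg_over_sub_neq0 b n0 hy.
  have h1 : ~ 0 < P (y - iota b).
    move=> h1; apply: h; exists (y - iota b); split => //; last by right; exists b.
    exact: deg_over_shift.
  have hy0 : vge P y 0 by right.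
  have := vgeP yb (vgeB hy0 (vge_const P b)); lia.
have hp p : p != 0 -> P (peval iota y p) = 0.
  move=> p0; have [s ->] := pe_splits p.
  have yb b : y - iota b != 0 := deg_over_sub_neq0 b n0 hy.
  rewrite pvalM ?fmorph_eq0 ?lead_coef_eq0 //; last first.
    by apply: (big_ind (fun z => z != 0)) => // [|u v]; [exact: oner_neq0|exact: mulf_neq0].
  rewrite pval_const ?lead_coef_eq0 // add0r pval_prod //.
  by rewrite big1.
have [t t0 Pt] := pval_unif P.
have [p [hs [i pi]]] := deg_over_rel t hy.
case: (@arg_minnP _ i (fun i => p i != 0) (fun i : 'I_n.+1 => val i) pi) => j pj hj.
have tn (k : 'I_n.+1) : p k != 0 -> peval iota y (p k) * t ^+ k != 0 /\
    P (peval iota y (p k) * t ^+ k) = k%:Z.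
  move=> pk; have e := deg_over_neq0 n0 hy pk.
  split; first by rewrite mulf_neq0 ?expf_neq0.
  by rewrite pvalM ?expf_neq0 // pvalX Pt hp // add0r mulr1.
have [tj Ptj] := tn _ pj.
move: hs; apply/eqP; apply: (sum_neq0 (P := P) (i0 := j)) => // k kj.
have [e|pk] := eqVneq (p k) 0; first by left; rewrite e rmorph0 mul0r.
have [_ Ptk] := tn _ pk; right; rewrite Ptk Ptj.
have /= h1 := hj _ pk.
have h2 : (nat_of_ord k != nat_of_ord j) by apply: contra_neq kj => /val_inj.
by lia.
Qed.

(** Reducing modulo w a relation of z over C[w] gives a nonzero polynomial c over C with c(z) in the
    maximal ideal. As c splits, some [z - iota r] lies there too. *)
Lemma residue P z : vge P z 0 -> exists c, vge P (z - iota c) 1.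
Proof.
move=> hz; have [w [hw Pw _]] := place_center P.
have w0 := deg_over_gen_neq0 n0 hw.
have [p [hs [i pi]]] : exists p : 'I_n.+1 -> {poly C},
    \sum_i peval iota w (p i) * z ^+ i = 0 /\ exists i, (p i).[0] != 0.
  by apply: dep_reduced => //; case: hw.
pose c := \poly_(i < n.+1) (p (inord i)).[0].
have c0 : c != 0.
  apply/eqP => e; have := congr1 (fun q : {poly C} => q`_i) e.
  by rewrite coef_poly ltn_ord coef0 inord_val => /eqP; apply/negP.
have hc : vge P (peval iota z c) 1.
  rewrite /c poly_def rmorph_sum /= -[X in vge _ X _]subr0 -{2}hs -sumrB.
  apply: vge_sum => j _; rewrite peZ rmorphXn /= peX inord_val -mulrBl.
  rewrite -[X in vge _ _ X]addr0; apply: vgeM; last exact: vgeX.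
  rewrite -opprB; apply: vgeN; apply: vge_pe_sub; right.
  by rewrite rmorph0 subr0; lia.
have [s es] := pe_splits c.
move: hc; rewrite es => hc; apply: (prod_vge1 (s := s)) => //.
have l0 : iota (lead_coef c) != 0 by rewrite fmorph_eq0 lead_coef_eq0.
have -> : \prod_(r <- s) (z - iota r) = (iota (lead_coef c))^-1 *
  (iota (lead_coef c) * \prod_(r <- s) (z - iota r)) by rewrite mulKf.
rewrite -[X in vge _ _ X]add0r; apply: vgeM => //.
by rewrite -fmorphV; apply: vge_const.
Qed.

End Center.

End DegreeOver.

(** * Existence of places *)

Section PlaceExistence.

Variables (C : closedFieldType) (K : fieldType) (iota : {rmorphism C -> K}).

Record subring_over (R : set K) : Prop := SubringOver {
  sr_const : forall c, R (iota c) ;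
  sr_add : forall u v, R u -> R v -> R (u + v) ;
  sr_mul : forall u v, R u -> R v -> R (u * v) }.

Section SubringTheory.

Variables (R : set K) (hR : subring_over R).

Lemma sr0 : R 0. Proof. by rewrite -(rmorph0 iota); apply: sr_const. Qed.

Lemma sr1 : R 1. Proof. by rewrite -(rmorph1 iota); apply: sr_const. Qed.

Lemma sr_opp u : R u -> R (- u).
Proof.
move=> hu; rewrite -mulN1r; apply: sr_mul => //.
by rewrite -(rmorphN1 iota); apply: sr_const.
Qed.

Lemma sr_exp u k : R u -> R (u ^+ k).
Proof.
move=> hu; elim: k => [|k IH]; first by rewrite expr0; apply: sr1.
by rewrite exprS; apply: sr_mul.
Qed.

Lemma sr_sum (I : Type) (s : seq I) (Pr : pred I) (F : I -> K) :
  (forall i, Pr i -> R (F i)) -> R (\sum_(i <- s | Pr i) F i).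
Proof.
by move=> h; apply: (big_ind R) => //; [exact: sr0|exact: sr_add].
Qed.

Lemma sr_pe u p : R u -> R (peval iota u p).
Proof.
move=> hu; rewrite pe_sum; apply: sr_sum => i _; apply: sr_mul => //.
  exact: sr_const.
exact: sr_exp.
Qed.

End SubringTheory.

Variables a b : K.

(** The last condition says that the ideal of R generated by a and b is proper; such rings are
    ordered by inclusion as in Chevalley's theorem. *)
Definition proper_pair (R : set K) : Prop :=
  [/\ subring_over R, R a, R b & forall r s, R r -> R s -> a * r + b * s <> 1].

Lemma proper_pair_maximal (R : set K) : proper_pair R ->
  exists V : set K, proper_pair V /\
    forall B : set K, proper_pair B -> (V `<=` B)%classic -> (B `<=` V)%classic.
Proof.
move=> hR; pose P (X : set K) := X = classical_sets.set0 \/ proper_pair X.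
have [F FP tot|A [PA maxA]] := @Zorn_bigcup K P.
  case: (pselect (exists2 X, F X & proper_pair X)) => [[X0 FX0 gX0]|h]; last first.
    left; rewrite -subset0 => x [X FX Xx].
    case: (FP _ FX) => [e|gX]; first by move: Xx; rewrite e.
    by apply: h; exists X.
  right; set U := (\bigcup_(X in F) X)%classic.
  have ne X x : F X -> X x -> proper_pair X.
    by move=> FX Xx; case: (FP _ FX) => // e; move: Xx; rewrite e.
  have two u v : U u -> U v -> exists X, [/\ F X, proper_pair X, X u & X v].
    move=> [X FX Xu] [Y FY Yv]; case: (tot _ _ FX FY) => h.
      by exists Y; split => //; [exact: ne FY Yv|exact: h].
    by exists X; split => //; [exact: ne FX Xu|exact: h].
  case: (gX0) => sX0 aX0 bX0 _.
  split.
  - split.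
    + by move=> c; exists X0 => //; apply: sr_const.
    + move=> u v hu hv; have [X [FX [sX _ _ _] Xu Xv]] := two u v hu hv.
      by exists X => //; apply: sr_add.
    + move=> u v hu hv; have [X [FX [sX _ _ _] Xu Xv]] := two u v hu hv.
      by exists X => //; apply: sr_mul.
  - by exists X0.
  - by exists X0.
  - by move=> r s hr hs; have [X [FX [_ _ _ h] Xr Xs]] := two r s hr hs; apply: h.
have gA : proper_pair A.
  case: PA => // A0; exfalso; apply: (maxA R); last by right.
  rewrite A0; split => // h; case: hR => sR _ _ _.
  by have := h _ (sr1 sR).
exists A; split => // B gB AB; apply: contrapT => BA.
by apply: (maxA B); [split|right].
Qed.

(** * A maximal ring with a proper pair is a valuation ring *)

Section Maximal.

Variable V : set K.
Hypotheses (hV : proper_pair V)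
  (maxV : forall B, proper_pair B -> (V `<=` B)%classic -> (B `<=` V)%classic).

Let sV : subring_over V. Proof. by case: hV. Qed.
Let Va : V a. Proof. by case: hV. Qed.
Let Vb : V b. Proof. by case: hV. Qed.

Definition pair_ideal (x : K) : Prop :=
  exists r s, [/\ V r, V s & x = a * r + b * s].

Lemma pair_ideal1 : ~ pair_ideal 1.
Proof. by move=> [r [s [Vr Vs e]]]; case: hV => _ _ _ /(_ r s Vr Vs); apply. Qed.

Lemma pair_idealD u v : pair_ideal u -> pair_ideal v -> pair_ideal (u + v).
Proof.
move=> [r [s [Vr Vs ->]]] [r' [s' [Vr' Vs' ->]]].
by exists (r + r'), (s + s'); split; [exact: sr_add|exact: sr_add|ring].
Qed.

Lemma pair_idealM u v : V u -> pair_ideal v -> pair_ideal (u * v).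
Proof.
move=> Vu [r [s [Vr Vs ->]]].
by exists (u * r), (u * s); split; [exact: sr_mul|exact: sr_mul|ring].
Qed.

Lemma pair_ideal0 : pair_ideal 0.
Proof. by exists 0, 0; split; [exact: sr0|exact: sr0|ring]. Qed.

Lemma pair_idealV u : pair_ideal u -> V u.
Proof.
by move=> [r [s [Vr Vs ->]]]; apply: sr_add => //; apply: sr_mul.
Qed.

Lemma pair_ideal_sum (I : Type) (s : seq I) (Pr : pred I) (F : I -> K) :
  (forall i, Pr i -> pair_ideal (F i)) -> pair_ideal (\sum_(i <- s | Pr i) F i).
Proof.
move=> h; apply: (big_ind pair_ideal) => //; [exact: pair_ideal0|exact: pair_idealD].
Qed.

(** The localization B of V at the powers of [1 + x] still has a proper pair: if 1 were in aB + bB,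
    some power of [1 + x] would be in the ideal, although it is 1 plus an element of the ideal. By
    maximality B is contained in V. *)
Lemma pair_ideal_inv x : pair_ideal x -> 1 + x != 0 /\ V (1 + x)^-1.
Proof.
move=> Ix; have x0 : 1 + x != 0.
  apply/eqP => e; apply: pair_ideal1.
  have -> : 1 = (-1) * x by rewrite mulN1r; apply/eqP; rewrite -addr_eq0 e.
  by apply: pair_idealM => //; apply: sr_opp => //; apply: sr1.
split => //.
have V1x : V (1 + x) by apply: sr_add => //; [exact: sr1|exact: pair_idealV].
pose B : set K := fun z => exists k, V (z * (1 + x) ^+ k).
have BV : (V `<=` B)%classic by move=> z Vz; exists 0%N; rewrite expr0 mulr1.
have Bk z k l : V (z * (1 + x) ^+ k) -> V (z * (1 + x) ^+ (k + l)).
  by move=> h; rewrite exprD mulrA; apply: sr_mul => //; apply: sr_exp.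
have sB : subring_over B.
  split.
  - by move=> c; apply: BV; apply: sr_const.
  - move=> u v [k hu] [l hv]; exists (k + l)%N; rewrite mulrDl; apply: sr_add => //.
      exact: Bk.
    by rewrite addnC; apply: Bk.
  - move=> u v [k hu] [l hv]; exists (k + l)%N.
    by rewrite exprD mulrACA; apply: sr_mul.
have gB : proper_pair B.
  split => //; try exact: BV.
  move=> r s [k hr] [l hs] e; apply: pair_ideal1.
  have h1 : pair_ideal ((1 + x) ^+ (k + l)).
    exists (r * (1 + x) ^+ (k + l)), (s * (1 + x) ^+ (k + l)); split.
    - exact: Bk.
    - by rewrite addnC; apply: Bk.
    - by rewrite !mulrA -mulrDl e mul1r.
  have h2 m : exists2 x', pair_ideal x' & (1 + x) ^+ m = 1 + x'.
    elim: m => [|m [x' Ix' em]]; first by exists 0; rewrite ?addr0 //; apply: pair_ideal0.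
    exists (x + (1 + x) * x'); last by rewrite exprS em; ring.
    by apply: pair_idealD => //; apply: pair_idealM.
  have [x' Ix' ex] := h2 (k + l)%N.
  have -> : 1 = (1 + x) ^+ (k + l) + (-1) * x' by rewrite ex; ring.
  apply: pair_idealD => //; apply: pair_idealM => //.
  by apply: sr_opp => //; apply: sr1.
apply: (maxV gB BV); exists 1%N; rewrite expr1 mulVf //; exact: sr1.
Qed.

(** A relation showing that the extension of the ideal to V[z] contains 1; its degree is the
    induction measure of Chevalley's argument. *)
Definition ideal_rel z (d : nat) : Prop := exists p : {poly K},
  [/\ forall i, pair_ideal p`_i, (size p <= d.+1)%N & p.[z] = 1].

Lemma ideal_rel_ex z : ~ V z -> exists d, ideal_rel z d.
Proof.
move=> Vz.
pose B : set K := fun x => exists2 p : {poly K}, (forall i, V p`_i) & x = p.[z].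
have BV : (V `<=` B)%classic.
  move=> x Vx; exists x%:P; last by rewrite hornerC.
  by move=> i; rewrite coefC; case: ifP => // _; apply: sr0.
have sB : subring_over B.
  split.
  - by move=> c; apply: BV; apply: sr_const.
  - move=> _ _ [p hp ->] [q hq ->]; exists (p + q); last by rewrite hornerD.
    by move=> i; rewrite coefD; apply: sr_add.
  - move=> _ _ [p hp ->] [q hq ->]; exists (p * q); last by rewrite hornerM.
    by move=> i; rewrite coefM; apply: sr_sum => // j _; apply: sr_mul.
have Bz : B z.
  exists 'X; last by rewrite hornerX.
  by move=> i; rewrite coefX; case: eqP => _; [exact: sr1|exact: sr0].
apply: contrapT => h; apply: Vz; apply: (maxV _ BV Bz).
split => //; try exact: BV.
move=> _ _ [p hp ->] [q hq ->] e; apply: h.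
exists (size (a *: p + b *: q)), (a *: p + b *: q); split => //.
- move=> i; rewrite coefD !coefZ; exists p`_i, q`_i; split => //.
- by rewrite hornerD !hornerZ.
Qed.

(** Induction on [d + l], with [l <= d] by symmetry. In the relation for [z^-1], 1 minus the
    constant term is invertible in V; multiplied by a power of z, this relation expresses the top
    power of z through lower ones, and substitution lowers d. *)
Lemma ideal_rel_False z d l : z != 0 -> ideal_rel z d -> ideal_rel z^-1 l -> False.
Proof.
move: {2}(d + l)%N (leqnn (d + l)) => k; elim: k z d l => [|k IH] z d l.
  rewrite leqn0 addn_eq0 => /andP [/eqP -> _] z0 [p [Ip sp pz]] _.
  apply: pair_ideal1; rewrite -pz (size1_polyC sp) hornerC; exact: Ip.
move=> dl z0.
wlog ld : z d l dl z0 / (l <= d)%N.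
  move=> H h1 h2; case: (leqP l d) => ld; first exact: (H z d l).
  apply: (H z^-1 l d) => //; rewrite ?invrK ?invr_eq0 //; first by rewrite addnC.
  exact: ltnW.
move=> [p [Ip sp pz]] [q [Iq sq qz]].
have [q0 Vq] : 1 + (- q`_0) != 0 /\ V (1 + (- q`_0))^-1.
  apply: pair_ideal_inv; rewrite -mulN1r; apply: pair_idealM => //.
  by apply: sr_opp => //; apply: sr1.
set u := (1 + (- q`_0))^-1 in Vq.
case: l dl ld sq => [|l] dl ld sq.
  by apply: pair_ideal1; rewrite -qz (size1_polyC sq) hornerC; exact: Iq.
case: d dl ld sp => [//|d] dl ld sp.
pose s := \sum_(j < l.+1) (u * q`_(j.+1)) *: 'X^(d - j).
have sz : s.[z] = z ^+ d.+1.
  rewrite /s horner_sum.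
  have e : 1 + (- q`_0) = \sum_(j < l.+1) q`_j.+1 * z ^- j.+1.
    have := qz; rewrite (horner_coef_wide _ sq) big_ord_recl /= expr0 mulr1 => <-.
    rewrite addrAC subrr add0r; apply: eq_bigr => j _.
    by rewrite /= /bump /= ?add1n exprVn.
  rewrite -[RHS]mul1r -(mulVf q0) {2}e -/u -mulrA big_distrl big_distrr /=.
  apply: eq_bigr => j _; rewrite hornerZ hornerXn -!mulrA; congr (_ * (_ * _)).
  have jd : (j < d.+1)%N by apply: leq_trans (ltn_ord j) _.
  rewrite [RHS]mulrC -expfB_cond ?subSS // (negbTE z0).
  exact: jd.
have ss : (size s <= d.+1)%N.
  apply: (leq_trans (size_sum _ _ _)); apply/bigmax_leqP => j _.
  apply: (leq_trans (size_scale_leq _ _)); rewrite size_polyXn ltnS; exact: leq_subr.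
have Is i : pair_ideal s`_i.
  rewrite coef_sum; apply: pair_ideal_sum => j _; rewrite coefZ coefXn.
  case: eqP => _; rewrite ?mulr1 ?mulr0; last exact: pair_ideal0.
  exact: pair_idealM.
apply: (IH z d l.+1) => //; last by exists q.
exists (\poly_(i < d.+1) p`_i + p`_d.+1 *: s); split.
- move=> i; rewrite coefD coef_poly coefZ; apply: pair_idealD.
    by case: ifP => _ //; apply: pair_ideal0.
  by apply: pair_idealM => //; apply: pair_idealV.
- rewrite (leq_trans (size_polyD _ _)) // geq_max size_poly /=.
  exact: leq_trans (size_scale_leq _ _) ss.
- rewrite hornerD hornerZ sz -pz (horner_coef_wide _ sp) big_ord_recr /=.
  by rewrite horner_poly.
Qed.

Lemma max_valuation_ring z : V z \/ V z^-1.
Proof.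
have [->|z0] := eqVneq z 0; first by left; apply: sr0.
apply: contrapT => /not_orP [/ideal_rel_ex [d hd] /ideal_rel_ex [l hl]].
exact: ideal_rel_False hd hl.
Qed.

Definition vunit z : Prop := [/\ z != 0, V z & V z^-1].
Definition nonunit z : Prop := V z /\ ~ vunit z.

Lemma nonunit0 : nonunit 0.
Proof. by split; [exact: sr0|case; rewrite eqxx]. Qed.

Lemma nonunit_a : nonunit a.
Proof.
split => // -[a0 _ Va']; apply: pair_ideal1; exists a^-1, 0.
by split => //; [exact: sr0|rewrite mulfV // mulr0 addr0].
Qed.

Lemma nonunit_b : nonunit b.
Proof.
split => // -[b0 _ Vb']; apply: pair_ideal1; exists 0, b^-1.
by split => //; [exact: sr0|rewrite mulfV // mulr0 add0r].
Qed.

Lemma nonunitM u v : nonunit u -> V v -> nonunit (u * v).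
Proof.
move=> [Vu nu] Vv; split; first exact: sr_mul.
move=> [uv0 Vuv Vuv']; apply: nu; move: (uv0); rewrite mulf_eq0 => /norP [u0 v0].
split => //; have -> : u^-1 = v * (u * v)^-1 by field; rewrite ?u0 ?v0.
exact: sr_mul.
Qed.

Lemma nonunitD u v : nonunit u -> nonunit v -> nonunit (u + v).
Proof.
have [->|u0] := eqVneq u 0; first by rewrite add0r.
have [->|v0] := eqVneq v 0; first by rewrite addr0.
move=> nu nv; case: (max_valuation_ring (u / v)) => h.
  have -> : u + v = v * (u / v + 1) by field.
  by apply: nonunitM => //; apply: sr_add => //; apply: sr1.
have -> : u + v = u * (1 + (u / v)^-1) by field; rewrite u0 v0.
by apply: nonunitM => //; apply: sr_add => //; apply: sr1.
Qed.

Lemma nonunit_sum (I : Type) (s : seq I) (Pr : pred I) (F : I -> K) :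
  (forall i, Pr i -> nonunit (F i)) -> nonunit (\sum_(i <- s | Pr i) F i).
Proof.
move=> h; apply: (big_ind nonunit) => //; [exact: nonunit0|exact: nonunitD].
Qed.

Lemma vunitD u v : vunit u -> nonunit v -> vunit (u + v).
Proof.
move=> hu nv; apply: contrapT => h.
have Vu : V u by case: hu.
have nuv : nonunit (u + v) by split => //; apply: sr_add => //; case: nv.
have nv' : nonunit (v * (-1)).
  by apply: nonunitM => //; apply: sr_opp => //; apply: sr1.
have [_] := nonunitD nuv nv'; rewrite mulrN1 addrK; exact.
Qed.

Lemma vunit1 : vunit 1.
Proof. by split; rewrite ?oner_neq0 ?invr1 //; apply: sr1. Qed.

Lemma vunitM u v : vunit u -> vunit v -> vunit (u * v).
Proof.
by move=> [? ? ?] [? ? ?]; split; rewrite ?mulf_neq0 ?invfM //; apply: sr_mul.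
Qed.

Lemma vunitV u : vunit u -> vunit u^-1.
Proof. by move=> [? ? ?]; split; rewrite ?invr_eq0 ?invrK. Qed.

Lemma vunitX u k : vunit u -> vunit (u ^+ k).
Proof.
move=> hu; elim: k => [|k IH]; first by rewrite expr0; apply: vunit1.
by rewrite exprS; apply: vunitM.
Qed.

Lemma vunit_const c : c != 0 -> vunit (iota c).
Proof.
by move=> c0; split; rewrite ?fmorph_eq0 -?fmorphV //; apply: sr_const.
Qed.

Lemma vunit_prod (I : Type) (s : seq I) (F : I -> K) :
  (forall i, vunit (F i)) -> vunit (\prod_(i <- s) F i).
Proof.
by move=> h; apply: (big_ind vunit) => //; [exact: vunit1|exact: vunitM].
Qed.

(** If instead [z^-1] is in V, then z is the product of [z ^+ k] and a power of [z^-1]. *)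
Lemma vring_root z k : (0 < k)%N -> V (z ^+ k) -> V z.
Proof.
move=> k0 h; case: (max_valuation_ring z) => // h'.
have [->|z0] := eqVneq z 0; first exact: sr0.
have -> : z = z ^+ k * z^-1 ^+ k.-1.
  by case: k k0 {h} => // k _; rewrite exprS /= exprVn mulfK // expf_neq0.
by apply: sr_mul => //; apply: sr_exp.
Qed.

(** Divisibility in V is a total preorder, so some nonzero member of a finite family divides all the
    others. *)
Lemma vring_min (I : eqType) (s : seq I) (T : I -> K) : (exists2 i, i \in s & T i != 0) ->
  exists i0, [/\ i0 \in s, T i0 != 0 & forall j, j \in s -> V (T j / T i0)].
Proof.
elim: s => [|i s IH]; first by case.
move=> [j hj Tj].
have [Ti|Ti] := eqVneq (T i) 0.
  have [|i0 [h1 h2 h3]] := IH.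
    exists j => //; move: hj; rewrite inE => /orP [/eqP e|//].
    by rewrite e Ti eqxx in Tj.
  exists i0; split => //; first by rewrite inE h1 orbT.
  move=> k; rewrite inE => /orP [/eqP ->|]; last exact: h3.
  by rewrite Ti mul0r; apply: sr0.
have Vii : V (T i / T i) by rewrite divff //; apply: sr1.
case: (pselect (exists2 j, j \in s & T j != 0)) => [/IH [i0 [h1 h2 h3]]|h]; last first.
  exists i; split => //; first by rewrite inE eqxx.
  move=> k; rewrite inE => /orP [/eqP -> //|ks].
  have [->|Tk] := eqVneq (T k) 0; first by rewrite mul0r; apply: sr0.
  by exfalso; apply: h; exists k.
case: (max_valuation_ring (T i / T i0)) => h.
  exists i0; split => //; first by rewrite inE h1 orbT.
  by move=> k; rewrite inE => /orP [/eqP ->|] //; apply: h3.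
exists i; split => //; first by rewrite inE eqxx.
move=> k; rewrite inE => /orP [/eqP -> //|ks].
have -> : T k / T i = (T k / T i0) * (T i / T i0)^-1 by field; rewrite Ti h2.
by apply: sr_mul => //; apply: h3.
Qed.

(** If a single term had the minimal value, dividing the sum by it would give 1 plus a nonunit,
    which is a unit and not 0. *)
Lemma vring_tie (I : finType) (T : I -> K) : \sum_i T i = 0 ->
  (exists i, T i != 0) ->
  exists i j, [/\ i != j, T i != 0, T j != 0 & vunit (T i / T j)].
Proof.
move=> hs [i Ti]; have [|i0 [_ h2 h3]] := @vring_min _ (enum I) T.
  by exists i => //; rewrite mem_enum.
apply: contrapT => h.
have hn j : j != i0 -> nonunit (T j / T i0).
  move=> ji; split; first by apply: h3; rewrite mem_enum.
  move=> hu; apply: h; exists j, i0; split => //.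
  by case: hu; rewrite mulf_eq0 => /norP [].
have : vunit (\sum_i T i / T i0).
  rewrite (bigD1 i0) //= divff //; apply: vunitD; first exact: vunit1.
  exact: nonunit_sum.
by rewrite -big_distrl /= hs mul0r => -[]; rewrite eqxx.
Qed.

Variables (y : K) (n : nat).
Hypotheses (n0 : (0 < n)%N) (hy : deg_over iota y n) (a0 : a != 0).

(** Otherwise every [u - c], hence every nonzero p(u), is a unit. Two terms of a relation of [a^-1]
    over C[u] tie, so a power of [a^-1] is a unit and [a^-1] is in V, against [nonunit_a]. *)
Lemma vring_center_aux u : deg_over iota u n -> V u ->
  exists c, nonunit (u - iota c).
Proof.
move=> hu Vu; apply: contrapT => h.
have hc c : vunit (u - iota c).
  apply: contrapT => h'; apply: h; exists c; split => //.
  by apply: sr_add => //; apply: sr_opp => //; apply: sr_const.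
have hp p : p != 0 -> vunit (peval iota u p).
  move=> p0; have [s ->] := pe_splits iota p; apply: vunitM.
    by apply: vunit_const; rewrite lead_coef_eq0.
  exact: vunit_prod.
have [_] := nonunit_a; apply; split => //.
set z := a^-1; have z0 : z != 0 by rewrite invr_eq0.
have [p [hs [i pi]]] := deg_over_rel z hu.
have [|j [k [jk]]] := vring_tie (T := fun i : 'I_n.+1 => peval iota u (p i) * z ^+ i) hs.
  by exists i; rewrite mulf_neq0 ?expf_neq0 //; case: (hp _ pi).
wlog kj : j k jk / (k < j)%N.
  move=> H h1 h2 h3; case: (ltngtP k j) => kj.
  - exact: (H j k).
  - apply: (H k j) => //; first by rewrite eq_sym.
    by rewrite -[_ / _]invrK invf_div; apply: vunitV.
  - by rewrite (val_inj kj) eqxx in jk.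
rewrite !mulf_eq0 => /norP [h1 _] /norP [h2 _] hu1.
have pj : p j != 0 by apply: contra_neq h1 => ->; rewrite rmorph0.
have pk : p k != 0 by apply: contra_neq h2 => ->; rewrite rmorph0.
have : vunit (z ^+ (j - k)).
  have -> : z ^+ (j - k) = peval iota u (p j) * z ^+ j / (peval iota u (p k) * z ^+ k) *
    (peval iota u (p k) / peval iota u (p j)).
    rewrite expfB //.
    by field; rewrite h1 h2 expf_neq0.
  apply: vunitM => //; apply: vunitM; first exact: hp.
  by apply: vunitV; apply: hp.
by move=> [_ /vring_root]; rewrite subn_gt0 => h3 _; apply: h3.
Qed.

Lemma vring_center : exists w, deg_over iota w n /\ nonunit w.
Proof.
case: (max_valuation_ring y) => h.
  have [c hc] := vring_center_aux hy h; exists (y - iota c); split => //.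
  exact: deg_over_shift.
have hy' := deg_over_inv n0 hy.
have [c hc] := vring_center_aux hy' h; exists (y^-1 - iota c); split => //.
exact: deg_over_shift.
Qed.

(** * The valuation of V is discrete *)

Section Discrete.

Variable w : K.
Hypotheses (hw : deg_over iota w n) (nw : nonunit w).

Let w0 : w != 0 := deg_over_gen_neq0 n0 hw.

Lemma vring_pe p : p != 0 -> exists k : nat, vunit (peval iota w p / w ^+ k).
Proof.
move=> p0; have [q q0 e] := mup_spec 0 p0; exists (mup 0 p).
rewrite {1}e subr0 rmorphM rmorphXn /= peX mulfK ?expf_neq0 //.
have r : root (q - q.[0]%:P) 0 by rewrite /root !hornerE subrr.
have [s [_]] := pe_root iota w r; rewrite rmorph0 subr0 rmorphB /= peC => es.
have -> : peval iota w q = iota q.[0] + w * peval iota w s by rewrite mulrC -es; ring.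
apply: vunitD; first exact: vunit_const.
by apply: nonunitM => //; apply: sr_pe => //; case: nw.
Qed.

Lemma vring_expz (s : int) : V (w ^ s) -> 0 <= s.
Proof.
case: s => k // h; exfalso; case: nw => Vw; apply; split => //.
have -> : w^-1 = w ^+ k * w ^ Negz k.
  by rewrite NegzE -exprnN exprS invfM mulrCA mulfV ?mulr1 // expf_neq0.
by apply: sr_mul => //; apply: sr_exp.
Qed.

Lemma vunit_expz_eq0 (s : int) : vunit (w ^ s) -> s = 0.
Proof.
move=> [_ h1]; rewrite invr_expz => h2.
have := vring_expz h1; have := vring_expz h2; lia.
Qed.

(** Every exponent from 1 to n divides N, so the single exponent N serves for all elements z. *)
Let N := n`!.

(* Two terms of a polynomial relation of degree n satisfied by z over C(w) have
   the same value, so that z^k is a unit times a power of w for some 0 < k <= n. *)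
Lemma vring_value z : z != 0 -> exists s : int, vunit (z ^+ N * w ^ s).
Proof.
move=> z0; have [p [hs [i pi]]] := deg_over_rel z hw.
have hp q : q != 0 -> peval iota w q != 0 := deg_over_neq0 n0 hw.
have [|j [k [jk]]] := vring_tie (T := fun i : 'I_n.+1 => peval iota w (p i) * z ^+ i) hs.
  by exists i; rewrite mulf_neq0 ?expf_neq0 ?hp.
wlog kj : j k jk / (k < j)%N.
  move=> H h1 h2 h3; case: (ltngtP k j) => kj.
  - exact: (H j k).
  - apply: (H k j) => //; first by rewrite eq_sym.
    by rewrite -[_ / _]invrK invf_div; apply: vunitV.
  - by rewrite (val_inj kj) eqxx in jk.
rewrite !mulf_eq0 => /norP [h1 _] /norP [h2 _] hu1.
have pj : p j != 0 by apply: contra_neq h1 => ->; rewrite rmorph0.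
have pk : p k != 0 by apply: contra_neq h2 => ->; rewrite rmorph0.
have [r hr] := vring_pe pj; have [t ht] := vring_pe pk.
have hu2 : vunit (z ^+ (j - k) * w ^ (r%:Z - t%:Z)).
  have -> : z ^+ (j - k) * w ^ (r%:Z - t%:Z) =
    peval iota w (p j) * z ^+ j / (peval iota w (p k) * z ^+ k) *
    ((peval iota w (p k) / w ^+ t) / (peval iota w (p j) / w ^+ r)).
    rewrite expfB // expfzDr // -exprnN -!exprnP.
    by field; rewrite h1 h2 !expf_neq0.
  by apply: vunitM => //; apply: vunitM => //; apply: vunitV.
have dv : (j - k %| N)%N.
  rewrite dvdn_fact // subn_gt0 kj /=.
  by have := ltn_ord j; lia.
exists ((r%:Z - t%:Z) * (N %/ (j - k))%N%:Z).
rewrite -exprz_exp -{1}(divnK dv) mulnC exprM -exprnP -exprMn.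
exact: vunitX.
Qed.

(** N times the valuation normalized by giving w the value 1; the factor N makes it an integer. *)
Definition vring_val z : int := xget 0 [set s : int | vunit (z ^+ N * w ^ (- s))]%classic.

Lemma vring_valP z : z != 0 -> vunit (z ^+ N * w ^ (- vring_val z)).
Proof.
move=> z0; apply: (@xgetPex _ 0 [set s : int | vunit (z ^+ N * w ^ (- s))]%classic).
by have [s hs] := vring_value z0; exists (- s); rewrite /= opprK.
Qed.

Lemma vring_val_unique z s : z != 0 -> vunit (z ^+ N * w ^ (- s)) -> vring_val z = s.
Proof.
move=> z0 h; have h' := vring_valP z0.
have : vunit (w ^ (vring_val z - s)).
  have -> : w ^ (vring_val z - s) = z ^+ N * w ^ (- s) / (z ^+ N * w ^ (- vring_val z)).
    rewrite expfzDr // -[w ^ (- vring_val z)]invr_expz.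
    by field; rewrite !expf_neq0 // expfz_neq0.
  by apply: vunitM => //; apply: vunitV.
by move/vunit_expz_eq0; lia.
Qed.

Lemma vring_valM u v : u != 0 -> v != 0 ->
  vring_val (u * v) = vring_val u + vring_val v.
Proof.
move=> u0 v0; apply: vring_val_unique; first by rewrite mulf_neq0.
rewrite opprD expfzDr // exprMn mulrACA.
by apply: vunitM; apply: vring_valP.
Qed.

Lemma vring_valV u : u != 0 -> vring_val u^-1 = - vring_val u.
Proof.
move=> u0; apply: vring_val_unique; first by rewrite invr_eq0.
rewrite -invr_expz exprVn -invfM; apply: vunitV; exact: vring_valP.
Qed.

Lemma vring_val_ge0 z : z != 0 -> V z <-> 0 <= vring_val z.
Proof.
move=> z0; have hz := vring_valP z0; split => h.
  apply: vring_expz.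
  have -> : w ^ vring_val z = z ^+ N * (z ^+ N * w ^ (- vring_val z))^-1.
    rewrite -[w ^ (- vring_val z)]invr_expz.
    by field; rewrite !expf_neq0 // expfz_neq0.
  apply: sr_mul => //; first exact: sr_exp.
  by case: hz.
apply: (@vring_root _ N); first exact: fact_gt0.
have -> : z ^+ N = (z ^+ N * w ^ (- vring_val z)) * w ^+ `|vring_val z|%N.
  by rewrite [w ^+ _]exprnP gez0_abs // -mulrA -expfzDr // addNr expr0z mulr1.
by apply: sr_mul => //; [case: hz|apply: sr_exp => //; case: nw].
Qed.

Lemma vring_valD u v : u != 0 -> v != 0 -> u + v != 0 ->
  Num.min (vring_val u) (vring_val v) <= vring_val (u + v).
Proof.
wlog h : u v / V (u / v) => [H u0 v0 uv0|u0 v0 uv0].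
  case: (max_valuation_ring (u / v)) => h; first exact: H.
  by rewrite minC [u + v]addrC; apply: H => //; rewrite -?[v / u]invf_div // addrC.
have e : u + v = v * (u / v + 1) by field.
have e0 : u / v + 1 != 0 by apply: contra_neq uv0 => e'; rewrite e e' mulr0.
rewrite e vring_valM // ge_min; apply/orP; right; rewrite lerDl.
by apply/vring_val_ge0 => //; apply: sr_add => //; apply: sr1.
Qed.

Lemma vring_val_w : vring_val w = N%:Z.
Proof.
apply: vring_val_unique => //.
by rewrite exprnP -expfzDr // subrr expr0z; apply: vunit1.
Qed.

(** The values form a nonzero subgroup of the integers; Euclidean division shows that its least
    positive element d generates it. Division by d then gives the normalized valuation. *)
Lemma vring_val_min : exists2 d : nat, (0 < d)%N &
  (exists2 t, t != 0 & vring_val t = d%:Z) /\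
  forall z, z != 0 -> (d %| vring_val z)%Z.
Proof.
pose Pr := [pred d : nat | (0 < d)%N && `[< exists2 t, t != 0 & vring_val t = d%:Z >]].
have ex : exists d, Pr d.
  exists N; rewrite /= fact_gt0 /=; apply/asboolP; exists w => //; exact: vring_val_w.
have [d /andP [d0 /asboolP [t t0 td]] dmin] := ex_minnP ex.
exists d => //; split; first by exists t.
move=> z z0; have dz0 : d%:Z != 0 by lia.
have vX u (k : int) : u != 0 -> vring_val (u ^ k) = k * vring_val u.
  move=> u0; have vX' (l : nat) : vring_val (u ^+ l) = l%:Z * vring_val u.
    elim: l => [|l IH]; last by rewrite exprS vring_valM ?expf_neq0 // IH; lia.
    rewrite expr0 mul0r; apply: vring_val_unique; first exact: oner_neq0.
    by rewrite expr1n expr0z mulr1; apply: vunit1.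
  case: k => l; first exact: vX'.
  by rewrite NegzE -exprnN vring_valV ?expf_neq0 // vX'; lia.
pose q := (vring_val z %/ d%:Z)%Z.
have z'0 : z * t ^ (- q) != 0 by rewrite mulf_neq0 ?expfz_neq0.
have e : vring_val (z * t ^ (- q)) = (vring_val z %% d%:Z)%Z.
  by rewrite vring_valM ?expfz_neq0 // vX // td {1}(divz_eq (vring_val z) d%:Z) -/q; lia.
apply/dvdz_mod0P/eqP/negPn/negP => ne.
have ge := modz_ge0 (vring_val z) dz0.
have lt := ltz_pmod (vring_val z) (d := d%:Z) d0.
have := dmin `|(vring_val z %% d%:Z)%Z|%N.
case/(_ _)/Wrap; last by lia.
apply/andP; split; first by lia.
by apply/asboolP; exists (z * t ^ (- q)) => //; rewrite e; lia.
Qed.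

Lemma vring_place : exists P : place iota,
  forall z, z != 0 -> nonunit z -> 0 < P z.
Proof.
have [d d0 [[t t0 td] dv]] := vring_val_min.
pose v z : int := if z == 0 then 0 else (vring_val z %/ d%:Z)%Z.
have vE z : z != 0 -> vring_val z = v z * d%:Z.
  by move=> z0; rewrite /v (negbTE z0) divzK // dv.
have v0 : v 0 = 0 by rewrite /v eqxx.
have dp : 0 < d%:Z by lia.
have vM u1 u2 : u1 != 0 -> u2 != 0 -> v (u1 * u2) = v u1 + v u2.
  move=> u10 u20; apply: (mulIf (lt0r_neq0 dp)); rewrite mulrDl -!vE ?mulf_neq0 //.
  exact: vring_valM.
have vD u1 u2 : u1 != 0 -> u2 != 0 -> u1 + u2 != 0 -> Num.min (v u1) (v u2) <= v (u1 + u2).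
  move=> h1 h2 h3; rewrite -(ler_pM2r dp) -vE // (minr_pMl _ _ (ltW dp)) -!vE //.
  exact: vring_valD.
have vc c : c != 0 -> v (iota c) = 0.
  move=> c0; have i0 : iota c != 0 by rewrite fmorph_eq0.
  apply: (mulIf (lt0r_neq0 dp)); rewrite mul0r -vE //.
  apply: vring_val_unique => //; rewrite oppr0 expr0z mulr1.
  by apply: vunitX; apply: vunit_const.
have vu : exists2 t, t != 0 & v t = 1.
  exists t => //; apply: (mulIf (lt0r_neq0 dp)); rewrite mul1r -vE //.
exists (Place v0 vM vD vc vu) => z z0 [Vz nz] /=.
have h1 : 0 <= vring_val z by apply/vring_val_ge0.
have h2 : ~ vring_val z <= 0.
  move=> h2; apply: nz; split => //; apply/vring_val_ge0; rewrite ?invr_eq0 //.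
  by rewrite vring_valV //; lia.
by have := vE _ z0; nia.
Qed.

End Discrete.

End Maximal.

(** Chevalley's extension theorem: the maximal ring is a valuation ring, and it is discrete because
    K is finite over C(w) for some w in its maximal ideal. *)
Theorem place_exists (y : K) (n : nat) (R : set K) : (0 < n)%N -> deg_over iota y n ->
  a != 0 -> proper_pair R -> exists P : place iota, vge P a 1 /\ vge P b 1.
Proof.
move=> n0 hy a0 /proper_pair_maximal [V [hV maxV]].
have [w [hw nw]] := vring_center hV maxV n0 hy a0.
have [P hP] := vring_place hV maxV n0 a0 hw nw.
exists P; split; first by right; have := hP _ a0 (nonunit_a hV); lia.
have [->|b0] := eqVneq b 0; first by left.
by right; have := hP _ b0 (nonunit_b hV); lia.
Qed.

End PlaceExistence.

(** * Weak approximation *)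

Section Approximation.

Variables (C : closedFieldType) (K : fieldType) (iota : {rmorphism C -> K}).
Implicit Types (P Q : place iota) (z u w y : K) (p q : {poly C}).

Lemma pe_const_neq0 u p : (forall c, u <> iota c) -> p != 0 -> peval iota u p != 0.
Proof.
move=> hu p0; have [s ->] := pe_splits iota p.
rewrite mulf_neq0 ?fmorph_eq0 ?lead_coef_eq0 //.
apply: (big_ind (fun z => z != 0)) => [|v1 v2|r _].
- exact: oner_neq0.
- exact: mulf_neq0.
- by rewrite subr_eq0; apply/eqP.
Qed.

(** If z is not constant, [z^-1] is transcendental over C and generates a proper ideal of C[z^-1]; a
    place over this ideal is a pole of z. The second element of the pair is 0. *)
Lemma regular_const y n z : (0 < n)%N -> deg_over iota y n ->
  (forall P, vge P z 0) -> exists c, z = iota c.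
Proof.
move=> n0 hy hz; apply: contrapT => nc.
have z0 : z != 0 by apply/eqP => e; apply: nc; exists 0; rewrite rmorph0.
have hc c : z^-1 <> iota c.
  by move=> e; apply: nc; exists c^-1; rewrite fmorphV -e invrK.
have a0 : z^-1 != 0 by rewrite invr_eq0.
have pp : proper_pair iota z^-1 0 (fun x => exists p, x = peval iota z^-1 p).
  split.
  - split.
    + by move=> c; exists c%:P; rewrite peC.
    + by move=> _ _ [p ->] [q ->]; exists (p + q); rewrite rmorphD.
    + by move=> _ _ [p ->] [q ->]; exists (p * q); rewrite rmorphM.
  - by exists 'X; rewrite peX.
  - by exists 0; rewrite rmorph0.
  - move=> _ s [p ->] _; rewrite mul0r addr0 => e.
    have : 'X * p - 1 != 0.
      apply/eqP => /(congr1 (fun q : {poly C} => q.[0])).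
      rewrite !hornerE ?mul0r ?sub0r => /eqP; rewrite oppr_eq0.
      by apply/negP; apply: oner_neq0.
    by move/(pe_const_neq0 hc); rewrite rmorphB rmorphM rmorph1 /= peX e subrr eqxx.
have [P [/(vgeP a0) h _]] := place_exists n0 hy a0 pp.
have := vgeP z0 (hz P); move: h; rewrite pvalV; lia.
Qed.

Lemma regular_zero y n z P : (0 < n)%N -> deg_over iota y n ->
  (forall Q, vge Q z 0) -> vge P z 1 -> z = 0.
Proof.
move=> n0 hy hz; have [c ->] := regular_const n0 hy hz.
have [->|c0] := eqVneq c 0; first by rewrite rmorph0.
by move=> /vgeP; rewrite fmorph_eq0 pval_const // => /(_ c0).
Qed.

(** If the valuation ring of P1 lies in that of Q1, then Q1 is a multiple of P1, and normalization
    forces equality. Applied in both directions, this gives z1 and z2, whose quotient separates P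
    and Q. *)
Lemma place_separate P Q : P <> Q -> exists z, [/\ z != 0, P z < 0 & 0 < Q z].
Proof.
have half (P1 Q1 : place iota) : P1 <> Q1 -> exists z, [/\ z != 0, 0 <= P1 z & Q1 z < 0].
  move=> PQ; apply: contrapT => h; apply: PQ.
  have h' z : z != 0 -> 0 <= P1 z -> 0 <= Q1 z.
    move=> z0 Pz; rewrite leNgt; apply/negP => lt.
    by apply: h; exists z.
  have [t t0 Pt] := pval_unif P1.
  have Qt z : z != 0 -> Q1 z = P1 z * Q1 t.
    move=> z0; pose v := z * t ^ (- P1 z).
    have v0 : v != 0 by rewrite mulf_neq0 // expfz_neq0.
    have Pv : P1 v = 0 by rewrite pvalM ?expfz_neq0 // pvalXz Pt; lia.
    have h1 := h' _ v0; rewrite Pv in h1.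
    have h2 : 0 <= Q1 v^-1 by apply: h'; rewrite ?invr_eq0 // pvalV Pv.
    move: (h1 isT) h2; rewrite pvalV pvalM ?expfz_neq0 // pvalXz; lia.
  have [t' t'0 Qt'] := pval_unif Q1.
  have Q1t : Q1 t = 1.
    have := h' _ t0; rewrite Pt => /(_ isT) h1.
    have := Qt _ t'0; rewrite Qt' => h2.
    case: (ltrgtP (Q1 t) 1) => // h3.
      have e : Q1 t = 0 by lia.
      by rewrite e mulr0 in h2.
    by case: (leP (P1 t') 0) => h4; nia.
  apply: place_eq => z; have [->|z0] := eqVneq z 0; first by rewrite !pval0.
  by rewrite (Qt _ z0) Q1t mulr1.
move=> PQ; have [z1 [z10 a1 a2]] := half _ _ PQ.
have [z2 [z20 b1 b2]] := half _ _ (nesym PQ).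
exists (z2 / z1); split; first by rewrite mulf_neq0 ?invr_eq0.
  by rewrite pval_div //; lia.
by rewrite pval_div //; lia.
Qed.

Lemma approx_sign P (s : seq (place iota)) : P \notin s ->
  exists z, [/\ z != 0, P z < 0 & forall Q, Q \in s -> 0 < Q z].
Proof.
elim: s => [_|Q s IH].
  have [t t0 Pt] := pval_unif P.
  by exists t^-1; split; rewrite ?invr_eq0 // pvalV Pt.
rewrite inE negb_or => /andP [PQ /IH [z [z0 Pz hz]]].
have [v [v0 Pv Qv]] := place_separate (elimN eqP PQ).
(* The exponent r is so large that at the places of s the positive value of [z ^+ r] outweighs that
   of v. *)
pose r := (\sum_(Q' <- s) `|Q' v|)%N.+1.
have rQ Q' : Q' \in s -> 0 < r%:Z * Q' z + Q' v.
  move=> Q's; have h1 := hz _ Q's.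
  have h2 : (`|Q' v|%N <= \sum_(Q' <- s) `|Q' v|)%N.
    by rewrite (big_rem Q') //= leq_addr.
  have h3 : `|Q' v|%N%:Z < r%:Z by rewrite /r; lia.
  have : - `|Q' v|%N%:Z <= Q' v by lia.
  nia.
case: (leP 0 (Q z)) => Qz.
  exists (z ^+ r * v); split; first by rewrite mulf_neq0 ?expf_neq0.
    by rewrite pvalM ?expf_neq0 // pvalX; nia.
  move=> Q'; rewrite inE pvalM ?expf_neq0 // pvalX => /orP [/eqP ->|]; last exact: rQ.
  nia.
have neg (P' : place iota) : P' z < 0 -> 1 + z ^+ r != 0 /\ P' (1 + z ^+ r) = P' (z ^+ r).
  move=> h; have zr0 : z ^+ r != 0 by rewrite expf_neq0.
  have h1 : vge P' 1 (P' (z ^+ r) + 1) by right; rewrite pval1 pvalX /r; nia.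
  by rewrite [1 + _]addrC (pval_add_neq0 zr0 h1) (pval_add_eq zr0 h1).
have [d0 Pd] := neg _ Pz.
have [_ Qd] := neg _ Qz.
have zr0 : z ^+ r != 0 by rewrite expf_neq0.
(* The quotient has value 0 at the poles P and Q of z, where v decides the sign, and the value of
   [z ^+ r] at its zeros in s. *)
exists (z ^+ r / (1 + z ^+ r) * v); split.
- by rewrite !mulf_neq0 ?invr_eq0.
- by rewrite pvalM ?mulf_neq0 ?invr_eq0 // pval_div // Pd subrr add0r.
move=> Q'; rewrite inE pvalM ?mulf_neq0 ?invr_eq0 // pval_div //.
case/orP => [/eqP ->|Q's]; first by rewrite Qd subrr add0r.
have h1 := hz _ Q's.
have zr1 : vge Q' (z ^+ r) (Q' 1 + 1) by right; rewrite pval1 pvalX /r; nia.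
rewrite (pval_add_eq (oner_neq0 K) zr1) pval1 subr0 pvalX; exact: rQ.
Qed.

(** With z of negative value at P and positive value on s, [z ^+ N / (1 + z ^+ N)] has value 0 at P
    and at least N on s; multiplying [t ^ k] by it changes nothing at P. *)
Lemma weak_approximation P (s : seq (place iota)) (k M : int) : P \notin s ->
  exists z, [/\ z != 0, P z = k & forall Q, Q \in s -> M <= Q z].
Proof.
move=> /approx_sign [z [z0 Pz hz]].
have [t t0 Pt] := pval_unif P.
pose tk : K := t ^ k.
have tk0 : tk != 0 by rewrite expfz_neq0.
pose N := (`|M| + \sum_(Q <- s) `|Q tk|)%N.+1.
have zN : z ^+ N != 0 by rewrite expf_neq0.
have h1 : vge P 1 (P (z ^+ N) + 1) by right; rewrite pval1 pvalX /N; nia.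
have d0 : 1 + z ^+ N != 0 by rewrite [1 + _]addrC (pval_add_neq0 zN h1).
have Pd : P (1 + z ^+ N) = P (z ^+ N) by rewrite [1 + _]addrC (pval_add_eq zN h1).
exists (tk * (z ^+ N / (1 + z ^+ N))); split.
- by rewrite !mulf_neq0 ?invr_eq0.
- rewrite pvalM ?mulf_neq0 ?invr_eq0 // pval_div // Pd subrr addr0 /tk pvalXz Pt; lia.
move=> Q Qs; rewrite pvalM ?mulf_neq0 ?invr_eq0 // pval_div //.
have Qz := hz _ Qs.
have zr1 : vge Q (z ^+ N) (Q 1 + 1) by right; rewrite pval1 pvalX /N; nia.
rewrite (pval_add_eq (oner_neq0 K) zr1) pval1 subr0 pvalX.
have h2 : (`|Q tk|%N <= \sum_(Q <- s) `|Q tk|)%N.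
  by rewrite (big_rem Q) //= leq_addr.
have h3 : `|M|%N%:Z + `|Q tk|%N%:Z < N%:Z by rewrite /N; lia.
have : - `|Q tk|%N%:Z <= Q tk by lia.
have : M <= `|M|%N%:Z by lia.
nia.
Qed.

(* Elements of value i < v_P(w) at P that are very small at the other zeros of w
   are independent over C[w]. *)
Lemma zeros_bound w n (s : seq (place iota)) : (0 < n)%N -> deg_over iota w n ->
  uniq s -> (forall P, P \in s -> 0 < P w) -> (\sum_(P <- s) `|P w| <= n)%N.
Proof.
move=> n0 hw us hs; have w0 := deg_over_gen_neq0 n0 hw.
case: s us hs => [|P0 s0]; first by rewrite big_nil.
set s := P0 :: s0 => us hs.
pose pl (k : 'I_(size s)) := nth P0 s k.
have pls k : pl k \in s by apply: mem_nth.
pose e k := `|pl k w|%N.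
have eE k : (e k)%:Z = pl k w by have := hs _ (pls k); rewrite /e; lia.
pose tg k (i : 'I_(e k)) : {k : 'I_(size s) & 'I_(e k)} := existT _ k i.
pose M := (\sum_k e k)%N.
have eM k : (e k <= M)%N by rewrite /M (bigD1 k) //= leq_addr.
have ex (x : {k : 'I_(size s) & 'I_(e k)}) : exists z, [/\ z != 0,
    pl (tag x) z = (tagged x : nat)%:Z &
    forall k, k != tag x -> M%:Z <= pl k z].
  have [|z [z0 h1 h2]] := @weak_approximation (pl (tag x)) [seq Q <- s | Q != pl (tag x)]
    (tagged x : nat)%:Z M%:Z.
    by rewrite mem_filter eqxx.
  exists z; split => // k kx; apply: h2; rewrite mem_filter pls andbT.
  by rewrite nth_uniq.
case/choice: ex => f hf.
have card : #|{: {k : 'I_(size s) & 'I_(e k)}}| = (\sum_(P <- s) `|P w|)%N.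
  rewrite card_tagged sumnE big_map big_enum /= (big_nth P0) big_mkord.
  by apply: eq_bigr => k _; rewrite card_ord.
rewrite -card; apply: (deg_over_max (f := f) hw); apply: contrapT.
move=> /(dep_reduced w0) [p [hp [[k i] pki]]].
(* Among the terms attached to k whose coefficient does not vanish at w = 0, the one with least
   index j has value j at [pl k]; all the other terms have greater value there. *)
have [j pj jmin] := @arg_minnP _ i (fun i => (p (tg _ i)).[0] != 0)
  (fun i : 'I_(e k) => val i) pki.
have hw1 : vge (pl k) (w - iota 0) 1.
  by right; rewrite rmorph0 subr0 -eE; have := ltn_ord i; lia.
have hw0 : vge (pl k) w 0 by right; rewrite -eE; lia.
have [fj0 fj1 _] := hf (tg _ j).
have [pj0 pj1] := pval_pe_nroot hw1 pj.
have hT : pl k (peval iota w (p (tg _ j)) * f (tg _ j)) = j%:Z.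
  by rewrite pvalM // pj1 fj1 add0r.
move: hp; apply/eqP; apply: (sum_neq0 (P := pl k) (i0 := tg _ j)).
  by rewrite mulf_neq0.
move=> [k' i'] ne; rewrite hT.
have [f0 f1 f2] := hf (tg _ i').
have [ek|kk] := eqVneq k' k; last first.
  rewrite -[X in vge _ _ X]add0r; apply: vgeM; first exact: vge_pe.
  right; apply: le_trans (f2 k _); last by rewrite /= eq_sym.
  by have := ltn_ord j; have := eM k; lia.
move: i' ne f0 f1 f2; rewrite ek => i' ne f0 f1 f2.
have [p0|p0] := eqVneq (p (tg _ i')).[0] 0.
  have [q [_ ->]] : exists q, p (tg _ i') = q * ('X - 0%:P) /\
    peval iota w (p (tg _ i')) = peval iota w q * (w - iota 0).
    by apply: pe_root; apply/rootP.
  rewrite rmorph0 subr0 -mulrA -[X in vge _ _ X]add0r; apply: vgeM; first exact: vge_pe.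
  right; rewrite pvalM // f1 -eE /=; have := ltn_ord j; lia.
rewrite -[X in vge _ _ X]add0r; apply: vgeM; first exact: vge_pe.
right; rewrite f1 /=; have /= h1 := jmin _ p0.
have h2 : (nat_of_ord i' != nat_of_ord j).
  by apply: contra_neq ne => /val_inj ->.
by lia.
Qed.

Lemma zeros_finite w n : (0 < n)%N -> deg_over iota w n ->
  exists s : seq (place iota), uniq s /\ forall P, (P \in s) = (0 < P w).
Proof.
move=> n0 hw.
pose Pr := [pred k : nat | `[< exists s : seq (place iota),
  [/\ uniq s, size s = k & forall P, P \in s -> 0 < P w] >]].
have ex : exists k, Pr k by exists 0%N; apply/asboolP; exists [::].
have bd k : Pr k -> (k <= n)%N.
  move=> /asboolP [s [us <- hs]]; apply: leq_trans (zeros_bound n0 hw us hs).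
  rewrite -sum1_size big_seq [X in (_ <= X)%N]big_seq; apply: leq_sum => P /hs; lia.
have [k /asboolP [s [us sk hs]] kmax] := ex_maxnP ex bd.
exists s; split => // P; apply/idP/idP; first exact: hs.
move=> Pw; apply: contraT => Ps.
have : (k.+1 <= k)%N; last by rewrite ltnn.
apply: kmax; apply/asboolP; exists (P :: s); split => //=; rewrite ?Ps ?sk //.
by move=> Q; rewrite inE => /orP [/eqP ->|/hs].
Qed.

End Approximation.

(** * Riemann-Roch spaces *)

Section Dimension.

Variables (C : closedFieldType) (K : fieldType) (iota : {rmorphism C -> K}).
Implicit Types (P Q : place iota) (z u w y : K) (V W : set K).

Lemma is_dimP V d : is_dim iota V d <-> exists w : 'I_d -> K,
  indep iota w /\ forall z, V z <-> exists c : 'I_d -> C, z = \sum_i iota (c i) * w i.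
Proof.
split=> -[w [h1 h2]]; exists w; split.
- move=> c hc i; have := h1 (\row_i c i).
  rewrite (eq_bigr (fun i => iota (c i) * w i)); last by move=> j _; rewrite mxE.
  by move=> /(_ hc) /(congr1 (fun M : 'rV_d => M 0 i)); rewrite !mxE.
- move=> z; rewrite h2; split => -[c ->]; first by exists (c 0).
  by exists (\row_i c i); apply: eq_bigr => i _; rewrite mxE.
- move=> c hc; apply/rowP => i; rewrite mxE; exact: (h1 (c 0)).
- move=> z; rewrite h2; split => -[c ->]; last by exists (c 0).
  by exists (\row_i c i); apply: eq_bigr => i _; rewrite mxE.
Qed.

Lemma dim_indep V d k (f : 'I_k -> K) : is_dim iota V d -> indep iota f ->
  (forall i, V (f i)) -> (k <= d)%N.
Proof.
move=> /is_dimP [w [_ h]] hf Vf; rewrite leqNgt; apply/negP => lt.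
apply: (dep_bound (psi := iota) (g := w) lt _ hf) => i.
have [c e] := (h (f i)).1 (Vf i).
by exists 1, c; rewrite oner_neq0 rmorph1 mul1r.
Qed.

Lemma dim_le V W d e : is_dim iota V d -> is_dim iota W e -> (forall z, V z -> W z) ->
  (d <= e)%N.
Proof.
move=> /is_dimP [w [hw h]] hW VW; apply: (dim_indep hW hw) => i.
apply: VW; apply/h; exists (fun j => (j == i)%:R).
rewrite (bigD1 i) //= eqxx rmorph1 mul1r big1 ?addr0 // => j /negbTE ->.
by rewrite rmorph0 mul0r.
Qed.

Lemma dim_unique V d e : is_dim iota V d -> is_dim iota V e -> d = e.
Proof.
by move=> hd he; apply/eqP; rewrite eqn_leq (dim_le hd he) // (dim_le he hd).
Qed.

Lemma dim_basis V (I : finType) (w : I -> K) : indep iota w ->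
  (forall z, V z <-> exists c : I -> C, z = \sum_i iota (c i) * w i) ->
  is_dim iota V #|I|.
Proof.
move=> hw h; apply/is_dimP; exists (w \o enum_val); split.
  by apply: (@indep_comp _ _ iota _ _ enum_val) => //; apply: enum_val_inj.
have bij : {on [pred i | true], bijective (@enum_val I predT)}.
  by apply: onW_bij; exact: enum_val_bij.
move=> z; rewrite h; split => -[c ->].
  exists (c \o enum_val); rewrite (reindex _ bij) /=.
  by apply: eq_bigr.
exists (c \o enum_rank); rewrite (reindex _ bij) /=.
by apply: eq_bigr => i _; rewrite enum_valK.
Qed.

Lemma dim_trivial V : (forall z, V z <-> z = 0) -> is_dim iota V 0.
Proof.
move=> h; apply/is_dimP; exists (fun=> 0); split; first by move=> c _ [].
move=> z; rewrite h; split => [->|[c ->]]; last by rewrite big_ord0.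
by exists (fun=> 0); rewrite big_ord0.
Qed.

Lemma dim_add1 V W d z0 : is_dim iota V d ->
  (forall z, W z <-> exists c v, V v /\ z = v + iota c * z0) ->
  exists d', is_dim iota W d' /\ (d' <= d.+1)%N.
Proof.
move=> hV hW; case: (pselect (V z0)) => Vz0.
  exists d; split => //; move/is_dimP: hV => [w [h1 h2]]; apply/is_dimP; exists w.
  split => // z; rewrite hW; split => [[c [v [/h2 [c1 ->] ->]]]|[c e]].
    have [c2 ->] := (h2 _).1 Vz0; exists (fun i => c1 i + c * c2 i).
    rewrite big_distrr -big_split /=; apply: eq_bigr => i _.
    by rewrite rmorphD rmorphM mulrDl mulrA.
  by exists 0, z; split; [apply/h2; exists c|rewrite rmorph0 mul0r addr0].
exists d.+1; split => //; move/is_dimP: hV => [w [h1 h2]]; apply/is_dimP.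
exists (fun i => oapp w z0 (unlift ord0 i)).
have hs (c : 'I_d.+1 -> C) : \sum_i iota (c i) * oapp w z0 (unlift ord0 i) =
    iota (c ord0) * z0 + \sum_i iota (c (lift ord0 i)) * w i.
  by rewrite big_ord_recl unlift_none /=; under eq_bigr do rewrite liftK.
split.
  move=> c; rewrite hs => hc.
  have c0 : c ord0 = 0.
    apply/eqP; apply: contrapT => /negP c0; apply: Vz0; apply/h2.
    exists (fun i => - (c ord0)^-1 * c (lift ord0 i)).
    have i0 : iota (c ord0) != 0 by rewrite fmorph_eq0.
    apply: (mulfI i0); move/eqP: hc; rewrite addr_eq0 => /eqP ->.
    rewrite big_distrr -sumrN /=; apply: eq_bigr => i _.
    rewrite rmorphM rmorphN fmorphV !mulrA mulrN mulfV //; ring.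
  move=> i; case: (unliftP ord0 i) => [j ->|-> //].
  move: hc; rewrite c0 rmorph0 mul0r add0r => hc.
  exact: (h1 (fun i => c (lift ord0 i)) hc).
move=> z; rewrite hW; split => [[c [v [/h2 [c1 ->] ->]]]|[c ->]].
  exists (fun i => oapp c1 c (unlift ord0 i)); rewrite hs unlift_none /= addrC.
  by congr (_ + _); apply: eq_bigr => i _; rewrite liftK.
exists (c ord0), (\sum_i iota (c (lift ord0 i)) * w i); split.
  by apply/h2; exists (fun i => c (lift ord0 i)).
by rewrite hs addrC.
Qed.

(* The Riemann-Roch space L(delta), for delta an arbitrary function on places. *)
Definition Lspace (delta : place iota -> int) : set K :=
  fun z => forall P, vge P z (- delta P).

Lemma Lspace_incl (d1 d2 : place iota -> int) z : (forall P, d1 P <= d2 P) -> Lspace d1 z -> Lspace d2 z.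
Proof. by move=> h hz P; apply: vgeW (hz P); have := h P; lia. Qed.

Section Steps.

Variables (y : K) (n : nat).
Hypotheses (n0 : (0 < n)%N) (hy : deg_over iota y n).

(** Dividing by an element z0 of exact value [- d2 P0] and taking the residue at P0 embeds L(d2) /
    L(d1) into C. Without such an element the two spaces coincide. *)
Lemma Lspace_step1 (d1 d2 : place iota -> int) P0 d : d2 P0 = d1 P0 + 1 ->
  (forall P, P != P0 -> d2 P = d1 P) -> is_dim iota (Lspace d1) d ->
  exists d', is_dim iota (Lspace d2) d' /\ (d' <= d.+1)%N.
Proof.
move=> h0 h1 hd.
have h12 P : d1 P <= d2 P.
  by have [->|/h1 ->] := eqVneq P P0; rewrite ?h0; lia.
case: (pselect (exists z0, [/\ z0 != 0, Lspace d2 z0 & P0 z0 = - d2 P0])) => [|h]; last first.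
  exists d; split => //; rewrite (_ : Lspace d2 = Lspace d1) //.
  apply/seteqP; split => z hz; last exact: Lspace_incl hz.
  have [->|z0] := eqVneq z 0; first by move=> P; left.
  move=> P; have [->|ne] := eqVneq P P0; last by rewrite -h1.
  right; have := vgeP z0 (hz P0); have : P0 z <> - d2 P0.
    by move=> e; apply: h; exists z.
  lia.
move=> [z0 [z00 Lz0 Pz0]]; apply: (dim_add1 (z0 := z0) hd) => z; split.
  move=> hz; have hq : vge P0 (z / z0) 0.
    have [->|zn] := eqVneq z 0; first by left; rewrite mul0r.
    by right; rewrite pval_div // Pz0; have := vgeP zn (hz P0); lia.
  have [c hc] := residue n0 hy hq.
  exists c, (z - iota c * z0); split; last by ring.
  move=> P; have [->|ne] := eqVneq P P0.
    have -> : z - iota c * z0 = (z / z0 - iota c) * z0 by field.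
    apply: (@vgeW _ _ _ _ _ (1 + - d2 P0)); first by lia.
    by apply: vgeM => //; right; rewrite Pz0.
  rewrite -h1 //; apply: vgeB; first exact: hz.
  by rewrite -[X in vge _ _ X]add0r; apply: vgeM; [exact: vge_const|exact: Lz0].
move=> [c [v [hv ->]]] P; apply: vgeD; first exact: (Lspace_incl h12 hv).
by rewrite -[X in vge _ _ X]add0r; apply: vgeM; [exact: vge_const|exact: Lz0].
Qed.

Lemma Lspace_stepk (d1 d2 : place iota -> int) P0 (k : nat) d : d2 P0 = d1 P0 + k%:Z ->
  (forall P, P != P0 -> d2 P = d1 P) -> is_dim iota (Lspace d1) d ->
  exists d', is_dim iota (Lspace d2) d' /\ (d' <= d + k)%N.
Proof.
elim: k d2 => [|k IH] d2 h0 h1 hd.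
  exists d; rewrite addn0; split => //; rewrite (_ : d2 = d1) //.
  by apply/funext => P; have [->|/h1 ->] := eqVneq P P0; rewrite ?h0 ?addr0.
pose d3 P := if P == P0 then d1 P0 + k%:Z else d1 P.
have [||d' [hd' le]] := IH d3 _ _ hd.
- by rewrite /d3 eqxx.
- by move=> P /negbTE ne; rewrite /d3 ne.
have [||d'' [hd'' le']] := Lspace_step1 (d1 := d3) (d2 := d2) (P0 := P0) _ _ hd'.
- by rewrite h0 /d3 eqxx; lia.
- by move=> P ne; rewrite h1 // /d3 (negbTE ne).
by exists d''; split => //; lia.
Qed.

Lemma Lspace_steps (s : seq (place iota)) (d1 d2 : place iota -> int) d : uniq s ->
  (forall P, d1 P <= d2 P) -> (forall P, P \notin s -> d2 P = d1 P) ->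
  is_dim iota (Lspace d1) d ->
  exists d', is_dim iota (Lspace d2) d' /\ d'%:Z <= d%:Z + \sum_(P <- s) (d2 P - d1 P).
Proof.
elim: s d1 d => [|P s IH] d1 d us h0 h1 hd.
  exists d; rewrite big_nil addr0; split => //; rewrite (_ : d2 = d1) //.
  by apply/funext => P; rewrite h1.
case/andP: us => Ps us.
pose d3 Q := if Q == P then d2 P else d1 Q.
have [||d' [hd' le']] := Lspace_stepk (d2 := d3) (k := `|d2 P - d1 P|%N) (P0 := P) _ _ hd.
- by rewrite /d3 eqxx; have := h0 P; lia.
- by move=> Q /negbTE ne; rewrite /d3 ne.
have [||d'' [hd'' le'']] := IH d3 d' us _ _ hd'.
- by move=> Q; rewrite /d3; case: eqP => [->|].
- move=> Q Qs; rewrite /d3; case: eqP => [-> //|/eqP ne]; apply: h1.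
  by rewrite inE negb_or ne.
exists d''; split => //; rewrite big_cons; apply: le_trans le'' _.
have -> : \sum_(Q <- s) (d2 Q - d3 Q) = \sum_(Q <- s) (d2 Q - d1 Q).
  rewrite big_seq [RHS]big_seq; apply: eq_bigr => Q Qs; rewrite /d3.
  by case: eqP => // e; rewrite e (negbTE Ps) in Qs.
by have := h0 P; move: le'; move: (\sum_(Q <- s) _) => X; lia.
Qed.

Lemma pole_exists : exists P : place iota, P y < 0.
Proof.
apply: contrapT => h.
have [c e] : exists c, y = iota c.
  apply: (regular_const n0 hy) => P; right; rewrite leNgt; apply/negP => lt.
  by apply: h; exists P.
by have := deg_over_sub_neq0 c n0 hy; rewrite e subrr eqxx.
Qed.

Lemma Lspace_trivial (d0 : place iota -> int) P : (forall Q, d0 Q <= 0) -> d0 P < 0 ->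
  is_dim iota (Lspace d0) 0.
Proof.
move=> h hP; apply: dim_trivial => z; split => [hz|-> Q]; last by left.
apply: (regular_zero n0 hy (P := P)) => [Q|]; first by apply: vgeW (hz Q); have := h Q; lia.
by apply: vgeW (hz P); lia.
Qed.

(** A divisor below [delta] that is nonpositive everywhere and negative at P0 has a trivial space;
    [delta] is reached from it by finitely many unit steps. *)
Lemma Lspace_finite (s : seq (place iota)) (delta : place iota -> int) :
  (forall P, P \notin s -> delta P = 0) -> exists d, is_dim iota (Lspace delta) d.
Proof.
move=> hs; have [P0 _] := pole_exists.
pose s' := undup (P0 :: s).
pose d0 Q := if Q \in s' then Num.min (delta Q) 0 - 1 else 0.
have hd0 : is_dim iota (Lspace d0) 0.
  apply: (Lspace_trivial (P := P0)).
    by move=> Q; rewrite /d0; case: ifP => _ //; lia.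
  by rewrite /d0 mem_undup inE eqxx /=; lia.
have [|||d [hd _]] := Lspace_steps (s := s') (d2 := delta) _ _ _ hd0.
- exact: undup_uniq.
- move=> Q; rewrite /d0; case: ifP => [_|]; first lia.
  by rewrite mem_undup inE => /negbT /norP [_ /hs ->].
- move=> Q Qs; rewrite /d0 (negbTE Qs); move: Qs; rewrite mem_undup inE.
  by move=> /norP [_ /hs ->].
by exists d.
Qed.

End Steps.

End Dimension.

(** * Reduced bases *)

Section ReducedBasis.

Variables (C : closedFieldType) (K : fieldType) (iota : {rmorphism C -> K}).
Implicit Types (P Q : place iota) (z u v w : K) (p q : {poly C}).
Variable y : K.

Notation pey := (peval iota y).

Definition pole_order P : int := Num.max 0 (- P y).

Lemma pole_order_ge0 P : 0 <= pole_order P.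
Proof. by rewrite /pole_order; lia. Qed.

Lemma pole_orderE P : P y < 0 -> pole_order P = - P y.
Proof. by rewrite /pole_order; lia. Qed.

Lemma pole_order0 P : 0 <= P y -> pole_order P = 0.
Proof. by rewrite /pole_order; lia. Qed.

(* L(N D) where D is the divisor of poles of y. *)
Definition Vpoles (N : int) : set K := Lspace (fun P => N * pole_order P).

Lemma Vpoles_le N M z : N <= M -> Vpoles N z -> Vpoles M z.
Proof.
by move=> NM; apply: Lspace_incl => P; rewrite ler_wpM2r // pole_order_ge0.
Qed.

Lemma Vpoles_regular N z P : Vpoles N z -> 0 <= P y -> vge P z 0.
Proof. by move=> /(_ P) h /pole_order0 e; move: h; rewrite e mulr0 oppr0. Qed.

Lemma Vpoles0 N : Vpoles N 0. Proof. by move=> P; left. Qed.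

Lemma VpolesD N u v : Vpoles N u -> Vpoles N v -> Vpoles N (u + v).
Proof. by move=> hu hv P; apply: vgeD; [exact: hu|exact: hv]. Qed.

Lemma VpolesB N u v : Vpoles N u -> Vpoles N v -> Vpoles N (u - v).
Proof. by move=> hu hv P; apply: vgeB; [exact: hu|exact: hv]. Qed.

Lemma Vpoles_sum N (I : Type) (s : seq I) (Pr : pred I) (F : I -> K) :
  (forall i, Pr i -> Vpoles N (F i)) -> Vpoles N (\sum_(i <- s | Pr i) F i).
Proof. by move=> h P; apply: vge_sum => i /h; apply. Qed.

Lemma VpolesM N M u v : Vpoles N u -> Vpoles M v -> Vpoles (N + M) (u * v).
Proof.
move=> hu hv P; rewrite mulrDl opprD; apply: vgeM; [exact: hu|exact: hv].
Qed.

Variable n : nat.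
Hypotheses (n0 : (0 < n)%N) (hy : deg_over iota y n).

Let y0 : y != 0 := deg_over_gen_neq0 n0 hy.

Lemma Vpoles_neg N z : N < 0 -> Vpoles N z -> z = 0.
Proof.
move=> N0 hz; have [P Py] := pole_exists n0 hy.
apply: (regular_zero n0 hy (P := P)) => [Q|].
  by apply: vgeW (hz Q); have := pole_order_ge0 Q; nia.
by apply: vgeW (hz P); rewrite pole_orderE //; nia.
Qed.

Lemma Vpoles_pe p (d : nat) : (size p <= d.+1)%N -> Vpoles d%:Z (pey p).
Proof.
move=> sp P; case: (ltP (P y) 0) => Py.
  by rewrite pole_orderE // mulrN opprK; apply: vge_pe_pole.
by rewrite pole_order0 // mulr0 oppr0; apply: vge_pe; right.
Qed.

Lemma Vpoles_divy M (k : nat) u : Vpoles M (y ^+ k * u) ->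
  (forall P, 0 <= P y -> vge P u 0) -> Vpoles (M - k%:Z) u.
Proof.
move=> h hr P; case: (ltP (P y) 0) => Py; last first.
  by rewrite pole_order0 // mulr0 oppr0; apply: hr.
have [->|u0] := eqVneq u 0; first by left.
right; have := vgeP _ (h P); rewrite mulf_neq0 ?expf_neq0 // => /(_ isT).
rewrite pvalM ?expf_neq0 // pvalX pole_orderE //; lia.
Qed.

(** If the value of x were below B, the term [x ^+ d] would have strictly the smallest value. *)
Lemma integral_vge P x (d : nat) (c : 'I_d -> K) (B : int) : B <= 0 ->
  x ^+ d + \sum_i c i * x ^+ i = 0 -> (forall i, vge P (c i) B) -> vge P x B.
Proof.
move=> B0 h hc; have [->|x0] := eqVneq x 0; first by left.
right; rewrite leNgt; apply/negP => lt.
have : x ^+ d + \sum_i c i * x ^+ i != 0; last by rewrite h eqxx.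
apply: (pval_add_neq0 (P := P)); first by rewrite expf_neq0.
apply: vge_sum => i _; apply: (@vgeW _ _ _ _ _ (B + i%:Z * P x)).
  by rewrite pvalX; have := ltn_ord i; nia.
by apply: vgeM => //; right; rewrite pvalX.
Qed.

(** The leading coefficient of a relation of z over C[y] is taken as q: multiplied by [q ^+ d.-1],
    in its values at y, the relation becomes monic in q(y) z. *)
Lemma Vpoles_ex z : exists q (N : nat), q != 0 /\ Vpoles N%:Z (pey q * z).
Proof.
have [p [hs [i0 pi0]]] := deg_over_rel z hy.
have [d pd dmax] := @arg_maxnP _ i0 (fun i => p i != 0) (fun i : 'I_n.+1 => val i) pi0.
pose c (i : 'I_d) := p (inord i) * p d ^+ (d - i.+1).
pose N := \max_i size (c i).
exists (p d), N; split => // P.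
have dn := ltn_ord d.
apply: (@integral_vge _ _ d (fun i => pey (c i))).
- by have := pole_order_ge0 P; nia.
- have hi (i : 'I_n.+1) : (d < i)%N -> p i = 0.
    move=> di; apply/eqP; apply: contrapT => /negP /dmax /=; lia.
  have hs' : \sum_(i < d.+1) pey (p (inord i)) * z ^+ i = 0.
    rewrite -[RHS]hs [RHS](bigID (fun i : 'I_n.+1 => (i < d.+1)%N)) /=.
    rewrite [X in _ = _ + X]big1 ?addr0; last first.
      by move=> i; rewrite -leqNgt => /hi ->; rewrite rmorph0 mul0r.
    rewrite (big_ord_widen_cond n.+1 xpredT (fun i => pey (p (inord i)) * z ^+ i)) //.
    by apply: eq_bigr => i _; rewrite inord_val.
  rewrite big_ord_recr /= inord_val in hs'.
  case: (posnP d) => [d0|dpos].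
    move: hs'; rewrite big1 ?add0r; last by move=> i _; have := ltn_ord i; lia.
    move=> e; exfalso; move: e; rewrite d0 expr0 mulr1 => e; have := deg_over_neq0 n0 hy pd.
    by rewrite e eqxx.
  have -> : (pey (p d) * z) ^+ d + \sum_(i < d) pey (c i) * (pey (p d) * z) ^+ i =
     pey (p d) ^+ d.-1 * (\sum_(i < d) pey (p (inord i)) * z ^+ i + pey (p d) * z ^+ d).
    rewrite mulrDr addrC exprMn; congr (_ + _); last first.
      by rewrite mulrA -exprSr prednK.
    rewrite big_distrr /=; apply: eq_bigr => i _.
    rewrite /c rmorphM rmorphXn /= exprMn.
    have -> : pey (p d) ^+ d.-1 = pey (p d) ^+ (d - i.+1) * pey (p d) ^+ i.
      by rewrite -exprD; congr (_ ^+ _); have := ltn_ord i; lia.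
    ring.
  by rewrite hs' mulr0.
- move=> i; apply: Vpoles_pe; apply: leqW; exact: (leq_bigmax i).
Qed.

Lemma indep_exchange (f : 'I_n -> K) (p : 'I_n -> {poly C}) q u i0 : indep pey f ->
  q != 0 -> pey q * u = \sum_i pey (p i) * f i -> p i0 != 0 ->
  indep pey (fun i => if i == i0 then u else f i).
Proof.
move=> hf q0 e p0 r hr.
pose t i := (if i == i0 then 0 else q * r i) + r i0 * p i.
have ht : \sum_i pey (t i) * f i = 0.
  transitivity (pey q * \sum_i pey (r i) * (if i == i0 then u else f i)); last first.
    by rewrite hr mulr0.
  rewrite [in RHS](bigD1 i0) //= eqxx mulrDr mulrCA e !big_distrr /=.
  have -> : \sum_i pey (t i) * f i =
      \sum_i pey (if i == i0 then 0 else q * r i) * f i + \sum_i pey (r i0 * p i) * f i.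
    by rewrite -big_split; apply: eq_bigr => i _; rewrite /t rmorphD mulrDl.
  rewrite addrC; congr (_ + _).
    by apply: eq_bigr => i _; rewrite rmorphM mulrA.
  rewrite (bigD1 i0) //= eqxx rmorph0 mul0r add0r.
  by apply: eq_bigr => i /negbTE ->; rewrite rmorphM mulrA.
have h := hf t ht.
have r0 : r i0 = 0.
  by have := h i0; rewrite /t eqxx add0r => /eqP; rewrite mulf_eq0 (negbTE p0) orbF => /eqP.
move=> i; have := h i; rewrite /t r0 mul0r addr0.
by case: eqP => [-> //|_] /eqP; rewrite mulf_eq0 (negbTE q0) => /eqP.
Qed.

(* Minimality of the sum of the pole orders a i makes the basis f reduced: a
   combination of the f i that were divisible by some y - b, or whose leading
   terms at infinity cancelled, could replace one of them. *)
Lemma minimal_basis : exists (a : 'I_n -> nat) (f : 'I_n -> K),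
  [/\ indep pey f, forall i, Vpoles (a i)%:Z (f i) &
   forall (a' : 'I_n -> nat) (f' : 'I_n -> K), indep pey f' ->
     (forall i, Vpoles (a' i)%:Z (f' i)) -> (\sum_i a i <= \sum_i a' i)%N].
Proof.
pose Pr := [pred k : nat | `[< exists (a : 'I_n -> nat) (f : 'I_n -> K),
  [/\ indep pey f, forall i, Vpoles (a i)%:Z (f i) & (\sum_i a i)%N = k] >]].
have ex : exists k, Pr k.
  have [[f hf] _] := hy.
  have /choice [q /choice [N hN]] : forall i, exists q (N : nat),
    q != 0 /\ Vpoles N%:Z (pey q * f i) by move=> i; apply: Vpoles_ex.
  exists (\sum_i N i)%N; apply/asboolP; exists N, (fun i => pey (q i) * f i); split => //.
    move=> p hp i; have := hf (fun i => p i * q i) _ i.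
    case/(_ _)/Wrap => [|/eqP].
      by rewrite -[RHS]hp; apply: eq_bigr => j _; rewrite rmorphM mulrA.
    by have [/negbTE qi _] := hN i; rewrite mulf_eq0 qi orbF => /eqP.
  by move=> i; have [] := hN i.
have [k /asboolP [a [f [h1 h2 h3]]] kmin] := ex_minnP ex.
exists a, f; split => // a' f' h1' h2'; rewrite h3; apply: kmin.
by apply/asboolP; exists a', f'.
Qed.

Section Reduced.

Variables (a : 'I_n -> nat) (f : 'I_n -> K).
Hypotheses (hf : indep pey f) (ha : forall i, Vpoles (a i)%:Z (f i)).
Hypothesis hmin : forall (a' : 'I_n -> nat) (f' : 'I_n -> K), indep pey f' ->
     (forall i, Vpoles (a' i)%:Z (f' i)) -> (\sum_i a i <= \sum_i a' i)%N.

(** Exchanging [f i0] for u would lower the sum of the pole orders. When [a i0 = 0] the bound cannot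
    be lowered, but then u is 0 and the relation is trivial. *)
Lemma no_improvement q (p : 'I_n -> {poly C}) u i0 : q != 0 ->
  pey q * u = \sum_i pey (p i) * f i -> p i0 != 0 -> Vpoles ((a i0)%:Z - 1) u -> False.
Proof.
move=> q0 e p0 hu; case: (posnP (a i0)) => ai.
  have u0 : u = 0 by apply: (Vpoles_neg _ hu); rewrite ai.
  by move: e p0; rewrite u0 mulr0 => /esym /hf ->; rewrite eqxx.
have := hmin (a' := fun i => if i == i0 then (a i).-1 else a i)
  (indep_exchange hf q0 e p0) _.
case/(_ _)/Wrap => [i|].
  case: eqP => // ->; rewrite (_ : (a i0).-1%:Z = (a i0)%:Z - 1) //; lia.
rewrite (bigD1 i0) //= [X in (_ <= X)%N](bigD1 i0) //= eqxx.
rewrite [X in (_ <= _ + X)%N](eq_bigr a); last by move=> i /negbTE ->.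
by lia.
Qed.

(** Induction on the size of a denominator q. At a root b of q, either all [p i] vanish and [y - b]
    cancels, or a nontrivial combination S of the [f i] over C is divisible by [y - b], against
    minimality. *)
Lemma reduced_span N z : Vpoles N z -> exists p : 'I_n -> {poly C}, z = \sum_i pey (p i) * f i.
Proof.
move=> hz; have [q [p [q0 e]]] := deg_over_span z hy hf.
move: {2}(size q) (leqnn (size q)) => k; elim: k q p q0 e => [|k IH] q p q0 e sk.
  by rewrite -size_poly_eq0 -leqn0 sk in q0.
have [s1|s1] := boolP (size q == 1%N).
  move/size_poly1P: s1 => [c c0 ec].
  exists (fun i => c^-1 *: p i); have i0 : iota c != 0 by rewrite fmorph_eq0.
  apply: (mulfI i0); move: e; rewrite ec peC => ->.
  rewrite big_distrr /=; apply: eq_bigr => i _.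
  by rewrite peZ fmorphV !mulrA mulfV // mul1r.
have [b /(pe_root iota y) [q' [eq' epq]]] := closed_rootP q s1.
have yb := deg_over_sub_neq0 b n0 hy.
have Xb0 : ('X - b%:P : {poly C}) != 0 by rewrite polyXsubC_eq0.
have q'0 : q' != 0 by apply: contra_neq q0 => h; rewrite eq' h mul0r.
have hr i : exists r, p i - (p i).[b]%:P = r * ('X - b%:P).
  by apply/factor_theorem; rewrite /root !hornerE subrr.
case/choice: hr => r hr.
have er i : pey (p i) = iota (p i).[b] + pey (r i) * (y - iota b).
  have := congr1 pey (hr i); rewrite rmorphB rmorphM /= peC peXsubC => <-; ring.
pose S := \sum_i iota (p i).[b] * f i.
have eS : S = (y - iota b) * (pey q' * z - \sum_i pey (r i) * f i).
  rewrite mulrBr mulrA [(y - iota b) * _]mulrC -epq e /S big_distrr -sumrB /=.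
  by apply: eq_bigr => i _; rewrite er; ring.
case: (pselect (exists i, (p i).[b] != 0)) => [[i1 pi1]|h]; last first.
  apply: (IH q' r q'0).
    apply: (mulfI yb); apply/eqP; rewrite -subr_eq0 -mulrBr -eS; apply/eqP.
    rewrite /S big1 // => i _; have [->|pb] := eqVneq (p i).[b] 0; first by rewrite rmorph0 mul0r.
    by exfalso; apply: h; exists i.
  by move: sk; rewrite eq' size_Mmonic ?monicXsubC // size_XsubC addn2.
exfalso.
(* With [a i0] largest among the terms present, S has pole order at most [a i0], and division by
   [y - b] lowers it by one. *)
have [i0 pi0 hi0] := @arg_maxnP _ i1 (fun i => (p i).[b] != 0) a pi1.
pose u := pey q' * z - \sum_i pey (r i) * f i.
apply: (@no_improvement ('X - b%:P) (fun i => (p i).[b]%:P) u i0) => //.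
- rewrite peXsubC -eS; by apply: eq_bigr => i _; rewrite peC.
- by rewrite polyC_eq0.
move=> P; case: (ltP (P y) 0) => Py; last first.
  rewrite pole_order0 // mulr0 oppr0.
  have hP : vge P y 0 by right.
  apply: vgeB.
    by rewrite -[X in vge _ _ X]add0r; apply: vgeM; [exact: vge_pe|exact: Vpoles_regular hz Py].
  apply: vge_sum => i _; rewrite -[X in vge _ _ X]add0r.
  by apply: vgeM; [exact: vge_pe|exact: Vpoles_regular (ha i) Py].
have [un|u0] := eqVneq u 0; first by left.
have hS : vge P S (- ((a i0)%:Z * pole_order P)).
  apply: vge_sum => i _; have [->|pb] := eqVneq (p i).[b] 0.
    by left; rewrite rmorph0 mul0r.
  rewrite -[X in vge _ _ X]add0r; apply: vgeM; first exact: vge_const.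
  apply: vgeW (ha i P); have := hi0 _ pb; have := pole_order_ge0 P; nia.
have S0 : S != 0 by rewrite eS mulf_neq0.
have := vgeP S0 hS; rewrite eS pvalM // -/u.
have -> : P (y - iota b) = P y.
  apply: pval_add_eq => //; apply: vgeN; apply: vgeW (vge_const P b); lia.
by rewrite pole_orderE // => h; right; lia.
Qed.

(** If N is below the largest value M of deg p_j + a_j, the terms of order M cancel at infinity. The
    combination u of their leading parts, divided by a power of y, contradicts [no_improvement]. *)
Lemma reduced_degree N (p : 'I_n -> {poly C}) : Vpoles N (\sum_i pey (p i) * f i) ->
  forall i, p i != 0 -> (size (p i)).-1%:Z + (a i)%:Z <= N.
Proof.
move=> hz i pi; rewrite leNgt; apply/negP => lt.
pose m i := ((size (p i)).-1 + a i)%N.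
have [i1 pi1 hi1] := @arg_maxnP _ i (fun i => p i != 0) m pi.
pose T j := (p j != 0) && (m j == m i1).
have Ti1 : T i1 by rewrite /T pi1 eqxx.
(* The largest [a] among the leading terms is chosen, so that no subtraction [a i0 - a j] is
   truncated for them. *)
have [i0 /andP [pi0 /eqP mi0] hi0] := @arg_maxnP _ i1 T a Ti1.
set M := m i1 in T Ti1 hi1 mi0 hi0.
have MN : N < M%:Z by have /= := hi1 _ pi; rewrite /m -/M; lia.
pose c j := if T j then lead_coef (p j) else 0.
pose u := \sum_j iota (c j) * (y ^+ (a i0 - a j) * f j).
apply: (@no_improvement 1 (fun j => c j *: 'X^(a i0 - a j)) u i0) => //.
- exact: oner_neq0.
- rewrite rmorph1 mul1r; apply: eq_bigr => j _.
  by rewrite peZ rmorphXn /= peX mulrA.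
- by rewrite subnn expr0 alg_polyC polyC_eq0 /c /T pi0 mi0 eqxx lead_coef_eq0.
have aM : (a i0 <= M)%N by rewrite -mi0 /m leq_addl.
have -> : (a i0)%:Z - 1 = (M%:Z - 1) - (M - a i0)%N%:Z by lia.
apply: Vpoles_divy; last first.
  move=> P Py; apply: vge_sum => j _; rewrite -[X in vge _ _ X]add0r.
  apply: vgeM; first exact: vge_const.
  rewrite -[X in vge _ _ X]add0r; apply: vgeM; last exact: Vpoles_regular (ha j) Py.
  by apply: vgeX; right.
have -> : y ^+ (M - a i0) * u = \sum_j pey (p j) * f j -
   \sum_j pey (p j - c j *: 'X^((size (p j)).-1)) * f j.
  rewrite -sumrB /u big_distrr /=; apply: eq_bigr => j _.
  rewrite rmorphB /= peZ rmorphXn /= peX mulrBl opprB addrC subrK /c.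
  case: ifP => [Tj|_]; last by rewrite rmorph0 !mul0r mulr0.
  case/andP: (Tj) => _ /eqP mj; have aj := hi0 _ Tj.
  have -> : (size (p j)).-1 = ((M - a i0) + (a i0 - a j))%N.
    by move: mj aj; rewrite /m; lia.
  rewrite exprD; ring.
apply: VpolesB; first by apply: Vpoles_le hz; lia.
apply: Vpoles_sum => j _.
have [pj|pj] := eqVneq (p j) 0.
  by rewrite /c /T pj eqxx /= scale0r subr0 rmorph0 mul0r; apply: Vpoles0.
have := hi1 _ pj => /= mj.
have key q (d : nat) : (size q <= d)%N -> (d + a j <= M)%N -> Vpoles (M%:Z - 1) (pey q * f j).
  case: d => [|d] sq dM.
    move: sq; rewrite leqn0 size_poly_eq0 => /eqP ->.
    by rewrite rmorph0 mul0r; apply: Vpoles0.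
  by apply: (@Vpoles_le (d%:Z + (a j)%:Z)); [lia|apply: VpolesM => //; apply: Vpoles_pe].
rewrite /c; case: ifP => Tj; last first.
  rewrite scale0r subr0; apply: (key _ (size (p j))) => //.
  have : m j != M by apply: contraFN Tj => /eqP e; rewrite /T pj e eqxx.
  move: mj; rewrite /m; have : (0 < size (p j))%N by rewrite size_poly_gt0.
  lia.
apply: (key _ (size (p j)).-1); last exact: mj.
apply/leq_sizeP => k; rewrite leq_eqVlt coefB coefZ coefXn => /orP [/eqP <-|lk].
  by rewrite eqxx mulr1 lead_coefE subrr.
rewrite gtn_eqF // mulr0 subr0 nth_default //.
by move: lk; case: (size (p j)).
Qed.

(** By [reduced_span] and [reduced_degree], the products [y ^+ j * f i] with [j <= N - a i] form a
    basis. *)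
Lemma dim_Vpoles (N : nat) : (forall i, (a i <= N)%N) ->
  is_dim iota (Vpoles N%:Z) (\sum_i (N - a i).+1).
Proof.
move=> aN.
pose J (i : 'I_n) := 'I_(N - a i).+1.
pose w (x : {i : 'I_n & J i}) := y ^+ (tagged x : 'I__) * f (tag x).
have card : #|{: {i : 'I_n & J i}}| = (\sum_i (N - a i).+1)%N.
  rewrite card_tagged sumnE big_map big_enum /=.
  by apply: eq_bigr => i _; rewrite card_ord.
have hsum (c : {i : 'I_n & J i} -> C) : \sum_x iota (c x) * w x =
    \sum_i pey (\poly_(j < (N - a i).+1) c (existT J i (inord j))) * f i.
  have := @sig_big_dep K 0 +%R 'I_n J xpredT (fun _ _ => true)
    (fun i j => iota (c (existT J i j)) * w (existT J i j)).
  rewrite /= => e; transitivity (\sum_(p : {i : 'I_n & J i})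
      iota (c (existT J (tag p) (tagged p))) * w (existT J (tag p) (tagged p))).
    by apply: eq_bigr => -[i j] _.
  rewrite -e; apply: eq_bigr => i _; rewrite poly_def rmorph_sum /= big_distrl /=.
  apply: eq_bigr => j _; rewrite peZ rmorphXn /= peX inord_val mulrA //.
rewrite -card; apply: (dim_basis (w := w)).
  move=> c; rewrite hsum => /hf h [i j]; have := congr1 (fun p : {poly C} => p`_j) (h i).
  by rewrite coef_poly ltn_ord inord_val coef0.
move=> z; split => [hz|[c ->]].
  have [p e] := reduced_span hz; rewrite e in hz.
  exists (fun x => (p (tag x))`_(tagged x : 'I__)); rewrite hsum e.
  apply: eq_bigr => i _; congr (pey _ * _); apply/polyP => j; rewrite coef_poly /=.
  case: ltnP => jN; first by rewrite inordK.
  have [->|pi] := eqVneq (p i) 0; first by rewrite coef0.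
  have := reduced_degree hz pi => h; rewrite nth_default //.
  have sp : (0 < size (p i))%N by rewrite size_poly_gt0.
  by move: jN h sp (aN i); rewrite -PoszD lez_nat; case: (size (p i)) => [|k] //=; lia.
rewrite hsum; apply: Vpoles_sum => i _.
have -> : N%:Z = (N - a i)%N%:Z + (a i)%:Z by have := aN i; lia.
by apply: VpolesM => //; apply: Vpoles_pe; apply: size_poly.
Qed.

End Reduced.

End ReducedBasis.

(** * Riemann's theorem *)

Lemma sum_subseq (T : eqType) (M : nmodType) (s s' : seq T) (F : T -> M) :
  uniq s -> uniq s' -> {subset s' <= s} -> (forall x, x \notin s' -> F x = 0) ->
  \sum_(x <- s) F x = \sum_(x <- s') F x.
Proof.
move=> us us' sub h; rewrite (bigID (mem s')) /= [X in _ + X]big1 ?addr0; last exact: h.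
rewrite -big_filter; apply: perm_big; apply: uniq_perm => //.
  exact: filter_uniq.
by move=> x; rewrite mem_filter; apply/andP/idP => [[]|h'] //; split => //; apply: sub.
Qed.

Lemma sum_dim (n : nat) (a : 'I_n -> nat) (N : nat) : (forall i, (a i <= N)%N) ->
  ((\sum_i (N - a i).+1) + \sum_i a i = n * N.+1)%N.
Proof.
move=> aN; rewrite -big_split /= (eq_bigr (fun=> N.+1)); last first.
  by move=> i _; have := aN i; lia.
by rewrite sum_nat_const card_ord.
Qed.

Section Genus.

Variables (C : closedFieldType) (K : fieldType) (iota : {rmorphism C -> K}).
Implicit Types (P Q : place iota) (z u v w : K) (p q : {poly C}).

(** * Degrees of the divisors of poles and of zeros *)

Section Degree.

Variables (y : K) (n : nat).
Hypotheses (n0 : (0 < n)%N) (hy : deg_over iota y n).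

Lemma poles_finite : exists s : seq (place iota), uniq s /\ forall P, (P \in s) = (P y < 0).
Proof.
have [s [us hs]] := zeros_finite n0 (deg_over_inv n0 hy).
by exists s; split => // P; rewrite hs pvalV oppr_gt0.
Qed.

(* The bound from below comes from the growth of dim L(N D) for D the divisor of
   poles: it is about n N, and at most deg (N D) + 1. *)
Lemma poles_degree (s : seq (place iota)) : uniq s ->
  (forall P, P y < 0 -> P \in s) -> \sum_(P <- s) pole_order y P = n%:Z.
Proof.
move=> us hs; have [s' [us' hs']] := poles_finite.
have off P : P \notin s' -> pole_order y P = 0.
  by rewrite hs' -leNgt; apply: pole_order0.
rewrite (sum_subseq (s' := s')) //; last first.
  by move=> P; rewrite hs'; apply: hs.
have up : \sum_(P <- s') pole_order y P <= n%:Z.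
  have h := zeros_bound n0 (deg_over_inv n0 hy) us' _.
  have : (\sum_(P <- s') `|P y^-1| <= n)%N.
    by apply: h => P; rewrite hs' pvalV; lia.
  rewrite -lez_nat; apply: le_trans; rewrite (big_morph Posz PoszD (erefl _)).
  rewrite big_seq [X in _ <= X]big_seq; apply: ler_sum => P; rewrite hs' => h1.
  by rewrite pole_orderE // pvalV; lia.
have [a [f [hf ha hmin]]] := minimal_basis n0 hy.
pose sa := (\sum_i a i)%N.
have aN i : (a i <= sa)%N by rewrite /sa (bigD1 i) //= leq_addr.
have hd := dim_Vpoles n0 hy hf ha hmin aN.
have [P0 hP0] := pole_exists n0 hy.
have h0 : is_dim iota (Lspace (fun P => -1 * pole_order y P)) 0.
  apply: (Lspace_trivial n0 hy (P := P0)) => [Q|]; first by have := pole_order_ge0 y Q; lia.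
  by rewrite pole_orderE //; lia.
have [||d [hd' le]] := Lspace_steps n0 hy us' (d2 := fun P => sa%:Z * pole_order y P) _ _ h0.
- by move=> P; have := pole_order_ge0 y P; nia.
- by move=> P /off ->; lia.
move: le; rewrite -(dim_unique hd hd').
rewrite (eq_bigr (fun P => (sa%:Z + 1) * pole_order y P)); last by move=> P _; lia.
rewrite -big_distrr /=; have := sum_dim aN; rewrite -/sa.
move: (\sum_i (sa - a i).+1)%N => D; move: up; move: (\sum_(P <- s') _) => X.
(* The multiple N = sa is large enough: a degree X at most n - 1 would bound D by (sa + 1) (n - 1),
   while D = (sa + 1) n - sa exceeds this by 1. *)
move=> up e le; apply/eqP; rewrite eq_le up /= leNgt; apply/negP => lt.
have e' : D%:Z + sa%:Z = n%:Z * (sa%:Z + 1) by lia.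
nia.
Qed.

End Degree.

Lemma zeros_degree w n (s : seq (place iota)) : (0 < n)%N -> deg_over iota w n ->
  uniq s -> (forall P, 0 < P w -> P \in s) -> \sum_(P <- s) Num.max 0 (P w) = n%:Z.
Proof.
move=> n0 hw us hs; rewrite -(poles_degree n0 (deg_over_inv n0 hw) us).
  by apply: eq_bigr => P _; rewrite /pole_order pvalV opprK.
by move=> P; rewrite pvalV oppr_lt0; apply: hs.
Qed.

Lemma div_degree w n (s : seq (place iota)) : (0 < n)%N -> deg_over iota w n ->
  uniq s -> (forall P, P w != 0 -> P \in s) -> \sum_(P <- s) P w = 0.
Proof.
move=> n0 hw us hs.
have h1 := zeros_degree n0 hw us (fun P h => hs P (lt0r_neq0 h)).
have h2 := poles_degree n0 hw us (fun P h => hs P (ltr0_neq0 h)).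
transitivity (\sum_(P <- s) (Num.max 0 (P w) - pole_order w P)).
  by apply: eq_bigr => P _; rewrite /pole_order; lia.
by rewrite sumrB h1 h2 subrr.
Qed.

(** * The genus from the pole orders of a reduced basis *)

Section Riemann.

Variables (y : K) (n : nat).
Hypotheses (n0 : (0 < n)%N) (hy : deg_over iota y n).

(** The condition on P stands under the quantifier so that choice yields a point b for every place,
    arbitrary at the poles of y. *)
Lemma finite_center P : exists b, 0 <= P y -> 0 < P (y - iota b).
Proof.
have [w [_ Pw [e|[b e]]]] := place_center n0 hy P; last by exists b; rewrite -e.
by exists 0 => Py; move: Pw; rewrite e pvalV; lia.
Qed.

Lemma dim_scale (V W : set K) d h : h != 0 -> (forall z, W z <-> V (h * z)) ->
  is_dim iota V d -> is_dim iota W d.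
Proof.
move=> h0 hW /is_dimP [w [h1 h2]]; apply/is_dimP; exists (fun i => h^-1 * w i); split.
  move=> c hc; apply: h1.
  transitivity (h * \sum_i iota (c i) * (h^-1 * w i)); last by rewrite hc mulr0.
  rewrite big_distrr /=; apply: eq_bigr => i _.
  by rewrite [iota _ * (_ * _)]mulrCA mulVKf.
move=> z; rewrite hW h2; split => -[c e]; exists c.
  apply: (mulfI h0); rewrite e big_distrr /=; apply: eq_bigr => i _.
  by rewrite [iota _ * (_ * _)]mulrCA mulVKf.
rewrite e big_distrr /=; apply: eq_bigr => i _.
by rewrite [iota _ * (_ * _)]mulrCA mulVKf.
Qed.

Variables (a : 'I_n -> nat) (f : 'I_n -> K).
Hypotheses (hf : indep (peval iota y) f) (ha : forall i, Vpoles iota y (a i)%:Z (f i)).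
Hypothesis hmin : forall (a' : 'I_n -> nat) (f' : 'I_n -> K), indep (peval iota y) f' ->
     (forall i, Vpoles iota y (a' i)%:Z (f' i)) -> (\sum_i a i <= \sum_i a' i)%N.

(* Every divisor is dominated by some N D + div(h), with D the divisor of poles of
   y and h a product of factors y - b. *)
Lemma riemann_bound (s : seq (place iota)) (delta : place iota -> int) d :
  uniq s -> (forall P, P \notin s -> delta P = 0) -> is_dim iota (Lspace delta) d ->
  \sum_(P <- s) delta P - d%:Z <= (\sum_i a i)%N%:Z - n%:Z.
Proof.
move=> us hs hd; set sa := (\sum_i a i)%N.
have aN i : (a i <= sa)%N by rewrite /sa (bigD1 i) //= leq_addr.
have /choice [b hb] := finite_center.
have /choice [zs hzs] c : exists s : seq (place iota),
    uniq s /\ forall P, (P \in s) = (0 < P (y - iota c)).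
  exact: zeros_finite n0 (deg_over_shift _ hy).
have [sp [usp hsp]] := poles_finite n0 hy.
have yb c : y - iota c != 0 := deg_over_sub_neq0 c n0 hy.
pose k P := `|delta P|%N.
pose D := (\sum_(P <- s) k P)%N.
have kD P : P \in s -> (k P <= D)%N by move=> Ps; rewrite /D (big_rem P) //= leq_addr.
pose h := \prod_(P <- s) (y - iota (b P)) ^+ k P.
have hk P : (y - iota (b P)) ^+ k P != 0 by rewrite expf_neq0.
have h0 : h != 0.
  by apply: (big_ind (fun z => z != 0)) => // [|u v]; [exact: oner_neq0|exact: mulf_neq0].
have Qh Q : Q h = \sum_(P <- s) (k P)%:Z * Q (y - iota (b P)).
  by rewrite /h pval_prod //; apply: eq_bigr => P _; rewrite pvalX.
have Qpole Q c : Q y < 0 -> Q (y - iota c) = Q y.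
  move=> Qy; apply: pval_add_eq; first exact: deg_over_gen_neq0 n0 hy.
  by apply: vgeN; apply: vgeW (vge_const Q c); lia.
have Qreg Q c : 0 <= Q y -> 0 <= Q (y - iota c).
  move=> Qy; apply: (vgeP (yb c)); apply: vgeB; [by right|exact: vge_const].
(* At a pole of y, h costs D times the pole order, so 2 D leaves at least D to dominate [delta]; the
   summand sa ensures that each [a i] is at most N. *)
pose N := (2 * D + sa)%N.
pose E Q := N%:Z * pole_order y Q + Q h.
have dE Q : delta Q <= E Q.
  rewrite /E; case: (ltP (Q y) 0) => Qy.
    have -> : Q h = D%:Z * Q y.
      rewrite Qh /D (big_morph Posz PoszD (erefl _)) big_distrl /=.
      by apply: eq_bigr => P _; rewrite Qpole.
    rewrite pole_orderE // /N.
    have : delta Q <= D%:Z.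
      have [/kD|/hs ->] := boolP (Q \in s); last by [].
      by rewrite /k; lia.
    nia.
  rewrite pole_order0 // mulr0 add0r Qh.
  have [Qs|/hs ->] := boolP (Q \in s); last first.
    by apply: sumr_ge0 => P _; apply: mulr_ge0 => //; apply: Qreg.
  rewrite (big_rem Q) //=.
  have h1 : 0 <= \sum_(P <- rem Q s) (k P)%:Z * Q (y - iota (b P)).
    by apply: sumr_ge0 => P _; apply: mulr_ge0 => //; apply: Qreg.
  apply: le_trans (_ : (k Q)%:Z * Q (y - iota (b Q)) <= _); last by rewrite lerDl.
  by have := hb Q Qy; rewrite /k; nia.
have LE z : Lspace E z <-> Vpoles iota y N%:Z (h * z).
  have [->|z0] := eqVneq z 0.
    by rewrite mulr0; split => _ P; left.
  split => hz P; right.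
    by have := vgeP z0 (hz P); rewrite pvalM // /E; lia.
  by have := vgeP (mulf_neq0 h0 z0) (hz P); rewrite pvalM // /E; lia.
have aN' i : (a i <= N)%N by have := aN i; rewrite /N; lia.
have hdE := dim_scale h0 LE (dim_Vpoles n0 hy hf ha hmin aN').
pose S := undup (s ++ sp ++ flatten [seq zs (b P) | P <- s]).
have uS : uniq S by apply: undup_uniq.
have sS P : P \in s -> P \in S by rewrite mem_undup mem_cat => ->.
have pS P : P y < 0 -> P \in S.
  by move=> Py; rewrite mem_undup !mem_cat hsp Py orbT.
have zS P Q : Q \in s -> P (y - iota (b Q)) != 0 -> P \in S.
  move=> Qs ne; case: (ltP (P y) 0) => Py; first exact: pS.
  rewrite mem_undup !mem_cat; apply/orP; right; apply/orP; right.
  apply/flatten_mapP; exists Q => //; have [_ ->] := hzs (b Q).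
  by rewrite lt0r ne Qreg.
have [|e [he le]] := Lspace_steps n0 hy uS dE _ hd.
  move=> P PS; rewrite (hs P) ?(contra (sS P)) // /E pole_order0; last first.
    by rewrite leNgt; apply: contra PS; apply: pS.
  rewrite mulr0 add0r Qh big_seq big1 // => Q Qs.
  have [->|ne] := eqVneq (P (y - iota (b Q))) 0; first by rewrite mulr0.
  by rewrite (zS _ _ Qs ne) in PS.
move: le; rewrite -(dim_unique hdE he) sumrB.
rewrite (sum_subseq (F := delta) uS us sS hs).
(* div(h) has degree 0, so deg E is that of N times the pole divisor. *)
have -> : \sum_(P <- S) E P = N%:Z * n%:Z.
  rewrite big_split /= -big_distrr /= (poles_degree n0 hy uS pS).
  rewrite (eq_bigr _ (fun P _ => Qh P)) exchange_big /= big_seq big1 ?addr0 // => Q Qs.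
  rewrite -big_distrr /= (div_degree n0 (deg_over_shift (b Q) hy) uS) ?mulr0 //.
  by move=> P; apply: zS.
have := sum_dim aN'; rewrite -/sa.
move: (\sum_(P <- s) delta P) (\sum_i (N - a i).+1)%N => X D' e1 e2.
have e3 : D'%:Z + sa%:Z = n%:Z * N%:Z + n%:Z by lia.
lia.
Qed.

(** The bound of [riemann_bound] is attained by DN, the multiple sa of the pole divisor, whose
    dimension is known exactly. *)
Lemma genus_sum : (genus iota)%:Z = (\sum_i a i)%N%:Z - n%:Z + 1.
Proof.
set sa := (\sum_i a i)%N.
have aN i : (a i <= sa)%N by rewrite /sa (bigD1 i) //= leq_addr.
have RRE (D : divisor iota) : RRspace D = Lspace D.
  apply/seteqP; split => z /=.
    by case=> [->|h] P; [left|right; have := h P; lia].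
  have [->|z0] := eqVneq z 0; first by left.
  by move=> h; right => P; have := vgeP z0 (h P); lia.
have RRd (D : divisor iota) : is_dim iota (Lspace D) (RRdim D).
  rewrite /RRdim RRE; apply: (@xgetPex _ 0%N [set d | is_dim iota (Lspace D) d]%classic).
  apply: (Lspace_finite n0 hy (s := finsupp D)) => P PD.
  by apply/eqP; rewrite -memNfinsupp.
have up (D : divisor iota) : divdeg D - (RRdim D)%:Z <= sa%:Z - n%:Z.
  apply: riemann_bound (RRd D); first exact: fset_uniq.
  by move=> P PD; apply/eqP; rewrite -memNfinsupp.
have [sp [usp hsp]] := poles_finite n0 hy.
pose DN : divisor iota := [fsfun P in seq_fset tt sp => sa%:Z * pole_order y P].
have DNE P : DN P = sa%:Z * pole_order y P.
  rewrite fsfunE; case: ifP => // /negbT; rewrite seq_fsetE hsp -leNgt => h.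
  by rewrite pole_order0 // mulr0.
have DNd : divdeg DN = sa%:Z * n%:Z.
  rewrite /divdeg -(sum_subseq (s := sp)) //.
  - rewrite (eq_bigr _ (fun P _ => DNE P)) -big_distrr /= (poles_degree n0 hy usp) //.
    by move=> P; rewrite hsp.
  - exact: fset_uniq.
  - by move=> P; rewrite mem_finsupp DNE hsp; apply: contraR; rewrite -leNgt => h;
      rewrite pole_order0 // mulr0.
  - by move=> P PD; apply/eqP; rewrite -memNfinsupp.
have DNdim : (RRdim DN + sa)%N = (n * sa.+1)%N.
  have := sum_dim aN; rewrite -/sa => <-; congr (_ + _)%N.
  apply: (dim_unique (RRd DN)); rewrite (_ : Lspace DN = Vpoles iota y sa%:Z).
    exact: (dim_Vpoles n0 hy hf ha hmin aN).
  by apply/seteqP; split => z h P; have := h P; rewrite DNE.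
(* Dimension at most 1 for the zero divisor makes [sa - n + 1] nonnegative, hence a candidate for
   the natural number g. *)
have z0 : RRdim ([fsfun] : divisor iota) = 1%N \/ RRdim ([fsfun] : divisor iota) = 0%N.
  have [P0 _] := pole_exists n0 hy.
  have h0 : is_dim iota (Lspace (fun P => if P == P0 then -1 else 0)) 0.
    by apply: (Lspace_trivial n0 hy (P := P0)) => [Q|]; [case: eqP|rewrite eqxx].
  have [||d [hd le]] := Lspace_step1 n0 hy (d2 := ([fsfun] : divisor iota)) (P0 := P0) _ _ h0.
  - by rewrite fsfun0E eqxx.
  - by move=> P /negbTE ->; rewrite fsfun0E.
  rewrite (dim_unique (RRd _) hd); lia.
have g0 : 0 <= sa%:Z - n%:Z + 1.
  have := up ([fsfun] : divisor iota).
  by rewrite /divdeg big1 => [|P _]; rewrite ?fsfun0E //; lia.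
have ex : is_genus iota (absz (sa%:Z - n%:Z + 1)%R).
  rewrite /is_genus gez0_abs //; split; first by move=> D; have := up D; lia.
  by exists DN; rewrite DNd; lia.
have [h1 [D h2]] : is_genus iota (genus iota).
  by apply: (@xgetPex _ 0%N [set g | is_genus iota g]%classic); exists (absz (sa%:Z - n%:Z + 1)%R).
have := h1 DN; rewrite DNd; have := up D; lia.
Qed.

End Riemann.

End Genus.

(** * Discriminant and ramification *)

(** All the eigenvalues are 0, so the characteristic polynomial is a power of X. Nilpotency is
    expressed on row vectors, uniformly in the size n. *)
Lemma nilpotent_trace (F : closedFieldType) (n k : nat) (A : 'M[F]_n) :
  (forall v : 'rV[F]_n, iter k (mulmxr A) v = 0) -> \tr A = 0.
Proof.
case: n A => [|n] A hA; first by rewrite /mxtrace big_ord0.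
have [r e] := closed_field_poly_normal (char_poly A).
rewrite (monicP (char_poly_monic A)) scale1r in e.
have hr : all (pred1 0) r.
  apply/allP => x xr /=; have : root (char_poly A) x by rewrite e root_prod_XsubC.
  rewrite -eigenvalue_root_char => /eigenvalueP [v vA v0].
  have hk m : iter m (mulmxr A) v = x ^+ m *: v.
    elim: m => [|m IH]; first by rewrite expr0 scale1r.
    by rewrite iterS IH /= -scalemxAl vA scalerA exprSr.
  have := hA v; rewrite hk => /eqP; rewrite scaler_eq0 (negbTE v0) orbF expf_eq0.
  by case/andP.
have sr : size r = n.+1.
  by have := congr1 (fun p : {poly F} => size p) e; rewrite size_char_poly size_prod_XsubC => -[].
have eX : char_poly A = 'X^(n.+1).
  rewrite e -sr; elim: r hr {e sr} => [|x r IH] /=; first by rewrite big_nil expr0.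
  by case/andP => /eqP -> /IH er; rewrite big_cons er subr0 exprS.
have := char_poly_trace A (ltn0Sn n); rewrite eX coefXn /= ltn_eqF //= => /eqP.
by rewrite eq_sym oppr_eq0 => /eqP.
Qed.

Section Discriminant.

Variables (C : closedFieldType) (K : fieldType) (iota : {rmorphism C -> K}).
Implicit Types (P Q : place iota) (z u v w g h t : K) (p q : {poly C}).
Variables (y : K) (n : nat).
Hypotheses (n0 : (0 < n)%N) (hy : deg_over iota y n).
Hypothesis char0 : forall k : nat, (k.+1%:R : C) != 0.
Variables (a : 'I_n -> nat) (f : 'I_n -> K).
Hypotheses (hf : indep (peval iota y) f) (ha : forall i, Vpoles iota y (a i)%:Z (f i)).
Hypothesis hmin : forall (a' : 'I_n -> nat) (f' : 'I_n -> K), indep (peval iota y) f' ->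
     (forall i, Vpoles iota y (a' i)%:Z (f' i)) -> (\sum_i a i <= \sum_i a' i)%N.

Notation pey := (peval iota y).
Notation Vy := (Vpoles iota y).

(** Regularity outside the poles of y, that is, integrality over C[y]; N only bounds the poles at
    infinity. *)
Definition is_integral g : Prop := exists N, Vy N g.

Lemma integralM g h : is_integral g -> is_integral h -> is_integral (g * h).
Proof. by move=> [N hg] [M hh]; exists (N + M); apply: VpolesM. Qed.

Lemma integral_f i : is_integral (f i). Proof. by exists (a i)%:Z. Qed.

Lemma integral_pe p : is_integral (pey p).
Proof. by exists (size p)%:Z; apply: Vpoles_pe. Qed.

Lemma integralD g h : is_integral g -> is_integral h -> is_integral (g + h).
Proof.
move=> [N hg] [M hh]; exists (Num.max N M); apply: VpolesD.
  by apply: Vpoles_le hg; lia.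
by apply: Vpoles_le hh; lia.
Qed.

Lemma integral_sum (I : Type) (s : seq I) (F : I -> K) :
  (forall i, is_integral (F i)) -> is_integral (\sum_(i <- s) F i).
Proof.
move=> h; apply: (big_ind is_integral) => //; last exact: integralD.
by exists 0; apply: Vpoles0.
Qed.

Lemma integralX g k : is_integral g -> is_integral (g ^+ k).
Proof.
move=> hg; elim: k => [|k IH]; last by rewrite exprS; apply: integralM.
by rewrite expr0 -(rmorph1 pey); apply: integral_pe.
Qed.

Definition mult_by g (M : 'M[{poly C}]_n) : Prop :=
  forall i, g * f i = \sum_j pey (M i j) * f j.

(** The matrix acts on the basis by rows, so products are reversed in [mult_mxM]. *)
Definition mult_mx g : 'M[{poly C}]_n := xget 0 [set M | mult_by g M]%classic.

Lemma mult_mxP g : is_integral g -> mult_by g (mult_mx g).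
Proof.
move=> hg; apply: (@xgetPex _ 0 [set M | mult_by g M]%classic).
have /choice [c hc] i : exists c : 'I_n -> {poly C}, g * f i = \sum_j pey (c j) * f j.
  have [N hN] := integralM hg (integral_f i).
  exact: (reduced_span n0 hy hf ha hmin hN).
exists (\matrix_(i, j) c i j) => i; rewrite hc.
by apply: eq_bigr => j _; rewrite mxE.
Qed.

Lemma mult_mx_unique g M : mult_by g M -> mult_mx g = M.
Proof.
move=> hM; have h : mult_by g (mult_mx g).
  by apply: (@xgetPex _ 0 [set M | mult_by g M]%classic); exists M.
apply/matrixP => i j; apply/eqP; rewrite -subr_eq0; apply/eqP.
apply: (hf (p := fun j => mult_mx g i j - M i j)).
under eq_bigr do rewrite rmorphB mulrBl.
by rewrite sumrB -h -hM subrr.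
Qed.

Lemma mult_mxM g h : is_integral g -> is_integral h -> mult_mx (g * h) = mult_mx h *m mult_mx g.
Proof.
move=> hg hh; apply: mult_mx_unique => i.
rewrite -mulrA (mult_mxP hh) big_distrr /=.
transitivity (\sum_j \sum_k pey (mult_mx h i j * mult_mx g j k) * f k).
  apply: eq_bigr => j _; rewrite mulrCA (mult_mxP hg) big_distrr /=.
  by apply: eq_bigr => k _; rewrite rmorphM mulrA.
rewrite exchange_big /=; apply: eq_bigr => k _.
by rewrite -big_distrl /= mxE rmorph_sum.
Qed.

Lemma mult_mx_pe p : mult_mx (pey p) = p%:M.
Proof.
apply: mult_mx_unique => i; rewrite (bigD1 i) //= mxE eqxx mulr1n big1 ?addr0 // => j ji.
by rewrite mxE eq_sym (negbTE ji) mulr0n rmorph0 mul0r.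
Qed.

Lemma mult_mx_sum (c : 'I_n -> {poly C}) (g : 'I_n -> K) : (forall j, is_integral (g j)) ->
  mult_mx (\sum_j pey (c j) * g j) = \sum_j c j *: mult_mx (g j).
Proof.
move=> hg; apply: mult_mx_unique => i.
rewrite big_distrl /=.
transitivity (\sum_j \sum_k pey (c j * mult_mx (g j) i k) * f k).
  apply: eq_bigr => j _; rewrite -mulrA (mult_mxP (hg j)) big_distrr /=.
  by apply: eq_bigr => k _; rewrite rmorphM mulrA.
rewrite exchange_big /=; apply: eq_bigr => k _.
rewrite -big_distrl /= summxE rmorph_sum; congr (_ * _).
by apply: eq_bigr => j _; rewrite mxE.
Qed.

Definition mult_tr g : {poly C} := \tr (mult_mx g).

Lemma mult_tr_sum (c : 'I_n -> {poly C}) (g : 'I_n -> K) : (forall j, is_integral (g j)) ->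
  mult_tr (\sum_j pey (c j) * g j) = \sum_j c j * mult_tr (g j).
Proof.
move=> hg; rewrite /mult_tr mult_mx_sum // raddf_sum; apply: eq_bigr => j _.
by rewrite /= mxtraceZ.
Qed.

(** After evaluation at b, multiplication by [y - b] is 0, so multiplication by t is nilpotent over
    C. *)
Lemma mult_tr_nilpotent t g b k : is_integral t -> is_integral g ->
  t ^+ k = (y - iota b) * g -> (mult_tr t).[b] = 0.
Proof.
move=> ht hg e.
pose ev := map_mx (horner_eval b) : 'M[{poly C}]_n -> 'M[C]_n.
have -> : (mult_tr t).[b] = \tr (ev (mult_mx t)).
  by rewrite /mult_tr /mxtrace horner_sum; apply: eq_bigr => i _; rewrite mxE.
apply: (@nilpotent_trace C n k) => v.
have hk m : iter m (mulmxr (ev (mult_mx t))) v = v *m ev (mult_mx (t ^+ m)).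
  elim: m => [|m IH].
    rewrite expr0 -(rmorph1 pey) mult_mx_pe /ev map_scalar_mx /=.
    by rewrite /horner_eval hornerC mulmx1.
  rewrite iterS IH /= -mulmxA; congr (_ *m _).
  by rewrite exprS mult_mxM //; [rewrite /ev map_mxM|exact: integralX].
rewrite hk e -(peXsubC iota y b) mult_mxM //; last exact: integral_pe.
rewrite mult_mx_pe mul_mx_scalar /ev map_mxZ /= {1}/horner_eval hornerXsubC subrr.
by rewrite scale0r mulmx0.
Qed.

Definition discr_mx : 'M[{poly C}]_n := \matrix_(i, j) mult_tr (f i * f j).

Definition discr : {poly C} := \det discr_mx.

(** The product [f i * f j * f k] has pole order at most [a i + a j + a k], so [reduced_degree]
    bounds the k-th diagonal entry by [a i + a j]. *)
Lemma size_mult_tr i j : (size (mult_tr (f i * f j)) <= (a i + a j).+1)%N.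
Proof.
rewrite /mult_tr /mxtrace; apply: (leq_trans (size_sum _ _ _)); apply/bigmax_leqP => k _.
have hij := integralM (integral_f i) (integral_f j).
set M := mult_mx _; have hM := mult_mxP hij k; rewrite -/M in hM.
have : Vy ((a i)%:Z + (a j)%:Z + (a k)%:Z) (f i * f j * f k).
  by apply: VpolesM => //; apply: VpolesM.
rewrite hM => /(reduced_degree n0 hy hf ha hmin) h.
have [->|Mk] := eqVneq (M k k) 0; first by rewrite size_poly0.
by have := h k Mk; rewrite lerD2r -PoszD lez_nat; case: (size (M k k)).
Qed.

Lemma size_discr : (size discr <= (2 * \sum_i a i).+1)%N.
Proof.
rewrite /discr /determinant; apply: (leq_trans (size_sum _ _ _)).
apply/bigmax_leqP => s _; rewrite mulr_sign.
have h : (size (\prod_i discr_mx i (s i))%R <= (2 * \sum_i a i).+1)%N.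
  apply: (leq_trans (size_prod_leq _ _)).
  have : (\sum_i size (discr_mx i (s i)) <= \sum_(i < n) ((a i + a (s i)) + 1))%N.
    by apply: leq_sum => i _; rewrite mxE addn1; apply: size_mult_tr.
  have es : (\sum_i a (s i) = \sum_i a i)%N by rewrite [RHS](reindex_inj (@perm_inj _ s)).
  rewrite !big_split /= sum1_card card_ord es.
   move: (\sum_i size _)%N (\sum_i a i)%N => X Y; lia.
by case: ifP => _; rewrite ?size_polyN.
Qed.

(** If h is orthogonal to all [f i], clearing the denominators of [h^-1] writes some nonzero q(y) as
    h times a combination of the [f i]. Its trace n q would be 0, against characteristic 0. *)
Lemma discr_neq0 : discr != 0.
Proof.
apply/det0P => -[v v0 vT].
pose h := \sum_j pey (v 0 j) * f j.
have ih : is_integral h.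
  by apply: integral_sum => j; apply: integralM; [exact: integral_pe|exact: integral_f].
have h0 : h != 0.
  apply: contra_neq v0 => /hf e; apply/rowP => j; rewrite mxE; exact: e.
have trh i : mult_tr (h * f i) = 0.
  rewrite /h big_distrl /=; under eq_bigr do rewrite -mulrA.
  rewrite mult_tr_sum; last by move=> j; apply: integralM; apply: integral_f.
  have := congr1 (fun M : 'rV_n => M 0 i) vT; rewrite !mxE => e.
  by rewrite -[RHS]e; apply: eq_bigr => j _; rewrite mxE.
have [q [N [q0 hg]]] := Vpoles_ex n0 hy h^-1.
have [c ec] := reduced_span n0 hy hf ha hmin hg.
have : mult_tr (pey q) = 0.
  have -> : pey q = \sum_i pey (c i) * (h * f i).
    under eq_bigr do rewrite mulrCA.
    by rewrite -big_distrr /= -ec mulrCA mulfV // mulr1.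
  rewrite mult_tr_sum; last by move=> i; apply: integralM => //; apply: integral_f.
  by rewrite big1 // => i _; rewrite trh mulr0.
rewrite /mult_tr mult_mx_pe mxtrace_scalar => /eqP; rewrite -mulr_natr mulf_eq0 (negbTE q0) /=.
rewrite -polyC_natr polyC_eq0; apply/negP.
by case: (n) n0 => // k _; apply: char0.
Qed.

(* An element t of value 1 at P0 that vanishes at all the places over b is
   nilpotent modulo y - b, hence in the kernel of the trace form at b. If the
   discriminant did not vanish at b, then t would be divisible by y - b. *)
Lemma discr_ramified b P0 : 2 <= P0 (y - iota b) -> root discr b.
Proof.
move=> hP0; rewrite /root -/(horner_eval b discr) /discr -det_map_mx.
apply: contraT => hdet; exfalso.
have yb := deg_over_sub_neq0 b n0 hy.
have Xb0 : ('X - b%:P : {poly C}) != 0 by rewrite polyXsubC_eq0.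
have hw := deg_over_shift b hy.
have [s [us hs]] := zeros_finite n0 hw.
have reg P : 0 < P (y - iota b) -> 0 <= P y.
  move=> h; apply: (vgeP (deg_over_gen_neq0 n0 hy)).
  rewrite -(subrK (iota b) y); apply: vgeD; last exact: vge_const.
  by right; exact: ltW.
have [|t [t0 P0t ht]] := @weak_approximation _ _ iota P0 [seq Q <- s | Q != P0] 1 1.
  by rewrite mem_filter eqxx.
have ht1 P : 0 < P (y - iota b) -> 1 <= P t.
  move=> h; have [->|ne] := eqVneq P P0; first by rewrite P0t.
  by apply: ht; rewrite mem_filter ne hs.
(* t may have finite poles away from b. Multiplication by q removes them, and the power of [y - b]
   in q is split off so that the values over b do not change. *)
have [q [N [q0 hq]]] := Vpoles_ex n0 hy t.
have [q1 q1b eq1] := mup_spec b q0; move: (mup b q) eq1 => r eq1.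
have q10 : q1 != 0 by apply: contraNneq q1b => ->; rewrite horner0.
have q1y0 := deg_over_neq0 n0 hy q10.
pose t1 := pey q1 * t.
have t10 : t1 != 0 by rewrite mulf_neq0.
have t1P P : 0 < P (y - iota b) -> P t1 = P t.
  move=> h; have hv : vge P (y - iota b) 1 by right; rewrite -gtz0_ge1.
  by have [_ e] := pval_pe_nroot hv q1b; rewrite pvalM // e add0r.
have et1 : pey q * t = (y - iota b) ^+ r * t1.
  by rewrite eq1 rmorphM rmorphXn /= peXsubC /t1; ring.
have Pyb P : P y < 0 -> P (y - iota b) = P y.
  move=> Py; apply: pval_add_eq; first exact: deg_over_gen_neq0 n0 hy.
  by apply: vgeN; apply: vgeW (vge_const P b); clear -Py; lia.
have nr P : 0 <= P y -> ~ 0 < P (y - iota b) -> P (y - iota b) = 0.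
  move=> Py h; have : 0 <= P (y - iota b).
    by apply: (vgeP yb); apply: vgeB; [right|exact: vge_const].
  clear -h; lia.
have ht1N : Vy N%:Z t1.
  move=> P; right; have := vgeP _ (hq P); rewrite et1 mulf_neq0 ?expf_neq0 // => /(_ isT).
  rewrite pvalM ?expf_neq0 // pvalX.
  case: (ltP (P y) 0) => Py; first by rewrite Pyb // pole_orderE //; clear -Py; nia.
  case: (ltP 0 (P (y - iota b))) => h.
    by rewrite pole_order0 // t1P //; have := ht1 _ h; clear; lia.
  by rewrite (nr P Py) ?mulr0 ?add0r // => h'; clear -h h'; lia.
have it1 : is_integral t1 by exists N%:Z.
have Pn P : 0 < P (y - iota b) -> P (y - iota b) <= n%:Z.
  move=> h; have := zeros_bound (s := [:: P]) n0 hw isT; rewrite big_seq1 => h1.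
  have : (`|P (y - iota b)%R| <= n)%N by apply: h1 => Q; rewrite inE => /eqP ->.
  clear -h; lia.
(* The exponent n suffices: [t1 * f i], if nonzero, has value at least 1 at each zero of [y - b],
   and [y - b] has value at most n there. *)
have nil i : (mult_tr (t1 * f i)).[b] = 0.
  have it : is_integral (t1 * f i) by apply: integralM => //; apply: integral_f.
  pose g := (t1 * f i) ^+ n / (y - iota b).
  have [N' hN'] := integralX n it.
  apply: (@mult_tr_nilpotent _ g b n) => //; last by rewrite /g mulrCA mulfV ?mulr1.
  exists N' => P.
  have [fi|fi] := eqVneq (f i) 0.
    by left; rewrite /g fi mulr0 expr0n (gtn_eqF n0) mul0r.
  have tf0 : t1 * f i != 0 by rewrite mulf_neq0.
  right; have hp := vgeP _ (hN' P); rewrite expf_neq0 // in hp.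
  have := hp isT; rewrite pval_div ?expf_neq0 // pvalX => {}hp.
  case: (ltP (P y) 0) => Py; first by rewrite Pyb // pole_orderE //; move: hp; rewrite pole_orderE //; clear -Py; lia.
  case: (ltP 0 (P (y - iota b))) => h.
    rewrite pole_order0 // mulr0 oppr0 pvalM // t1P //.
    have := vgeP fi (Vpoles_regular (ha i) Py); have := ht1 _ h; have := Pn _ h; clear; nia.
  by rewrite (nr P Py) ?subr0 // => h'; clear -h h'; lia.
have [c ec] := reduced_span n0 hy hf ha hmin ht1N.
have cb : (\row_j (c j).[b]) *m map_mx (horner_eval b) discr_mx = 0.
  apply/rowP => i; rewrite !mxE.
  transitivity (mult_tr (t1 * f i)).[b]; last exact: nil.
  rewrite ec big_distrl /=.
  rewrite (eq_bigr (fun j => pey (c j) * (f j * f i))); last by move=> j _; rewrite mulrA.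
  rewrite mult_tr_sum; last by move=> j; apply: integralM; apply: integral_f.
  rewrite horner_sum; by apply: eq_bigr => j _; rewrite !mxE hornerM.
have cb0 j : (c j).[b] = 0.
  have : \row_j (c j).[b] = 0.
    apply/eqP; apply: contraNT hdet => ne; apply/det0P.
    by exists (\row_j (c j).[b]).
  by move/rowP/(_ j); rewrite !mxE.
have /choice [c' hc'] j : exists r, pey (c j) = pey r * (y - iota b).
  have [r' [_ e]] := pe_root iota y (introT rootP (cb0 j)).
  by exists r'.
have e2 : t1 = (y - iota b) * \sum_j pey (c' j) * f j.
  rewrite {1}ec big_distrr /=; apply: eq_bigr => j _; rewrite hc'; ring.
have P0y : 0 <= P0 y by apply: reg; clear -hP0; lia.
(* As a multiple of [y - b], t1 would have value at least 2 at P0, while its value there is 1. *)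
have : vge P0 t1 (P0 (y - iota b) + 0).
  rewrite e2; apply: vgeM; first by right.
  apply: vge_sum => j _; rewrite -[X in vge _ _ X]add0r; apply: vgeM.
    by apply: vge_pe; right.
  exact: Vpoles_regular (ha j) P0y.
move=> /(vgeP t10); rewrite t1P ?P0t; clear -hP0; lia.
Qed.

Lemma ramified_count (S : seq C) : uniq S ->
  (forall b, b \in S -> exists P : place iota, 2 <= P (y - iota b)) ->
  (size S <= 2 * \sum_i a i)%N.
Proof.
move=> uS hS; rewrite -ltnS; apply: leq_trans size_discr.
apply: max_poly_roots => //; first exact: discr_neq0.
by apply/allP => b /hS [P]; apply: discr_ramified.
Qed.

End Discriminant.

Theorem ramified_le_genus (C : closedFieldType) (K : fieldType)
    (iota : {rmorphism C -> K}) (y : K) (n : nat) (S : seq C) :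
  (forall k : nat, (k.+1%:R : C) != 0) -> (0 < n)%N -> deg_over iota y n -> uniq S ->
  (forall b, b \in S -> exists P : place iota, 2 <= P (y - iota b)) ->
  (size S)%:Z <= 2 * ((genus iota)%:Z + n%:Z - 1).
Proof.
move=> char0 n0 hy uS hS.
have [a [f [hf ha hmin]]] := minimal_basis n0 hy.
have := ramified_count n0 hy char0 hf ha hmin uS hS.
have := genus_sum n0 hy hf ha hmin; move: (\sum_i a i)%N => X; lia.
Qed.

(** * Fibers of rational functions *)

Lemma sum_mup_le (F : closedFieldType) (g : {poly F}) (s : seq F) : g != 0 -> uniq s ->
  (\sum_(x <- s) mup x g <= (size g).-1)%N /\
  ((forall x, root g x -> x \in s) -> \sum_(x <- s) mup x g = (size g).-1)%N.
Proof.
move=> g0 us; have [r e] := closed_field_poly_normal g.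
have l0 : lead_coef g != 0 by rewrite lead_coef_eq0.
have mE x : mup x g = count_mem x r.
  rewrite e -mul_polyC mupMr ?mu_prod_XsubC // rootC //.
have -> : (size g).-1 = size r by rewrite e size_scale // size_prod_XsubC.
have rE x : root g x = (x \in r) by rewrite e rootZ // root_prod_XsubC.
rewrite (eq_bigr _ (fun x _ => mE x)).
have {}rE : (forall x, root g x -> x \in s) -> {subset r <= s}.
  by move=> h x; rewrite -rE; apply: h.
suff [h1 h2] : (\sum_(x <- s) count_mem x r <= size r)%N /\
    ({subset r <= s} -> \sum_(x <- s) count_mem x r = size r)%N.
  by split => // /rE /h2.
elim: r {e mE rE} => [|y r [IH1 IH2]] /=; first by rewrite big1.
have -> : (\sum_(x <- s) ((y == x) + count_mem x r) =
    (y \in s) + \sum_(x <- s) count_mem x r)%N.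
  rewrite big_split /=; congr (_ + _)%N.
  rewrite -(count_uniq_mem _ us) -sum1_count [RHS]big_mkcond /=.
  by apply: eq_bigr => x _; rewrite eq_sym; case: eqP.
split; first by case: (y \in s); lia.
move=> h; rewrite h ?mem_head // IH2 // => x xr; apply: h.
by rewrite inE xr orbT.
Qed.

Lemma pi_ratioE (R : idomainType) (x : {ratio R}) :
  \pi_({fraction R})%qT x * FracField.tofrac \d_x = FracField.tofrac \n_x.
Proof.
have d0 := denom_ratioP x.
unlock FracField.tofrac; rewrite -[LHS]FracField.pi_mul.
apply/eqmodP; rewrite /= FracField.equivfE /FracField.mulf.
by rewrite !numden_Ratio ?oner_neq0 ?mulr1 ?mulf_neq0 ?oner_neq0 // mulrC.
Qed.

Section RationalFunction.

Variable C : closedFieldType.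
Implicit Types (f : ratfun C) (p q u v g h : {poly C}).

Local Notation tf := (@FracField.tofrac _).

Lemma ratfun_spec f : [/\ ratden f != 0, coprimep (ratnum f) (ratden f) &
  (f : {fraction {poly C}}) * tf (ratden f) = tf (ratnum f)].
Proof.
have d0 := denom_ratioP (repr f); have := pi_ratioE (repr f); rewrite reprK.
rewrite /ratnum /ratden; set p := \n_ _; set q := \d_ _ => e.
have g0 : gcdp p q != 0 by rewrite gcdp_eq0 negb_and d0 orbT.
have ep : p = p %/ gcdp p q * gcdp p q by rewrite divpK // dvdp_gcdl.
have eq : q = q %/ gcdp p q * gcdp p q by rewrite divpK // dvdp_gcdr.
split.
- by apply: contraNneq d0 => h; rewrite -/q eq h mul0r.
- by apply: coprimep_div_gcd; rewrite d0 orbT.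
- have tg0 : tf (gcdp p q) != 0 by rewrite tofrac_eq0.
  by apply: (mulIf tg0); rewrite -mulrA -!tofracM -eq -ep.
Qed.

(** [ratnum] and [ratden] come from an arbitrary representative, so lowest terms are determined only
    up to a common scalar. *)
Lemma ratfun_unique f u v : v != 0 -> coprimep u v ->
  (f : {fraction {poly C}}) * tf v = tf u ->
  exists2 k, k != 0 & ratnum f = k *: u /\ ratden f = k *: v.
Proof.
move=> v0 cuv e; have [q0 cpq ef] := ratfun_spec f.
set p := ratnum f in cpq ef *; set q := ratden f in q0 cpq ef *.
have cross : p * v = q * u.
  by apply/eqP; rewrite -tofrac_eq !tofracM -ef -e; apply/eqP; rewrite [RHS]mulrCA mulrA.
have /eqpfP e1 : q %= v.
  rewrite /eqp; apply/andP; split.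
    rewrite -(@Gauss_dvdpr _ v p q) ?cross ?dvdp_mulr //; by rewrite coprimep_sym.
  rewrite -(@Gauss_dvdpl _ q u v) -?cross ?dvdp_mull //; by rewrite coprimep_sym.
have {e1} [k k0 e1] : exists2 k, k != 0 & q = k *: v.
  by exists (lead_coef q / lead_coef v); rewrite // mulf_neq0 ?invr_eq0 ?lead_coef_eq0.
exists k => //; split => //; apply: (mulIf v0); rewrite cross e1 -!mul_polyC; ring.
Qed.

Section Fibers.

Variable f : ratfun C.
Local Notation p := (ratnum f).
Local Notation q := (ratden f).
Local Notation n := (ratdeg f).

Lemma ratdeg_num : (size q < size p)%N -> n = (size p).-1.
Proof. by rewrite /ratdeg; case: (size p) => [|i]; case: (size q) => [|j] //=; lia. Qed.

Lemma ratdeg_den : (size p <= size q)%N -> n = (size q).-1.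
Proof. by rewrite /ratdeg; case: (size p) => [|i]; case: (size q) => [|j] //=; lia. Qed.

Hypothesis n0 : (0 < n)%N.

(* The zeros of the binary form of degree n associated to [fibpoly z] are the
   points of the fiber of f over z; [fibmult] is the multiplicity of such a zero. *)
Definition fibpoly (z : P1 C) : {poly C} := if z is Some c then p - c *: q else q.

Definition fibmult (x : P1 C) g : nat :=
  if x is Some a then mup a g else (n - (size g).-1)%N.

Let q0 : q != 0. Proof. by case: (ratfun_spec f). Qed.
Let cpq : coprimep p q. Proof. by case: (ratfun_spec f). Qed.

Lemma ratnum_const_False k : (size q <= 1)%N -> p = k *: q -> False.
Proof.
move=> sq e; have := n0; rewrite /ratdeg e.
have sp : (size (k *: q) <= 1)%N := leq_trans (size_scale_leq _ _) sq.
by move: sp sq; case: (size (k *: q)) => [|[|]] //; case: (size q) => [|[|]].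
Qed.

Lemma ratnum_neq0 : p != 0.
Proof.
apply/eqP => e; move: cpq; rewrite e coprime0p /eqp => /andP [/dvdp_leq h _].
have := h (oner_neq0 _); rewrite size_poly1 => sq.
by apply: (@ratnum_const_False 0); rewrite ?scale0r.
Qed.

Lemma coprimep_fibpoly c : coprimep (p - c *: q) q.
Proof.
by rewrite coprimep_sym addrC -scaleNr -mul_polyC coprimep_addl_mul coprimep_sym.
Qed.

Lemma fibpoly_neq0 z : fibpoly z != 0.
Proof.
case: z => [c|] //=; apply/eqP => e.
have := coprimep_fibpoly c; rewrite e coprime0p /eqp => /andP [/dvdp_leq h _].
have := h (oner_neq0 _); rewrite size_poly1 => sq.
apply: (@ratnum_const_False c) => //.
by apply/eqP; rewrite -subr_eq0 e.
Qed.

Lemma size_ratnum : (size p <= n.+1)%N.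
Proof. by rewrite /ratdeg; case: (size p) => [|k] //=; rewrite ltnS leq_max leqnn. Qed.

Lemma size_ratden : (size q <= n.+1)%N.
Proof.
by rewrite /ratdeg; case: (size q) => [|k] //=; rewrite ltnS leq_max leqnn orbT.
Qed.

Lemma size_fibpoly z : (size (fibpoly z) <= n.+1)%N.
Proof.
case: z => [c|]; last exact: size_ratden.
rewrite /= (leq_trans (size_polyD _ _)) // geq_max size_ratnum size_polyN /=.
exact: leq_trans (size_scale_leq _ _) size_ratden.
Qed.

Lemma fibmult_gt0 x z : (0 < fibmult x (fibpoly z))%N <-> rateval f x = z.
Proof.
case: x => [a|]; rewrite /fibmult /rateval.
  rewrite -XsubC_dvd ?fibpoly_neq0 // dvdp_XsubCl /root.
  case: z => [c|] /=; last by case: eqP.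
  rewrite hornerD hornerN hornerZ; case: (eqVneq q.[a] 0) => qa; last first.
    rewrite subr_eq0; split => [/eqP ->|[<-]]; first by rewrite mulfK.
    by rewrite divfK.
  split => // /eqP; rewrite qa mulr0 subr0 => pa.
  have := coprimep_root cpq; move=> /(_ a); rewrite /root pa eqxx qa eqxx.
  by move=> /(_ isT).
have sq : (size q) = (size q).-1.+1 by rewrite prednK // size_poly_gt0.
have sp : (size p) = (size p).-1.+1 by rewrite prednK // size_poly_gt0 ratnum_neq0.
case: (ltnP (size q) (size p)) => h.
  have en := ratdeg_num h.
  case: z => [c|] /=; last first.
    by split => // _; rewrite en; move: h sq sp; move: (size p) (size q) => i j; lia.
  split => //; have -> : size (p - c *: q) = size p; last by rewrite en subnn.
  rewrite size_polyDl // size_polyN; apply: leq_ltn_trans h; exact: size_scale_leq.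
have en := ratdeg_den h.
case: z => [c|] /=; last by split => //; rewrite en subnn.
have l0 : lead_coef q != 0 by rewrite lead_coef_eq0.
have cf : (p - c *: q)`_n = p`_n - c * lead_coef q by rewrite coefB coefZ lead_coefE en.
have sf := size_fibpoly (Some c); rewrite /= in sf.
have -> : (0 < n - (size (p - c *: q)%R).-1)%N = ((p - c *: q)`_n == 0).
  apply/idP/eqP => [lt|cf0].
    by rewrite nth_default //; move: lt; move: (size (p - c *: q)) => k; lia.
  have : (size (p - c *: q)%R <= n)%N.
    apply/leq_sizeP => j; rewrite leq_eqVlt => /orP [/eqP <- //|lt].
    by rewrite nth_default // (leq_trans sf).
  by move: n0; move: (size (p - c *: q)) (ratdeg f) => k l; lia.
rewrite cf -en subr_eq0; split => [/eqP ->|[<-]]; first by rewrite mulfK.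
by rewrite divfK.
Qed.

Lemma fibmult_eq0 x z : rateval f x <> z -> fibmult x (fibpoly z) = 0%N.
Proof. by move=> h; apply/eqP; rewrite -leqn0 leqNgt; apply/negP => /fibmult_gt0. Qed.

(** The lowest terms of f - c and of 1 / f are (p - c q) / q and q / p. The denominator does not
    vanish at x, or has full degree if x is infinite. *)
Lemma locdegE x : locdeg f x = fibmult x (fibpoly (rateval f x)).
Proof.
have [_ _ ef] := ratfun_spec f.
have h0 := (fibmult_gt0 x (rateval f x)).2 erefl.
rewrite /locdeg; case ez: (rateval f x) => [c|].
  have [||k k0 [e1 e2]] := @ratfun_unique (f - tf c%:P) (p - c *: q) q q0.
  - exact: coprimep_fibpoly.
  - by rewrite mulrBl ef -tofracM -tofracB mul_polyC.
  rewrite /ratord e1 e2; case: x h0 ez => [a|] h0 ez /=.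
    have qa : ~~ root q a by move: ez; rewrite /= /root; case: eqP.
    rewrite -!mul_polyC !mupMr ?rootC // (mupNroot qa) subr0 //.
  rewrite !size_scale //; move: ez => /=; case: ltnP => // h _.
  have en := ratdeg_den h.
  have := size_fibpoly (Some c); have := fibpoly_neq0 (Some c).
  rewrite en /= -size_poly_gt0; have : (0 < size q)%N by rewrite size_poly_gt0.
  by move: (size (p - c *: q)) (size q) => i j; lia.
have [|||k k0 [e1 e2]] := @ratfun_unique f^-1 q p.
- exact: ratnum_neq0.
- by rewrite coprimep_sym.
- have f0 : (f : {fraction {poly C}}) != 0.
    apply: contraNneq ratnum_neq0 => e; move: ef; rewrite e mul0r => /esym /eqP.
    by rewrite tofrac_eq0.
  by apply: (mulfI f0); rewrite mulrA mulfV // mul1r.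
rewrite /ratord e1 e2; case: x h0 ez => [a|] h0 ez /=.
  have qa : root q a by move: ez; rewrite /= /root; case: eqP.
  have pa : ~~ root p a.
    apply/negP => pa; have := coprimep_root cpq pa.
    by move: qa; rewrite /root => /eqP ->; rewrite eqxx.
  by rewrite -!mul_polyC !mupMr ?rootC // (mupNroot pa) subr0.
rewrite !size_scale //; move: ez => /=; case: ltnP => // h _.
have en := ratdeg_num h.
rewrite en; have : (0 < size q)%N by rewrite size_poly_gt0.
by move: h; move: (size p) (size q) => i j; lia.
Qed.

Lemma locdeg_gt0 x : (0 < locdeg f x)%N.
Proof. by rewrite locdegE; apply/fibmult_gt0. Qed.

Lemma ratfun_fiber (z : P1 C) : exists s : seq (P1 C),
  [/\ uniq s, forall x, (x \in s) <-> rateval f x = z & (\sum_(x <- s) locdeg f x = n)%N].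
Proof.
set g := fibpoly z; have g0 : g != 0 := fibpoly_neq0 z.
have [r e] := closed_field_poly_normal g.
have rE a : (a \in r) = root g a by rewrite e rootZ ?lead_coef_eq0 // root_prod_XsubC.
pose sN : seq (P1 C) := if (0 < fibmult None g)%N then [:: None] else [::].
exists ([seq Some a | a <- undup r] ++ sN); split.
- rewrite cat_uniq map_inj_uniq ?undup_uniq; last by move=> a b [].
  rewrite /sN; case: ifP => _ //=; rewrite orbF andbT.
  by apply/negP => /mapP [].
- case=> [a|]; rewrite -fibmult_gt0 -/g mem_cat.
    rewrite mem_map ?mem_undup ?rE; last by move=> b c [].
    rewrite /fibmult -XsubC_dvd // dvdp_XsubCl.
    by rewrite (_ : (Some a \in sN) = false) ?orbF // /sN; case: ifP.
  rewrite (_ : (None \in [seq Some a | a <- undup r]) = false); last first.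
    by apply/negP => /mapP [].
  by rewrite /= /sN; case: ifP.
- have hz x : rateval f x = z -> locdeg f x = fibmult x g.
    by move=> ez; rewrite locdegE ez.
  rewrite big_cat big_map /=.
  have -> : (\sum_(a <- undup r) locdeg f (Some a) = (size g).-1)%N.
    have [_ <-] := sum_mup_le g0 (undup_uniq r); last by move=> x; rewrite mem_undup rE.
    rewrite big_seq [RHS]big_seq; apply: eq_bigr => a; rewrite mem_undup rE => ra.
    by rewrite hz //; apply/fibmult_gt0; rewrite /fibmult -XsubC_dvd // dvdp_XsubCl.
  have -> : (\sum_(x <- sN) locdeg f x = fibmult None g)%N.
    rewrite /sN; case: ifP => h; last by rewrite big_nil; move: h; case: fibmult.
    by rewrite big_seq1 hz //; apply/fibmult_gt0.
  rewrite /= subnKC //; have := size_fibpoly z; rewrite -/g; case: (size g) => //.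
Qed.

(** * Riemann-Hurwitz inequality for maps of the projective line *)

Hypothesis char0 : forall k : nat, (k.+1%:R : C) != 0.

Lemma deriv_eq0 g : g^`() = 0 -> (size g <= 1)%N.
Proof.
move=> h; apply/leq_sizeP => -[//|j] _.
have := congr1 (fun g : {poly C} => g`_j) h; rewrite coef_deriv coef0 => /eqP.
by rewrite -mulr_natr mulf_eq0 (negbTE (char0 j)) orbF => /eqP.
Qed.

(** The numerator of the derivative of g / h; for h = q and g = p it detects the ramification of
    f. *)
Definition wronsk g h := g^`() * h - g * h^`().

Lemma wronsk_neq0 : wronsk p q != 0.
Proof.
apply/eqP => /eqP; rewrite /wronsk subr_eq0 => /eqP e.
have : q %| p * q^`() by rewrite -e dvdp_mull.
rewrite Gauss_dvdpr; last by rewrite coprimep_sym.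
have dq0 : q %| q^`() -> q^`() = 0.
  move=> h; apply/eqP; apply: contraT => ne; have := dvdp_leq ne h.
  by rewrite leqNgt lt_size_deriv.
move=> /dq0 q'0; have sq := deriv_eq0 q'0.
move: e; rewrite q'0 mulr0 => /eqP; rewrite mulf_eq0 (negbTE q0) orbF => /eqP p'0.
have sp := deriv_eq0 p'0; have := n0; rewrite /ratdeg.
by move: sp sq; case: (size p) => [|[|]] //; case: (size q) => [|[|]].
Qed.

(** The Wronskian is invariant under replacing (p, q) by (p - c q, q) or (q, - p), so poles are
    treated like any other fiber. *)
Lemma wronsk_fib z : exists2 h : {poly C}, (size h <= n.+1)%N &
  wronsk p q = wronsk (fibpoly z) h.
Proof.
case: z => [c|] /=.
  exists q; first exact: size_ratden.
  rewrite /wronsk derivB derivZ -!mul_polyC; ring.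
exists (- p); first by rewrite size_polyN; exact: size_ratnum.
by rewrite /wronsk derivN; ring.
Qed.

Lemma wronsk_mup a : (locdeg f (Some a) - 1 <= mup a (wronsk p q))%N.
Proof.
rewrite mup_geq ?wronsk_neq0 //; set z := rateval f (Some a).
have [h _ ->] := wronsk_fib z.
have : ('X - a%:P) ^+ locdeg f (Some a) %| fibpoly z.
  by rewrite -mup_geq ?fibpoly_neq0 // locdegE.
have := locdeg_gt0 (Some a); case: (locdeg f (Some a)) => // e _.
move=> /dvdpP [k ->]; rewrite subn1 /= /wronsk derivM deriv_exp /=.
have -> : forall t : {poly C}, (k^`() * ('X - a%:P) ^+ e.+1 +
  k * (('X - a%:P)^`() * ('X - a%:P) ^+ e *+ e.+1)) * h - k * ('X - a%:P) ^+ e.+1 * t =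
  ((k^`() * ('X - a%:P) + k * (('X - a%:P)^`() *+ e.+1)) * h - k * ('X - a%:P) * t) *
    ('X - a%:P) ^+ e.
  move=> t; rewrite -[_ * _ *+ _]mulr_natr -[('X - a%:P)^`() *+ _]mulr_natr exprS.
  by move: (e.+1%:R) (('X - a%:P) ^+ e) (('X - a%:P)^`()) => N E X'; ring.
exact: dvdp_mull.
Qed.

(** The Wronskian is a form of degree 2 n - 2, and ramification at infinity lowers its degree as an
    affine polynomial. *)
Lemma size_wronsk : (size (wronsk p q) + locdeg f None <= 2 * n)%N.
Proof.
set z := rateval f None; have [h sh ->] := wronsk_fib z.
have eN : locdeg f None = (n - (size (fibpoly z)).-1)%N by rewrite locdegE.
have lN := locdeg_gt0 None; have g0 := fibpoly_neq0 z.
move: eN lN; set g := fibpoly z => -> lN.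
have sg : (0 < size g)%N by rewrite size_poly_gt0.
suff : (size (wronsk g h) <= (size g).-1 + n)%N by lia.
have sd (k : {poly C}) : (size k^`() <= (size k).-1)%N.
  have [->|k0] := eqVneq k 0; first by rewrite deriv0 size_poly0.
  by rewrite -ltnS prednK ?size_poly_gt0 // lt_size_deriv.
rewrite /wronsk (leq_trans (size_polyD _ _)) // geq_max size_polyN; apply/andP; split.
  apply: (leq_trans (size_polyMleq _ _)); move: sg sh (sd g).
  by move: (size g^`()) (size g) (size h) => i j k; lia.
apply: (leq_trans (size_polyMleq _ _)); move: sg sh (sd h).
by move: (size h^`()) (size g) (size h) => i j k; lia.
Qed.

Lemma sum_P1 (s : seq (P1 C)) (F : P1 C -> nat) : uniq s ->
  (\sum_(x <- s) F x <= \sum_(a <- pmap id s) F (Some a) + F None)%N /\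
  (None \notin s -> \sum_(x <- s) F x = \sum_(a <- pmap id s) F (Some a))%N.
Proof.
elim: s => [_|[a|] s IH] /=; first by rewrite !big_nil.
  move=> /andP [_ /IH [IH1 IH2]]; rewrite !big_cons; split; first by lia.
  by rewrite inE /= => /IH2 ->.
move=> /andP [Ns /IH [IH1 IH2]]; rewrite big_cons; split; last by [].
by rewrite (IH2 Ns); lia.
Qed.

Lemma riemann_hurwitz_P1 (s : seq (P1 C)) : uniq s ->
  (\sum_(x <- s) (locdeg f x - 1) + 2 <= 2 * n)%N.
Proof.
move=> us; have [h _] := sum_P1 (fun x => locdeg f x - 1)%N us.
have up : uniq (pmap id s).
  by apply: (pmap_uniq (g := Some)) => // -[].
have [h2 _] := sum_mup_le wronsk_neq0 up.
have h3 : (\sum_(a <- pmap id s) (locdeg f (Some a) - 1) <=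
  \sum_(a <- pmap id s) mup a (wronsk p q))%N.
  by apply: leq_sum => a _; apply: wronsk_mup.
have h4 := size_wronsk; have h5 := locdeg_gt0 None.
have h6 : (0 < size (wronsk p q))%N by rewrite size_poly_gt0 wronsk_neq0.
have {h2 h3} h2 := leq_trans h3 h2.
move: h h2; set X := (\sum_(x <- s) _)%N; set Y := (\sum_(a <- _) _)%N => h h2.
move: h4 h5 h6 h h2; clear; move: (size (wronsk p q)) (locdeg f None) X Y n => W L X Y k.
lia.
Qed.

End Fibers.

End RationalFunction.

(** * Bivariate polynomials *)

(** In the fraction field, reversal is X^N p(1/X), which is visibly multiplicative. *)
Lemma revpM (R : idomainType) (a b : nat) (p q : {poly R}) :
  (size p <= a.+1)%N -> (size q <= b.+1)%N -> revp (a + b) (p * q) = revp a p * revp b q.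
Proof.
move=> sp sq; pose tf := @FracField.tofrac {poly R}.
pose psi := tf \o polyC : {rmorphism R -> {fraction {poly R}}}.
have ev (g : {poly R}) : (map_poly psi g).[tf 'X] = tf g.
  by rewrite -[g in RHS]comp_polyXr /comp_poly /tf -(horner_map (@FracField.tofrac {poly R})) /= -map_poly_comp.
have X0 : tf 'X != 0 by rewrite tofrac_eq0 polyX_eq0.
have sM : (size (p * q)%R <= (a + b).+1)%N.
  apply: leq_trans (size_polyMleq _ _) _; move: sp sq; move: (size p) (size q) => i j; lia.
apply/eqP; rewrite -(tofrac_eq (R := {poly R})); apply/eqP; rewrite tofracM -/tf.
rewrite -(ev (revp _ _)) -(ev (revp a p)) -(ev (revp b q)).
by rewrite !horner_revp // rmorphM hornerM exprD mulrACA.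
Qed.

Lemma fresh_point (F : closedFieldType) (s : seq F) : exists c, c \notin s.
Proof.
(* The extra factor for 0 keeps the product nonconstant when s is empty. *)
pose p := \prod_(a <- 0 :: s) ('X - a%:P) + 1.
have [c pc] : exists c, root p c.
  apply/closed_rootP; rewrite /p size_polyDl ?size_prod_XsubC //= size_poly1 //.
exists c; apply/negP => cs; move: pc; rewrite /root /p hornerD hornerC horner_prod.
rewrite (big_rem c) /=; last by rewrite inE cs orbT.
by rewrite hornerXsubC subrr mul0r add0r oner_eq0.
Qed.

Section BivariateEvaluation.

Variables (C : closedFieldType) (K : fieldType) (iota : {rmorphism C -> K}).
Implicit Types (u v : K) (G F : {poly {poly C}}) (p q r s : {poly C}).

Definition ev2 u v : {poly {poly C}} -> K := horner_eval v \o map_poly (peval iota u).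

HB.instance Definition _ u v := GRing.RMorphism.on (ev2 u v).

Lemma ev2E u v G : ev2 u v G = (map_poly (peval iota u) G).[v]. Proof. by []. Qed.

Lemma ev2C u v p : ev2 u v p%:P = peval iota u p.
Proof. by rewrite ev2E map_polyC hornerC. Qed.

Lemma ev2X u v : ev2 u v 'X = v.
Proof. by rewrite ev2E map_polyX hornerX. Qed.

Lemma ev2_map u v p : ev2 u v p^:P = peval iota v p.
Proof.
rewrite ev2E peE -map_poly_comp; congr (_.[_]); apply: eq_map_poly => c /=.
by rewrite peC.
Qed.

Lemma ev2_swap u v G : ev2 u v G = ev2 v u (swapXY G).
Proof.
have ev a b H : ev2 a b H = (map_poly (map_poly iota) H).[b%:P].[a].
  rewrite ev2E -[RHS]/(horner_eval a _) -horner_map /= [horner_eval a _]hornerC.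
  by rewrite -map_poly_comp.
by rewrite !ev -swapXY_map horner2_swapXY.
Qed.

(** Together with F(u, v) = 0, this says that F generates the kernel of evaluation at (u, v). *)
Definition divker u v F : Prop := forall G, ev2 u v G = 0 -> exists H, G = H * F.

Lemma divker_swap u v F : divker u v F -> divker v u (swapXY F).
Proof.
move=> h G hG; have [|H e] := h (swapXY G); first by rewrite ev2_swap swapXYK.
by exists (swapXY H); rewrite -rmorphM /= -e swapXYK.
Qed.

Lemma divker_inv u v F m : v != 0 -> size F = m.+1 -> divker u v F -> divker u v^-1 (revp m F).
Proof.
move=> v0 sF h G hG; pose N := (size G + m)%N.
have sG : (size G <= N.+1)%N by apply: leqW; apply: leq_addr.
have [|H e] := h (revp N G).
  by rewrite ev2E horner_revp // -ev2E hG mulr0.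
have [->|G0] := eqVneq G 0; first by exists 0; rewrite mul0r.
have F0 : F != 0 by rewrite -size_poly_eq0 sF.
have H0 : H != 0.
  apply: contra_neq G0 => H0; apply: (revp_eq0 sG); by rewrite e H0 mul0r.
have sH : (size H <= (size G).+1)%N.
  have : (size (H * F)%R <= N.+1)%N by rewrite -e; apply: size_poly.
  by rewrite size_mul // sF addnS /N; move: (size H) (size G) => i j /=; lia.
exists (revp (size G) H); rewrite -revpM ?sF // -e revpK //.
Qed.

(** An equation 1 = (u - a) r + (v - b) s lifts to polynomials modulo F, and evaluation at the point
    (a, b) of F = 0 gives 1 = 0. *)
Lemma divker_proper u v F (a b : C) : divker u v F -> F.[b%:P].[a] = 0 ->
  proper_pair iota (u - iota a) (v - iota b) (fun z => exists G, z = ev2 u v G).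
Proof.
move=> h F0; split.
- split.
  + by move=> c; exists c%:P%:P; rewrite ev2C peC.
  + by move=> _ _ [G1 ->] [G2 ->]; exists (G1 + G2); rewrite rmorphD.
  + by move=> _ _ [G1 ->] [G2 ->]; exists (G1 * G2); rewrite rmorphM.
- by exists ('X - a%:P)%:P; rewrite ev2C peXsubC.
- by exists ('X - b%:P%:P); rewrite rmorphB /= ev2X ev2C peC.
- move=> _ _ [G1 ->] [G2 ->] e.
  have [|H eH] := h (('X - a%:P)%:P * G1 + ('X - b%:P%:P) * G2 - 1).
    have eb : ev2 u v ('X - b%:P%:P) = v - iota b by rewrite rmorphB /= ev2X ev2C peC.
    have ea : ev2 u v ('X - a%:P)%:P = u - iota a by rewrite ev2C peXsubC.
    by rewrite rmorphB rmorphD !rmorphM rmorph1 /= eb ea e subrr.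
  have := congr1 (fun G : {poly {poly C}} => G.[b%:P].[a]) eH.
  rewrite !(hornerE, F0, subrr, mul0r, mulr0, add0r, sub0r) => /eqP.
  by rewrite oppr_eq0 oner_eq0.
Qed.

(** This shape is stable under swapping the variables and under reversal, so it also describes the
    curve near its points at infinity. *)
Definition bipoly p q r s : {poly {poly C}} := p%:P * s^:P - q%:P * r^:P.

Lemma swap_bipoly p q r s : swapXY (bipoly p q r s) = bipoly s r q p.
Proof.
rewrite /bipoly rmorphB /= ![swapXY (_ * _)]rmorphM /= !swapXY_polyC !swapXY_map_polyC.
by rewrite [_ * p^:P]mulrC [_ * q^:P]mulrC.
Qed.

Lemma coef_bipoly p q r s i : (bipoly p q r s)`_i = s`_i *: p - r`_i *: q.
Proof. by rewrite coefB !coefCM !coef_map /= -!mul_polyC; ring. Qed.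

Lemma revp_bipoly m p q r s : revp m (bipoly p q r s) = bipoly p q (revp m r) (revp m s).
Proof.
apply/polyP => i; rewrite coef_bipoly !coef_poly; case: ifP => _; last by rewrite !scale0r subr0.
exact: coef_bipoly.
Qed.

Lemma horner_bipoly p q r s a b : (bipoly p q r s).[b%:P].[a] = p.[a] * s.[b] - q.[a] * r.[b].
Proof.
rewrite /bipoly hornerD hornerN !hornerM !hornerC !(horner_map (@polyC C)) /=.
by rewrite hornerD hornerN !hornerM !hornerC.
Qed.

Lemma ev2_bipoly u v p q r s : ev2 u v (bipoly p q r s) =
  peval iota u p * peval iota v s - peval iota u q * peval iota v r.
Proof. by rewrite /bipoly rmorphB !rmorphM /= !ev2C !ev2_map. Qed.

Definition linind p q : Prop := forall c d : C, c *: p = d *: q -> c = 0 /\ d = 0.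

Lemma linind_sym p q : linind p q -> linind q p.
Proof. by move=> h c d /esym /h []. Qed.

Lemma linind_revp m p q : (size p <= m.+1)%N -> (size q <= m.+1)%N ->
  linind p q -> linind (revp m p) (revp m q).
Proof.
move=> sp sq h c d e; apply: h; apply/eqP; rewrite -subr_eq0; apply/eqP.
apply: (@revp_eq0 _ m).
  rewrite (leq_trans (size_polyD _ _)) // geq_max size_polyN.
  by rewrite !(leq_trans (size_scale_leq _ _)).
apply/polyP => i; have := congr1 (fun g : {poly C} => g`_i) e.
rewrite !coefZ !coef_poly coef0; case: ifP => // _.
by rewrite coefB !coefZ => ->; rewrite subrr.
Qed.

Lemma size_bipoly m p q r s : (size r <= m.+1)%N -> (size s <= m.+1)%N ->
  (r`_m != 0) || (s`_m != 0) -> linind p q -> size (bipoly p q r s) = m.+1.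
Proof.
move=> sr ss top h; apply/eqP; rewrite eqn_leq; apply/andP; split.
  apply/leq_sizeP => i mi; rewrite coef_bipoly !nth_default ?scale0r ?subrr //.
    exact: leq_trans sr mi.
  exact: leq_trans ss mi.
rewrite ltnNge; apply/negP => /leq_sizeP /(_ m (leqnn m)).
rewrite coef_bipoly => /eqP; rewrite subr_eq0 => /eqP /h [e1 e2].
by move: top; rewrite e1 e2 eqxx.
Qed.

(** The value at x of the binary form of degree N associated to g. *)
Definition hval (N : nat) (x : P1 C) (g : {poly C}) : C :=
  if x is Some a then g.[a] else g`_N.

Definition lcoord u (x : P1 C) : K := if x is Some a then u - iota a else u^-1.

(** For b at infinity, r and s are reversed, v is inverted and b becomes 0, while the values of the
    associated forms are kept. *)
Lemma chart_outer u v p q r s m (b : P1 C) : v != 0 -> linind p q -> linind r s ->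
  (size r <= m.+1)%N -> (size s <= m.+1)%N -> (r`_m != 0) || (s`_m != 0) ->
  divker u v (bipoly p q r s) -> exists r' s' v' b',
  [/\ divker u v' (bipoly p q r' s'), v' - iota b' = lcoord v b, r'.[b'] = hval m b r,
      s'.[b'] = hval m b s & linind r' s'].
Proof.
move=> v0 lpq lrs sr ss top h; case: b => [b|]; first by exists r, s, v, b.
exists (revp m r), (revp m s), v^-1, 0; split.
- by rewrite -revp_bipoly; apply: divker_inv => //; apply: size_bipoly.
- by rewrite rmorph0 subr0.
- by rewrite horner_coef0 coef_poly subn0.
- by rewrite horner_coef0 coef_poly subn0.
- exact: linind_revp.
Qed.

(** The powers of v below n are independent because a nonzero multiple of F has size greater than n;
    pseudo-division by F shows that they span. *)
Lemma deg_over_gen u v F n : size F = n.+1 -> ev2 u v F = 0 -> divker u v F ->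
  (forall z, exists G H, ev2 u v H != 0 /\ z = ev2 u v G / ev2 u v H) ->
  deg_over iota u n.
Proof.
move=> sF F0 hK gen; have Fn0 : F != 0 by rewrite -size_poly_eq0 sF.
have hs (c : nat -> {poly C}) k : ev2 u v (\poly_(i < k) c i) = \sum_(i < k) peval iota u (c i) * v ^+ i.
  rewrite poly_def rmorph_sum /=; apply: eq_bigr => i _.
  by rewrite -mul_polyC rmorphM rmorphXn /= ev2C ev2X.
split.
  exists (fun i => v ^+ i) => p hp i.
  have [|H e] := hK (\poly_(i < n) (if insub i is Some j then p j else 0)).
    rewrite hs -[RHS]hp; apply: eq_bigr => j _; rewrite insubT //=.
    by move=> hj; congr (peval iota u (p _) * _); apply: val_inj.
  have H0 : H = 0.
    apply/eqP; apply: contraT => H0.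
    have : (size (H * F)%R <= n)%N by rewrite -e; apply: size_poly.
    rewrite size_mul // sF addnS; have : (0 < size H)%N by rewrite size_poly_gt0.
    by move: (size H) => k /=; lia.
  have := congr1 (fun g : {poly {poly C}} => g`_i) e.
  rewrite H0 mul0r coef0 coef_poly ltn_ord insubT //= => hi <-.
  by congr p; apply: val_inj.
move=> z; have /choice [G /choice [H hGH]] := fun i => gen (z i).
pose D := \prod_i ev2 u v (H i).
have D0 : D != 0.
  by apply/prodf_neq0 => i _; case: (hGH i).
apply: (@dep_bound _ _ (peval iota u) n.+1 n (fun j => v ^+ j / D)) => // i.
pose G' := G i * \prod_(j | j != i) H j.
have ez : z i = ev2 u v G' / D.
  have [Hi ->] := hGH i; rewrite /G' rmorphM rmorph_prod /=.
  have -> : D = ev2 u v (H i) * \prod_(j | j != i) ev2 u v (H j) by rewrite /D (bigD1 i).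
  have Di0 : \prod_(j | j != i) ev2 u v (H j) != 0.
    by apply/prodf_neq0 => j _; case: (hGH j).
  by rewrite -mulf_div divff ?mulr1.
have eD := Pdiv.Idomain.divp_eq G' F.
have sr : (size (G' %% F)%R <= n)%N by rewrite -ltnS -sF ltn_modp.
exists (lead_coef F ^+ scalp G' F), (fun j => (G' %% F)`_j); split.
  by rewrite expf_neq0 // lead_coef_eq0.
rewrite /= ez mulrA -(ev2C u v) -rmorphM /= mul_polyC eD.
rewrite rmorphD rmorphM /= F0 mulr0 add0r ev2E (horner_coef_wide _ (n := n)); last first.
  exact: leq_trans (size_poly _ _) sr.
by rewrite big_distrl /=; apply: eq_bigr => j _; rewrite coef_map mulrA.
Qed.

End BivariateEvaluation.

(** * Ramification of the curve A(x) = B(y) *)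

Section Charts.

Variables (C : closedFieldType) (K : fieldType) (iota : {rmorphism C -> K}).
Implicit Types (f : ratfun C) (u : K) (P : place iota).

Lemma linind_ratfun f : (0 < ratdeg f)%N -> linind (ratnum f) (ratden f).
Proof.
move=> n0 c d e; have [q0 _ _] := ratfun_spec f.
have [c0|c0] := eqVneq c 0.
  split => //; move/esym/eqP: e; rewrite c0 scale0r scaler_eq0 (negbTE q0) orbF.
  by move/eqP.
have := fibpoly_neq0 n0 (Some (d / c)); rewrite /= subr_eq0 => /negP []; apply/eqP.
by apply: (scalerI c0); rewrite e scalerA mulrCA mulfV // mulr1.
Qed.

Lemma top_ratfun f : (0 < ratdeg f)%N ->
  ((ratnum f)`_(ratdeg f) != 0) || ((ratden f)`_(ratdeg f) != 0).
Proof.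
move=> n0; have [q0 _ _] := ratfun_spec f; have p0 := ratnum_neq0 n0.
case: (ltnP (size (ratden f)) (size (ratnum f))) => h.
  by rewrite (ratdeg_num h) -lead_coefE lead_coef_eq0 p0.
by rewrite (ratdeg_den h) -[X in _ || (X != 0)]lead_coefE lead_coef_eq0 q0 orbT.
Qed.

Lemma hval_fiber f a : (0 < ratdeg f)%N ->
  hval (ratdeg f) a (fibpoly f (rateval f a)) = 0.
Proof.
move=> n0; have g0 := fibpoly_neq0 n0 (rateval f a).
have := (fibmult_gt0 n0 a (rateval f a)).2 erefl.
move: g0; move: (fibpoly f _) => g; case: a => [a|] g0; rewrite /fibmult /=.
  by rewrite -XsubC_dvd // dvdp_XsubCl => /rootP.
rewrite subn_gt0 => h; apply: nth_default; move: h g0; rewrite -size_poly_gt0.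
by move: (size g) => k; lia.
Qed.

(** The quotient of the two polynomials at u is f(u) followed by a Moebius map that sends f(a) to 0
    and [z'] to infinity. *)
Lemma pval_fibers f u P a z' : (forall g, g != 0 -> peval iota u g != 0) ->
  (0 < ratdeg f)%N -> vge P (lcoord iota u a) 1 -> z' <> rateval f a ->
  P (peval iota u (fibpoly f (rateval f a))) - P (peval iota u (fibpoly f z')) =
  (locdeg f a)%:Z * P (lcoord iota u a).
Proof.
move=> tu n0 hv ne; rewrite (locdegE n0).
have g0 := fibpoly_neq0 n0 (rateval f a); have g'0 := fibpoly_neq0 n0 z'.
have e' := fibmult_eq0 n0 (nesym ne).
have sz' := size_fibpoly f z'.
have u0 : u != 0 by have := tu 'X; rewrite peX polyX_eq0; apply.
case: a hv e' ne g0 => [a|] hv e' ne; set g := fibpoly f (rateval f _) => g0.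
  have ua : u - iota a != 0.
    by rewrite -peXsubC; apply: tu; rewrite polyXsubC_eq0.
  have [_ ->] := pval_pe_mup ua hv g0; have [_ ->] := pval_pe_mup ua hv g'0.
  by move: e'; rewrite /fibmult => ->; rewrite mul0r subr0.
move: hv => /= /(vgeP (invr_neq0 u0)); rewrite pvalV => hv.
have Pu : P u < 0 by lia.
have [_ ->] := pval_pe_pole Pu g0; have [_ ->] := pval_pe_pole Pu g'0.
have sg := size_fibpoly f (rateval f None); rewrite -/g in sg.
move: e' sz' sg g0 g'0; rewrite /fibmult -!size_poly_gt0.
move: (size g) (size (fibpoly f z')) (ratdeg f) (P u) => i j k l; clear.
move=> h1 h2 h3 h4 h5; have -> : j.-1 = k by lia.
have -> : (k - i.-1)%N%:Z = k%:Z - i.-1%:Z by lia.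
ring.
Qed.

End Charts.

(** * Places of the curve and their ramification over the y-line *)

Section Curve.

Variables (C : closedFieldType) (A B : ratfun C) (K : fieldType)
  (phi : {rmorphism {poly {poly C}} -> K}).
Hypotheses (char0 : forall k : nat, (k.+1%:R : C) != 0)
  (n0 : (0 < ratdeg A)%N) (m0 : (0 < ratdeg B)%N)
  (funK : function_field (curveE A B) phi).

Local Notation n := (ratdeg A).
Local Notation m := (ratdeg B).

(** Convertible to the embedding in [curve_genus]; the composition carries the morphism
    structure. *)
Definition curve_cst : C -> K := phi \o (polyC \o polyC).
HB.instance Definition _ := GRing.RMorphism.on curve_cst.
Definition curve_x : K := phi 'X%:P.
Definition curve_y : K := phi 'X.

Lemma phiE G : phi G = ev2 curve_cst curve_x curve_y G.
Proof.
have inner g : phi g%:P = peval curve_cst curve_x g.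
  rewrite -[g]coefK poly_def [in RHS]rmorph_sum /= (raddf_sum polyC) rmorph_sum /=.
  apply: eq_bigr => i _; rewrite peZ [peval _ _ _]rmorphXn /= peX -mul_polyC polyCM.
  by rewrite rmorphM polyC_exp rmorphXn.
rewrite -[G]coefK poly_def !rmorph_sum /=; apply: eq_bigr => i _.
by rewrite -mul_polyC !rmorphM !rmorphXn /= ev2C ev2X inner.
Qed.

Local Notation F := (bipoly (ratnum A) (ratden A) (ratnum B) (ratden B)).

Lemma curve_divker : divker curve_cst curve_x curve_y F.
Proof. by move=> G; rewrite -phiE; apply: (funK.1 G).1. Qed.

Lemma curve_eq : ev2 curve_cst curve_x curve_y F = 0.
Proof. by rewrite -phiE; apply/(funK.1 _).2; exists 1; rewrite mul1r. Qed.

Lemma size_curve : size F = m.+1.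
Proof.
apply: size_bipoly; [exact: size_ratnum|exact: size_ratden|exact: top_ratfun|].
exact: linind_ratfun.
Qed.

Lemma deg_over_curve_y : deg_over curve_cst curve_y n.
Proof.
apply: (@deg_over_gen _ _ curve_cst curve_y curve_x (swapXY F)).
- rewrite swap_bipoly; apply: size_bipoly; [exact: size_ratden|exact: size_ratnum| |].
    by rewrite orbC; apply: top_ratfun.
  by apply: linind_sym; apply: linind_ratfun.
- by rewrite -ev2_swap curve_eq.
- by apply: divker_swap; apply: curve_divker.
- move=> z; have [G [H [H0 ->]]] := funK.2 z; exists (swapXY G), (swapXY H).
  by rewrite -!ev2_swap -!phiE.
Qed.

Lemma curve_x_transc g : g != 0 -> peval curve_cst curve_x g != 0.
Proof.
move=> g0; apply/eqP => e; have [|H eH] := curve_divker (G := g%:P); first by rewrite ev2C.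
have F0 : F != 0 by rewrite -size_poly_eq0 size_curve.
have H0 : H != 0.
  by apply: contra_neq g0 => H0; apply/eqP; rewrite -polyC_eq0 eH H0 mul0r.
have := congr1 (fun G : {poly {poly C}} => size G) eH.
rewrite size_polyC g0 size_mul // size_curve.
have : (0 < size H)%N by rewrite size_poly_gt0.
by move: m0; move: (size H) (ratdeg B) => i j; lia.
Qed.

Lemma curve_y_transc g : g != 0 -> peval curve_cst curve_y g != 0.
Proof. exact: deg_over_neq0 n0 deg_over_curve_y. Qed.

Lemma lcoord_neq0 u (a : P1 C) : (forall g, g != 0 -> peval curve_cst u g != 0) ->
  lcoord curve_cst u a != 0.
Proof.
move=> h; case: a => [a|] /=.
  by rewrite -peXsubC; apply: h; rewrite polyXsubC_eq0.
by rewrite invr_eq0; have := h 'X; rewrite peX polyX_eq0; apply.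
Qed.

(** One chart for y and, after a swap, one for x bring a and b to finite points of a curve of the
    same shape, where [divker_proper] applies. *)
Lemma curve_place (a b : P1 C) : rateval A a = rateval B b ->
  exists P : place curve_cst, vge P (lcoord curve_cst curve_x a) 1 /\ vge P (lcoord curve_cst curve_y b) 1.
Proof.
move=> eab.
have cx0 : curve_x != 0 by have := curve_x_transc (g := 'X); rewrite peX polyX_eq0; apply.
have cy0 : curve_y != 0 by have := curve_y_transc (g := 'X); rewrite peX polyX_eq0; apply.
have lA := linind_ratfun n0; have lB := linind_ratfun m0.
have [r [s [y [b' [h1 eb er es lrs]]]]] := chart_outer b cy0 lA lB
  (size_ratnum B) (size_ratden B) (top_ratfun m0) curve_divker.
have := divker_swap h1; rewrite swap_bipoly => h2.
have topA : ((ratden A)`_n != 0) || ((ratnum A)`_n != 0) by rewrite orbC top_ratfun.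
have [q [p [x [a' [h3 ea eq ep _]]]]] := chart_outer a cx0 (linind_sym lrs)
  (linind_sym lA) (size_ratden A) (size_ratnum A) topA h2.
have := divker_swap h3; rewrite swap_bipoly => h4.
have van : p.[a'] * s.[b'] - q.[a'] * r.[b'] = 0.
  rewrite ep es eq er.
  have hA := hval_fiber a n0; have := hval_fiber b m0; rewrite -eab => hB.
  have hv N (x0 : P1 C) c g h : hval N x0 (g - c *: h) = hval N x0 g - c * hval N x0 h.
    by case: x0 => [x0|] /=; rewrite ?hornerE ?coefB ?coefZ.
  case ez: (rateval A a) => [c|]; move: hA hB; rewrite ez /= ?hv.
    move=> /eqP; rewrite subr_eq0 => /eqP -> /eqP; rewrite subr_eq0 => /eqP ->; ring.
  by move=> -> ->; rewrite mulr0 mul0r subrr.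
have := divker_proper h4 (a := a') (b := b'); rewrite horner_bipoly => /(_ van).
rewrite ea eb => pp.
by apply: (place_exists n0 deg_over_curve_y _ pp); apply: lcoord_neq0; apply: curve_x_transc.
Qed.

Lemma curve_pval (a b : P1 C) (P : place curve_cst) : rateval A a = rateval B b ->
  vge P (lcoord curve_cst curve_x a) 1 -> vge P (lcoord curve_cst curve_y b) 1 ->
  (locdeg A a)%:Z * P (lcoord curve_cst curve_x a) = (locdeg B b)%:Z * P (lcoord curve_cst curve_y b).
Proof.
move=> eab ha hb.
have := curve_eq; rewrite ev2_bipoly => /eqP; rewrite subr_eq0 => /eqP e.
(* A second fiber serves as denominator: the equation of the curve becomes an equality of quotients
   vanishing at a and at b. *)
pose z' : P1 C := if rateval A a is Some _ then None else Some 0.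
have ne : z' <> rateval A a by rewrite /z'; case: (rateval A a).
have ne' : z' <> rateval B b by rewrite -eab.
rewrite -(pval_fibers curve_x_transc n0 ha ne) -(pval_fibers curve_y_transc m0 hb ne') -eab.
have tA z : peval curve_cst curve_x (fibpoly A z) != 0 by apply: curve_x_transc; apply: fibpoly_neq0.
have tB z : peval curve_cst curve_y (fibpoly B z) != 0 by apply: curve_y_transc; apply: fibpoly_neq0.
have cross : peval curve_cst curve_x (fibpoly A (rateval A a)) * peval curve_cst curve_y (fibpoly B z') =
    peval curve_cst curve_x (fibpoly A z') * peval curve_cst curve_y (fibpoly B (rateval A a)).
  rewrite /z'; case: (rateval A a) => [c|] /=.
    by rewrite !rmorphB /= !peZ mulrBl mulrBr e; ring.
  by rewrite !scale0r !subr0 e.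
have := congr1 (P : K -> int) cross; rewrite !pvalM // => h.
by apply/eqP; rewrite subr_eq addrAC eq_sym subr_eq eq_sym [X in _ == X]addrC; apply/eqP.
Qed.

Lemma curve_ramified (a b : P1 C) : rateval A a = rateval B b ->
  ~~ (locdeg A a %| locdeg B b)%N -> exists P : place curve_cst, 2 <= P (lcoord curve_cst curve_y b).
Proof.
move=> eab nd; have [P [ha hb]] := curve_place eab; exists P.
have := curve_pval eab ha hb.
have ha' := vgeP (lcoord_neq0 a curve_x_transc) ha.
have hb' := vgeP (lcoord_neq0 b curve_y_transc) hb.
move=> e; rewrite leNgt; apply/negP => lt.
have e1 : P (lcoord curve_cst curve_y b) = 1.
  by apply/eqP; rewrite eq_le hb' andbT -ltzD1; exact: lt.
move: e; rewrite e1 mulr1 => e; case/negP: nd; apply/dvdnP.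
exists `|P (lcoord curve_cst curve_x a)|%N; move: e ha'; move: (P _) (locdeg A a) (locdeg B b) => i j k.
by case: i => // i e _; apply/eqP; rewrite -eqz_nat -e mulnC.
Qed.

(* The coordinate 1 / (y - c), for c generic, makes all the points of s finite. *)
Lemma ramified_points (s : seq (P1 C)) : uniq s ->
  (forall b, b \in s -> exists a, rateval A a = rateval B b /\
     ~~ (locdeg A a %| locdeg B b)%N) ->
  (size s)%:Z <= 2 * ((genus curve_cst)%:Z + n%:Z - 1).
Proof.
move=> us hs; have [c cs] := fresh_point (pmap id s).
have Sc : Some c \notin s.
  apply: contra cs => cs; rewrite mem_pmap; apply/mapP; by exists (Some c).
have hw : deg_over curve_cst (curve_y - curve_cst c)^-1 n.
  by apply: deg_over_inv => //; apply: deg_over_shift; apply: deg_over_curve_y.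
pose t (b : P1 C) : C := if b is Some b then (b - c)^-1 else 0.
have bc b : Some b \in s -> b - c != 0.
  by move=> bs; rewrite subr_eq0; apply: contraNneq Sc => <-.
have ti : {in s &, injective t}.
  case=> [b|] [b'|] //= h1 h2.
  - by move=> /invr_inj /addIr ->.
  - by move=> /eqP; rewrite invr_eq0 (negbTE (bc _ h1)).
  - by move=> /esym /eqP; rewrite invr_eq0 (negbTE (bc _ h2)).
rewrite -(size_map t s); apply: (ramified_le_genus char0 n0 hw).
  by rewrite map_inj_in_uniq.
move=> _ /mapP [b bs ->]; have [a [eab nd]] := hs _ bs.
have [P hP] := curve_ramified eab nd; exists P.
have ycn : curve_y - curve_cst c != 0 := lcoord_neq0 (Some c) curve_y_transc.
case: b bs hP {eab nd} => [b|] bs hP /=; last first.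
  have Py : P curve_y < 0 by move: hP; rewrite /= pvalV; move: (P curve_y) => k; lia.
  rewrite rmorph0 subr0 pvalV.
  have -> : P (curve_y - curve_cst c) = P curve_y.
    apply: pval_add_eq; first by rewrite -invr_eq0; exact: (lcoord_neq0 None curve_y_transc).
    apply: vgeN; apply: vgeW (vge_const (iota := curve_cst) P c).
    by move: Py; move: (P curve_y) => k; lia.
  by move: hP; rewrite /= pvalV.
have ybn : curve_y - curve_cst b != 0 := lcoord_neq0 (Some b) curve_y_transc.
have bcn : curve_cst (b - c) != 0 by rewrite fmorph_eq0 bc.
(* As b differs from c, [y - c] has value 0 at a zero of [y - b]; the new coordinate minus its value
   at b thus has the same value as [y - b]. *)
have -> : (curve_y - curve_cst c)^-1 - curve_cst (b - c)^-1 = - ((curve_y - curve_cst b) / ((curve_y - curve_cst c) * curve_cst (b - c))).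
  have := bcn; rewrite fmorphV rmorphB => h; field; by rewrite h ycn.
rewrite pvalN pval_div ?mulf_neq0 // pvalM // (pval_const P (bc _ bs)) addr0.
have -> : P (curve_y - curve_cst c) = 0.
  have -> : curve_y - curve_cst c = curve_cst (b - c) + (curve_y - curve_cst b) by rewrite rmorphB; ring.
  rewrite pval_add_eq //; rewrite (pval_const P (bc _ bs)) //.
  by right; move: hP => /=; move: (P _) => k; lia.
by rewrite subr0.
Qed.

End Curve.

(** * The genus inequality *)

(** With denominators cleared: 1/a + 1/b + 1/c below 1 is at most 41/42, attained at (2, 3, 7). The
    other cases stay below: 3/4 for a at least 4, 11/12 for a = 3, 19/20 for a = 2 and b at least
    4. *)
Lemma hyperbolic_triple_sorted (a b c : nat) : (2 <= a)%N -> (a <= b)%N -> (b <= c)%N ->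
  (b * c + a * c + a * b < a * b * c)%N ->
  (42 * (b * c + a * c + a * b) <= 41 * (a * b * c))%N.
Proof.
move=> a2 ab bc h; case: (ltnP 3 a) => a4.
  have h1 : (4 * (b * c) <= a * (b * c))%N by rewrite leq_mul2r a4 orbT.
  have h2 : (4 * (a * c) <= b * (a * c))%N by rewrite leq_mul2r (leq_trans a4 ab) orbT.
  have h3 : (4 * (a * b) <= c * (a * b))%N.
    by rewrite leq_mul2r (leq_trans a4 (leq_trans ab bc)) orbT.
  have e : (a * (b * c) = a * b * c)%N by rewrite mulnA.
  have e' : (b * (a * c) = a * b * c)%N by rewrite mulnCA mulnA.
  have e'' : (c * (a * b) = a * b * c)%N by rewrite mulnC.
  move: e e' e'' h1 h2 h3; clear => -> -> ->; lia.
have [a23|a23] : a = 2%N \/ a = 3%N by lia.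
  rewrite a23 in h a4 ab *; case: (ltnP 4 b) => b5.
    have : (5 * c <= b * c)%N by rewrite leq_mul2r b5 orbT.
    lia.
  have [e|[e|e]] : b = 2%N \/ b = 3%N \/ b = 4%N by lia.
  - by rewrite e in h *; lia.
  - by rewrite e in h *; lia.
  - by rewrite e in h *; lia.
rewrite a23 in h a4 ab *; case: (ltnP 3 b) => b4.
  have : (4 * c <= b * c)%N by rewrite leq_mul2r b4 orbT.
  lia.
have e : b = 3%N by lia.
by rewrite e in h *; lia.
Qed.

Lemma hyperbolic_triple (a b c : nat) : (2 <= a)%N -> (2 <= b)%N -> (2 <= c)%N ->
  (b * c + a * c + a * b < a * b * c)%N ->
  (42 * (b * c + a * c + a * b) <= 41 * (a * b * c))%N.
Proof.
wlog ab : a b / (a <= b)%N => [H|].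
  move=> a2 b2 c2 h; case: (leqP a b) => [ab|/ltnW ba]; first exact: H.
  have := H b a ba b2 a2 c2; rewrite [(b * a)%N]mulnC [(a * c + _)%N]addnC.
  by apply.
wlog bc : a b c ab / (b <= c)%N => [H|].
  move=> a2 b2 c2 h; case: (leqP b c) => [bc|/ltnW cb]; first exact: H.
  case: (leqP a c) => [ac|/ltnW ca].
    have := H a c b ac cb a2 c2 b2.
    by rewrite [(c * b)%N]mulnC [(a * c * b)%N]mulnAC -addnA [(a * b + _)%N]addnC addnA; apply.
  have := H c a b ca ab c2 a2 b2.
  rewrite (_ : (c * a * b = a * b * c)%N); last by rewrite [(a * b * c)%N]mulnC mulnA.
  rewrite (_ : (a * b + c * b + c * a = b * c + a * c + a * b)%N); last by lia.
  by apply.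
by move=> a2 b2 c2; apply: hyperbolic_triple_sorted.
Qed.

(** Entries 1 contribute nothing, and at least three others are needed. Beyond triples, (2, 2, 2, 2)
    gives exactly 2 and is excluded; any other choice gives at least 2 + 1/6. *)
Lemma hyperbolic_gap (s : seq nat) : (forall k, k \in s -> 0 < k)%N ->
  2 < \sum_(k <- s) (1 - k%:R^-1 : rat) -> 2 + 42^-1 <= \sum_(k <- s) (1 - k%:R^-1 : rat).
Proof.
move=> pos; pose t := [seq k <- s | (1 < k)%N].
have -> : \sum_(k <- s) (1 - k%:R^-1 : rat) = \sum_(k <- t) (1 - k%:R^-1).
  rewrite /t big_filter [RHS]big_mkcond /= big_seq [RHS]big_seq.
  by apply: eq_bigr => -[|[|k]] ks; rewrite ?invr1 ?subrr //; have := pos _ ks.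
have {pos} : all (leq 2) t by apply: filter_all.
clearbody t; clear s.
have half (k : nat) : (2 <= k)%N -> (1/2 : rat) <= 1 - k%:R^-1.
  move=> k2; have : (k%:R^-1 : rat) <= 2%:R^-1 by rewrite lef_pV2 ?posrE ?ltr0n ?ler_nat //; lia.
  by lra.
have third (k : nat) : (3 <= k)%N -> (2/3 : rat) <= 1 - k%:R^-1.
  move=> k2; have : (k%:R^-1 : rat) <= 3%:R^-1 by rewrite lef_pV2 ?posrE ?ltr0n ?ler_nat //; lia.
  by lra.
have lt1 (k : nat) : (2 <= k)%N -> 1 - k%:R^-1 < 1 :> rat.
  move=> k2; have : (0 : rat) < k%:R^-1 by rewrite invr_gt0 ltr0n; lia.
  by lra.
case: t => [|a [|b [|c [|d t]]]] /=; rewrite ?big_cons ?big_nil.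
- by move=> _; lra.
- by case/andP => /lt1 ? _; lra.
- by case/and3P => /lt1 ? /lt1 ? _; lra.
- case/and4P => a2 b2 c2 _ h.
  have abc0 : (0 < a * b * c)%N by rewrite !muln_gt0; lia.
  have a0 : (a%:R : rat) != 0 by rewrite pnatr_eq0; lia.
  have b0 : (b%:R : rat) != 0 by rewrite pnatr_eq0; lia.
  have c0 : (c%:R : rat) != 0 by rewrite pnatr_eq0; lia.
  have e : a%:R^-1 + b%:R^-1 + c%:R^-1 = (b * c + a * c + a * b)%N%:R / (a * b * c)%N%:R :> rat.
    by rewrite !natrD !natrM; field; rewrite a0 b0 c0.
  have h1 : a%:R^-1 + b%:R^-1 + c%:R^-1 < 1 :> rat by lra.
  have h2 : (b * c + a * c + a * b < a * b * c)%N.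
    by move: h1; rewrite e ltr_pdivrMr ?ltr0n // mul1r ltr_nat.
  have h3 := hyperbolic_triple a2 b2 c2 h2.
  have h4 : a%:R^-1 + b%:R^-1 + c%:R^-1 <= 41 / 42 :> rat.
    rewrite e; move: abc0 h3; clear; move: (a * b * c)%N (b * c + a * c + a * b)%N => x y.
    move=> x0; rewrite -(ler_nat rat) (natrM _ 42) (natrM _ 41) => h3.
    rewrite ler_pdivrMr; last by rewrite ltr0n.
    by lra.
  by lra.
- move=> /and5P [a2 b2 c2 d2 t2] h.
  have t0 : 0 <= \sum_(k <- t) (1 - k%:R^-1 : rat).
    rewrite big_seq; apply: sumr_ge0 => k kt; have := half k (allP t2 _ kt); lra.
  have hs : (t != [::]) -> (1/2 : rat) <= \sum_(k <- t) (1 - k%:R^-1).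
    case: t t2 t0 {h} => // k t /andP [k2 t2] _ _; rewrite big_cons.
    have := half _ k2; have : 0 <= \sum_(k <- t) (1 - k%:R^-1 : rat); last by lra.
    rewrite big_seq; apply: sumr_ge0 => j jt; have := half j (allP t2 _ jt); lra.
  have := half _ a2; have := half _ b2; have := half _ c2; have := half _ d2.
  have [te|tn] := eqVneq t [::]; last by have := hs tn; lra.
  move: h; rewrite te big_nil => h ha hb hc hd.
  have [|] := leqP 3 a; first by move/third => h3; lra.
  have [|] := leqP 3 b; first by move=> /third h3 _; lra.
  have [|] := leqP 3 c; first by move=> /third h3 _ _; lra.
  have [|] := leqP 3 d; first by move=> /third h3 _ _ _; lra.
  move=> d3 c3 b3 a3; exfalso; move: h.
  have -> : a = 2%N by lia.
  have -> : b = 2%N by lia.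
  have -> : c = 2%N by lia.
  have -> : d = 2%N by lia.
  by lra.
Qed.

Section MainInequality.

Variable C : closedFieldType.
Implicit Types (f : ratfun C).

Lemma nu2_gt0 f z : (0 < ratdeg f)%N -> (0 < nu2 f z)%N.
Proof.
move=> n0; apply: (big_ind (fun k => 0 < k)%N) => // [k l k0 l0|x _].
  by rewrite lcmn_gt0 k0.
exact: locdeg_gt0.
Qed.

Lemma nu2_dvd f z k : (forall x, rateval f x = z -> (locdeg f x %| k)%N) -> (nu2 f z %| k)%N.
Proof.
(* If the support is infinite, the big operator has its default value 1, which divides k as well. *)
move=> h; rewrite /nu2; case: finite_supportP => [_|X sub _ _].
  by rewrite big_nil dvd1n.
rewrite big_seq; apply: (big_ind (fun l => l %| k)%N) => [|i j hi hj|x xX].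
- exact: dvd1n.
- by rewrite dvdn_lcm hi hj.
- by apply: h; apply: (sub x).
Qed.

Lemma chi2_sum f : exists2 s : seq (P1 C), uniq s &
  chi2 f = 2 - \sum_(z <- s) (1 - (nu2 f z)%:R^-1).
Proof.
exists (finite_support 0 [set: P1 C]%classic (fun z => (nu2 f z)%:R^-1 - 1 : rat)).
  exact: finite_support_uniq.
by rewrite /chi2 -sumrN; congr (_ + _); apply: eq_bigr => z _; rewrite opprB.
Qed.

(** Each value z with [nu2 f z] different from 1 has a critical point above it, so there are at most
    2 n - 2 of them, each contributing at most 1. For n at most 2 this leaves chi nonnegative. *)
Lemma chi2_neg_deg f : (forall k : nat, (k.+1%:R : C) != 0) -> (0 < ratdeg f)%N ->
  chi2 f < 0 -> (2 < ratdeg f)%N.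
Proof.
move=> char0 n0; have [s us ->] := chi2_sum f => h; rewrite ltnNge; apply/negP => n2.
pose t := [seq z <- s | nu2 f z != 1%N].
have ex z : exists x, z \in t -> rateval f x = z /\ (1 < locdeg f x)%N.
  case: (boolP (z \in t)) => [|_]; last by exists None.
  rewrite mem_filter => /andP [nz _]; apply: contrapT => hx.
  case/eqP: nz; apply/eqP; rewrite -dvdn1; apply: nu2_dvd => x ex.
  rewrite dvdn1; apply: contraT => l1; exfalso; apply: hx; exists x => _; split => //.
  by have := locdeg_gt0 n0 x; move: l1; case: (locdeg f x) => [|[|]].
case/choice: ex => x hx.
have ux : uniq [seq x z | z <- t].
  rewrite map_inj_in_uniq ?filter_uniq // => z1 z2 /hx [e1 _] /hx [e2 _] e.
  by rewrite -e1 -e2 e.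
have := riemann_hurwitz_P1 n0 char0 ux; rewrite big_map.
have : (size t <= \sum_(z <- t) (locdeg f (x z) - 1))%N.
  rewrite -sum1_size big_seq [X in (_ <= X)%N]big_seq; apply: leq_sum => z zt.
  by have [_] := hx _ zt; move: (locdeg _ _) => l; lia.
have st : \sum_(z <- s) (1 - (nu2 f z)%:R^-1 : rat) <= (size t)%:R.
  rewrite size_filter -sum1_count natr_sum [X in _ <= X]big_mkcond /=.
  apply: ler_sum => z _; case: eqP => [->|_] /=; first by rewrite invr1 subrr.
  by rewrite lerBlDr lerDl invr_ge0 ler0n.
move: (\sum_(z <- t) _)%N => X h1 h2.
have : (size t <= 2)%N by lia.
by rewrite -(ler_nat rat) => h3; lra.
Qed.

(* At a good point the local degree is at least nu(z), at a bad one at least 1;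
   either way (locdeg - 1) >= (1 - 1 / nu) (locdeg - [bad]), and summing over the
   fibers, the Riemann-Hurwitz formula for B bounds the number of bad points. *)
Lemma bad_points_count (A B : ratfun C) (Z : seq (P1 C)) (k : rat) :
  (forall k : nat, (k.+1%:R : C) != 0) -> (0 < ratdeg A)%N -> (0 < ratdeg B)%N ->
  uniq Z -> 2 <= k -> k <= \sum_(z <- Z) (1 - (nu2 A z)%:R^-1) ->
  exists s : seq (P1 C), [/\ uniq s,
    forall b, b \in s -> exists a, rateval A a = rateval B b /\
      ~~ (locdeg A a %| locdeg B b)%N &
    (ratdeg B)%:R * (k - 2) + 2 < (size s)%:R :> rat].
Proof.
move=> char0 n0 m0 uZ k2 gap; set m := ratdeg B in m0 *.
have /choice [fb hfb] := ratfun_fiber m0.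
pose S0 := flatten [seq fb z | z <- Z].
have uS0 : uniq S0.
  rewrite /S0; elim: Z uZ {gap S0} => //= z Z IH /andP [zZ /IH {}IH].
  rewrite cat_uniq IH andbT; have [-> /= hz _] := hfb z.
  apply/hasPn => b /flatten_mapP [z' z'Z bz']; apply/negP => /hz ez.
  by have [_ hz' _] := hfb z'; move/hz': bz'; rewrite ez => e; rewrite e z'Z in zZ.
pose bad b := ~~ (nu2 A (rateval B b) %| locdeg B b)%N.
exists [seq b <- S0 | bad b]; split; first exact: filter_uniq.
  move=> b; rewrite mem_filter => /andP [hb _]; apply: contrapT => h.
  case/negP: hb; apply: nu2_dvd => a ea; apply: contraT => nd; exfalso.
  by apply: h; exists a.
pose c z : rat := 1 - (nu2 A z)%:R^-1.
have nup z : (0 : rat) < (nu2 A z)%:R^-1 by rewrite invr_gt0 ltr0n nu2_gt0.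
have nu1 z : (nu2 A z)%:R^-1 <= 1 :> rat.
  by rewrite invf_le1 ?ltr0n ?nu2_gt0 // ler1n nu2_gt0.
pose W z : rat := \sum_(b <- fb z) (bad b)%:R.
have term z b : rateval B b = z ->
    c z * ((locdeg B b)%:R - (bad b)%:R) <= (locdeg B b)%:R - 1.
  move=> ez; have l0 : (1 : rat) <= (locdeg B b)%:R by rewrite ler1n locdeg_gt0.
  have := nup z; have := nu1 z; rewrite /c /bad ez.
  have [dv|_] /= := boolP (nu2 A z %| locdeg B b)%N; last by nra.
  have : (nu2 A z)%:R <= (locdeg B b)%:R :> rat.
    by rewrite ler_nat dvdn_leq // locdeg_gt0.
  have n0' : (nu2 A z)%:R != 0 :> rat by rewrite pnatr_eq0 -lt0n nu2_gt0.
  move=> le _ pz; rewrite subr0 mulrBl mul1r lerD2l lerN2.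
  by rewrite -[X in X <= _](mulVf n0') ler_pM2l.
have fiber z : c z * (m%:R - W z) <= \sum_(b <- fb z) ((locdeg B b)%:R - 1).
  have [_ hz sz] := hfb z.
  have -> : m%:R = \sum_(b <- fb z) (locdeg B b)%:R :> rat by rewrite -natr_sum sz.
  rewrite /W -sumrB big_distrr /= big_seq [X in _ <= X]big_seq.
  by apply: ler_sum => b /hz; apply: term.
have RH : \sum_(z <- Z) \sum_(b <- fb z) ((locdeg B b)%:R - 1 : rat) + 2 <= 2 * m%:R.
  have := riemann_hurwitz_P1 m0 char0 uS0; rewrite -(ler_nat rat) natrD natrM natr_sum.
  rewrite /S0 big_flatten /= big_map.
  congr (_ + _ <= _); apply: eq_bigr => z _; apply: eq_bigr => b _.
  by rewrite natrB // locdeg_gt0.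
have sS : (size [seq b <- S0 | bad b])%:R = \sum_(z <- Z) W z.
  rewrite size_filter -sum1_count natr_sum big_mkcond /S0 big_flatten /= big_map.
  by apply: eq_bigr => z _; apply: eq_bigr => b _; case: (bad b).
rewrite sS.
have W0 z : 0 <= W z by apply: sumr_ge0.
have le1 : \sum_(z <- Z) c z * (m%:R - W z) <=
    \sum_(z <- Z) \sum_(b <- fb z) ((locdeg B b)%:R - 1 : rat).
  by apply: ler_sum => z _; apply: fiber.
have eq1 : \sum_(z <- Z) c z * (m%:R - W z) =
    m%:R * \sum_(z <- Z) c z - \sum_(z <- Z) W z + \sum_(z <- Z) (nu2 A z)%:R^-1 * W z.
  rewrite big_distrr /= -sumrB -big_split /=; apply: eq_bigr => z _.
  by rewrite /c; ring.
have m1 : (1 : rat) <= m%:R by rewrite ler1n.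
have big : m%:R * k <= m%:R * \sum_(z <- Z) c z :> rat by rewrite ler_pM2l // ltr0n.
have big2 : m%:R * 2 <= m%:R * k by rewrite ler_pM2l // ltr0n.
have nn : 0 <= \sum_(z <- Z) (nu2 A z)%:R^-1 * W z.
  by apply: sumr_ge0 => z _; rewrite mulr_ge0 // ltW.
(* This sum makes the inequality strict. If it is 0 there are no bad points, and Riemann-Hurwitz
   would give m k at most 2 m - 2, against k at least 2. *)
have [nz|nz] := eqVneq (\sum_(z <- Z) (nu2 A z)%:R^-1 * W z) 0; last first.
  have : 0 < \sum_(z <- Z) (nu2 A z)%:R^-1 * W z by rewrite lt0r nz nn.
  by move: (\sum_(z <- Z) (nu2 A z)%:R^-1 * W z) eq1 => X eq1 X0; lra.
exfalso; have Wz : \sum_(z <- Z) W z = 0.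
  have := nz; rewrite big_seq => /eqP; rewrite psumr_eq0; last first.
    by move=> z _; rewrite mulr_ge0 // ltW.
  move=> /allP h; rewrite big_seq big1 // => z zZ; have := h z zZ.
  by rewrite zZ /= mulf_eq0 (gt_eqF (nup z)) => /eqP.
by move: eq1; rewrite nz Wz; lra.
Qed.

End MainInequality.

Theorem theorem3p1 (R : realType) (A B : ratfun R[i]) (n m : nat)
    (n_gt0 : (0 < n)%N) (degA : ratdeg A = n) (chiA : chi2 A < 0)
    (degB : ratdeg B = m) (irrE : irreducible_elt (curveE A B))
    (K : fieldType) (phi : {rmorphism {poly {poly R[i]}} -> K})
    (funK : function_field (curveE A B) phi) :
  (m%:R - 84 * n%:R + 168) / 168 < (curve_genus phi)%:R :> rat.
Proof.
have char0 (k : nat) : (k.+1%:R : R[i]) != 0 by rewrite pnatr_eq0.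
rewrite -degA in n_gt0 *; rewrite -{}degB.
have g0 : 0 <= (curve_genus phi)%:R :> rat by rewrite ler0n.
have [small|large] := ltP ((ratdeg B)%:R - 84 * (ratdeg A)%:R + 168 : rat) 0; first by lra.
(* For constant B, [chi2_neg_deg] gives n > 2, so 168 - 84 n is negative, against [large]. *)
have [m0|m_gt0] := posnP (ratdeg B).
  exfalso; have := chi2_neg_deg char0 n_gt0 chiA; rewrite -(ler_nat rat) => h.
  by move: large; rewrite m0; lra.
have [Z uZ eZ] := chi2_sum A; rewrite eZ subr_lt0 in chiA.
have [s [us hs lt]] : exists s : seq (P1 R[i]), [/\ uniq s,
    forall b, b \in s -> exists a, rateval A a = rateval B b /\
      ~~ (locdeg A a %| locdeg B b)%N &
    (ratdeg B)%:R * ((2 + 42^-1) - 2) + 2 < (size s)%:R :> rat].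
  apply: (bad_points_count char0 n_gt0 m_gt0 uZ); first by rewrite lerDl invr_ge0 ler0n.
  rewrite -(big_map (nu2 A) xpredT (fun k : nat => 1 - k%:R^-1 : rat)).
  apply: hyperbolic_gap; last by rewrite big_map.
  by move=> k /mapP [z _ ->]; apply: nu2_gt0.
(* With [lt] this gives g > (m - 84 n + 168) / 84; by [large] the numerator is nonnegative, so
   halving the bound keeps the inequality. *)
have := ramified_points char0 n_gt0 m_gt0 funK us hs.
rewrite -[genus _]/(curve_genus phi) -(ler_int rat) rmorphM rmorphB rmorphD /= => h.
move: h lt; rewrite -!pmulrn; lra.
Qed.
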